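(* Let $\Lambda$ be an Artin algebra. If $\mathrm{Gproj}\,\Lambda$ is contravariantly finite in $\mathrm{mod}\,\Lambda$ (for instance if $\Lambda$ is virtually Gorenstein or of finite CM-type), then the following are equivalent. (i) ${}^\perp\Lambda=\mathrm{Gproj}\,\Lambda$. (ii) ${}^\perp\Lambda\cap(\mathrm{Gproj}\,\Lambda)^\perp=\mathrm{proj}\,\Lambda$. (iii) ${}^\perp\Lambda\cap(\mathrm{Gproj}\,\Lambda)^\perp$ is of finite representation type.
   Context: $\mathrm{mod}\,\Lambda$ is the category of finitely generated right $\Lambda$-modules and $\mathrm{proj}\,\Lambda$ its subcategory of projective modules. An acyclic complex $P^\bullet$ of projective modules is totally acyclic if $\mathrm{Hom}_\Lambda(P^\bullet,P)$ is acyclic for every projective $P$; a module is Gorenstein-projective if it is $\mathrm{Coker}(P^{-1}\to P^0)$ for such a $P^\bullet$; Gorenstein-injective modules are defined dually. $\mathrm{GProj}\,\Lambda$, $\mathrm{GInj}\,\Lambda$ are the full subcategories of $\mathrm{Mod}\,\Lambda$ (all modules) of Gorenstein-projective, resp. Gorenstein-injective, modules, and $\mathrm{Gproj}\,\Lambda=\mathrm{GProj}\,\Lambda\cap\mathrm{mod}\,\Lambda$. Here ${}^\perp\Lambda=\{A\in\mathrm{mod}\,\Lambda\mid\mathrm{Ext}^n_\Lambda(A,\Lambda)=0\ \forall n\ge1\}$ and $(\mathrm{Gproj}\,\Lambda)^\perp=\{A\in\mathrm{mod}\,\Lambda\mid\mathrm{Ext}^n_\Lambda(X,A)=0\ \forall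 n\ge1,\ \forall X\in\mathrm{Gproj}\,\Lambda\}$. A subcategory $\mathcal X\subseteq\mathrm{mod}\,\Lambda$ is contravariantly finite if each $A\in\mathrm{mod}\,\Lambda$ admits a map $X_A\to A$ with $X_A\in\mathcal X$ through which every map $X\to A$ with $X\in\mathcal X$ factors. A subcategory is of finite representation type if it has only finitely many isomorphism classes of indecomposable modules; $\Lambda$ is of finite CM-type if $\mathrm{Gproj}\,\Lambda$ is of finite representation type. $\Lambda$ is virtually Gorenstein if, in $\mathrm{Mod}\,\Lambda$, the class of modules $A$ with $\mathrm{Ext}^n_\Lambda(X,A)=0$ for all $n\ge1$, $X\in\mathrm{GProj}\,\Lambda$ coincides with the class of modules $A$ with $\mathrm{Ext}^n_\Lambda(A,Y)=0$ for all $n\ge1$, $Y\in\mathrm{GInj}\,\Lambda$. *)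

(* Defs.v *)
From mathcomp Require Import all_boot all_order all_algebra.

Set Implicit Arguments.
Unset Strict Implicit.
Unset Printing Implicit Defensive.

Import GRing.Theory.
Local Open Scope ring_scope.

(* All notions below are stated for left modules over an arbitrary ring R.
   Right modules over L are left modules over the converse ring L^c, and
   (L^c)^o is L viewed as a right module over itself. *)

Section Modules.
Variable R : pzRingType.
Implicit Types A B M N X Y : lmodType R.

Definition fin_gen M : Prop :=
  exists (n : nat) (e : 'I_n -> M),
    forall x : M, exists c : 'I_n -> R, x = \sum_(i < n) c i *: e i.

Definition artinian M : Prop :=
  forall S : nat -> {pred M},
    (forall n, submod_closed (S n)) ->
    (forall n, {subset S n.+1 <= S n}) ->
    exists n, forall m, (n <= m)%N -> S m =i S n.

Definition surj M N (f : M -> N) : Prop := forall y, exists x, f x = y.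

Definition isom M N : Prop := exists f : {linear M -> N}, bijective f.

Definition zero_mod M : Prop := forall x : M, x = 0.

Definition indecomposable M : Prop :=
  ~ zero_mod M /\
  forall A B, isom M (A * B)%type -> zero_mod A \/ zero_mod B.

Definition projective M : Prop :=
  forall A B (g : {linear A -> B}) (f : {linear M -> B}), surj g ->
    exists h : {linear M -> A}, forall x, g (h x) = f x.

Definition injective_mod M : Prop :=
  forall A B (g : {linear A -> B}) (f : {linear A -> M}), injective g ->
    exists h : {linear B -> M}, forall x, h (g x) = f x.

Definition exact A B M (f : A -> B) (g : B -> M) : Prop :=
  forall y, g y = 0 <-> exists x, f x = y.

Record proj_resolution A := ProjResolution {
  res_obj : nat -> lmodType R;
  res_diff : forall n, {linear res_obj n.+1 -> res_obj n};
  res_aug : {linear res_obj 0 -> A};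
  res_proj : forall n, projective (res_obj n);
  res_exact : forall n, exact (res_diff n.+1) (res_diff n);
  res_exact0 : exact (res_diff 0) res_aug;
  res_aug_surj : surj res_aug
}.

(* H^n (Hom (P, B)) = 0: every n-cocycle f is an n-coboundary. *)
Definition Hom_cohomology_zero A (P : proj_resolution A) B (n : nat) : Prop :=
  forall f : {linear res_obj P n -> B},
    (forall x, f (res_diff P n x) = 0) ->
    match n return ({linear res_obj P n -> B} -> Prop) with
    | 0 => fun f => forall x, f x = 0
    | m.+1 => fun f => exists g : {linear res_obj P m -> B},
                forall x, f x = g (res_diff P m x)
    end f.

(* Ext^n (A, B) = 0.  Projective resolutions exist and the cohomology does not
   depend on the one chosen, so quantifying over all of them is harmless. *)
Definition Ext_zero (n : nat) A B : Prop :=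
  forall P : proj_resolution A, Hom_cohomology_zero P B n.

Record cochain := Cochain {
  cobj : int -> lmodType R;
  cdiff : forall i, {linear cobj i -> cobj (i + 1)}
}.

Definition acyclic (C : cochain) : Prop :=
  forall i, exact (cdiff C i) (cdiff C (i + 1)).

(* Hom (C, M), resp. Hom (M, C), is acyclic. *)
Definition Hom_from_acyclic (C : cochain) M : Prop :=
  forall i (f : {linear cobj C (i + 1) -> M}),
    (forall x, f (cdiff C i x) = 0) <->
    exists g : {linear cobj C (i + 1 + 1) -> M},
      forall x, g (cdiff C (i + 1) x) = f x.

Definition Hom_to_acyclic M (C : cochain) : Prop :=
  forall i (f : {linear M -> cobj C (i + 1)}),
    (forall x, cdiff C (i + 1) (f x) = 0) <->
    exists g : {linear M -> cobj C i}, forall x, cdiff C i (g x) = f x.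

Definition totally_acyclic_proj (C : cochain) : Prop :=
  [/\ forall i, projective (cobj C i), acyclic C
    & forall P, projective P -> Hom_from_acyclic C P].

Definition totally_acyclic_inj (C : cochain) : Prop :=
  [/\ forall i, injective_mod (cobj C i), acyclic C
    & forall I, injective_mod I -> Hom_to_acyclic I C].

(* The differential leaving degree -1 lands in degree -1 + 1, which is
   convertible to 0; pi exhibits A as its cokernel. *)
Definition GProj A : Prop :=
  exists2 C : cochain, totally_acyclic_proj C &
    exists pi : {linear cobj C (-1 + 1) -> A},
      surj pi /\ exact (cdiff C (-1)) pi.

(* iota exhibits A as the kernel of the differential leaving degree 0. *)
Definition GInj A : Prop :=
  exists2 C : cochain, totally_acyclic_inj C &
    exists iota : {linear A -> cobj C 0},
      injective iota /\ exact iota (cdiff C 0).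

Definition proj A : Prop := fin_gen A /\ projective A.

Definition Gproj A : Prop := fin_gen A /\ GProj A.

(* The left perpendicular of R and the right perpendicular of Gproj in the
   category of finitely generated modules. *)
Definition perp_ring A : Prop :=
  fin_gen A /\ forall n, (1 <= n)%N -> Ext_zero n A R^o.

Definition Gproj_perp A : Prop :=
  fin_gen A /\
  forall n X, (1 <= n)%N -> Gproj X -> Ext_zero n X A.

(* For subcategories of finitely generated modules. *)
Definition contravariantly_finite (S : lmodType R -> Prop) : Prop :=
  forall A, fin_gen A ->
    exists (XA : lmodType R) (p : {linear XA -> A}), S XA /\
      forall X (f : {linear X -> A}), S X ->
        exists h : {linear X -> XA}, forall x, p (h x) = f x.

Definition finite_rep_type (S : lmodType R -> Prop) : Prop :=
  exists (n : nat) (M : 'I_n -> lmodType R),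
    forall A, S A -> indecomposable A -> exists i, isom A (M i).

Definition finite_CM_type : Prop := finite_rep_type Gproj.

Definition virtually_Gorenstein : Prop :=
  forall A,
    (forall n X, (1 <= n)%N -> GProj X -> Ext_zero n X A) <->
    (forall n Y, (1 <= n)%N -> GInj Y -> Ext_zero n A Y).

End Modules.

Definition artin_algebra (k : comPzRingType) (L : algType k) : Prop :=
  artinian k^o /\ fin_gen (L : lmodType k).

(* Main.v *)
(* Over an Artin algebra finitely generated modules have finite length, so
   Fitting's lemma provides minimal approximations, for which Wakamatsu's lemma
   controls the (co)kernels.

   (iii) => (i).  The class C = perp(R) /\ Gproj^perp is closed under syzygies,
   and Hom(A, P) -> Hom(Omega A, P) is onto for A in C and P projective.  Hence
   a nonprojective indecomposable module is a summand of Omega A for at most one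
   indecomposable A in C; sending A to such a summand is an injection of a finite
   set into itself, hence onto, so that every module in C embeds into a free
   module.  The cokernel of a left approximation by free modules is again in C,
   so the modules in C are Gorenstein-projective, and then projective.  For A in
   perp(R) the kernel of its minimal Gproj-approximation lies in C, and the
   approximation splits.

   Virtually Gorenstein algebras.  Let T be the class of finitely generated Z
   with Ext(Z, GInj) = 0.  The small object argument, which stops after omega
   steps, covers every Y by a module W, all of whose finitely generated pieces
   factor through T, with kernel in T^perp.  Since f.g. modules embed into f.g.
   injectives and every injective is built from these, T^perp = GInj; hence maps
   from f.g. modules to left Ext-orthogonals of GInj factor through T.  By
   hypothesis the latter class is closed under products, so T is covariantly
   finite, and Salce's argument turns left T-approximations into right
   Gproj-approximations. *)
Require Import Defs.
From HB Require Import structures.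
From mathcomp Require Import all_boot all_order all_algebra.
From mathcomp Require Import boolp classical_sets.

Set Implicit Arguments.
Unset Strict Implicit.
Unset Printing Implicit Defensive.

Import GRing.Theory.
Local Open Scope ring_scope.

(** * Submodules, quotients, products and direct sums *)

(** Submodules, quotients, sums and pushouts are used mostly through existential statements that
    supply maps and exactness. Ext^1 is treated as splitting of extensions, and higher Ext enters
    only by passing to syzygies. After [gp_class_GProj] and [gi_class_GInj] complexes disappear:
    [GProj] is the largest class whose members have no Ext^1 into projectives and possess a syzygy
    and a cosyzygy in the class, so membership is proved by coinduction, by exhibiting a class with
    these properties; dually for [GInj]. Three obstacles shape the details. The complexes and the
    orthogonality conditions involve infinitely generated modules, so finitely generated data are
    recovered by factoring maps through finite free summands, or through T. Counting needs
    finiteness over k: a commutative artinian ring is noetherian, so Hom groups of finitely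
    generated modules are finitely generated over k, which yields left approximations by free
    modules; the same finiteness bounds injective hulls. Finally sums and products need small index
    sets, so they range over submodules and quotients of R^n instead of over modules. *)

Lemma dchoice (I : Type) (T : I -> Type) (P : forall i, T i -> Prop) :
  (forall i, exists x, P i x) -> exists f : forall i, T i, forall i, P i (f i).
Proof.
by move=> h; exists (fun i => projT1 (cid (h i))) => i; exact: (projT2 (cid (h i))).
Qed.

Section Constructions.
Variable R : pzRingType.
Implicit Types A B M N : lmodType R.

Definition submod M (S : M -> Prop) : Prop :=
  S 0 /\ forall a x y, S x -> S y -> S (a *: x + y).

Lemma submodD M (S : M -> Prop) x y : submod S -> S x -> S y -> S (x + y).
Proof. by move=> [_ h] hx hy; rewrite -[x]scale1r; apply: h. Qed.

Lemma submodZ M (S : M -> Prop) a x : submod S -> S x -> S (a *: x).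
Proof. by move=> [h0 h] hx; rewrite -[_ *: _]addr0; apply: h. Qed.

Lemma submodN M (S : M -> Prop) x : submod S -> S x -> S (- x).
Proof. by move=> hS hx; rewrite -scaleN1r; apply: submodZ. Qed.

Lemma submodB M (S : M -> Prop) x y : submod S -> S x -> S y -> S (x - y).
Proof. by move=> hS hx hy; apply: submodD => //; apply: submodN. Qed.

Lemma submod_sum M (S : M -> Prop) (I : Type) (r : seq I) (P : pred I) F :
  submod S -> (forall i, P i -> S (F i)) -> S (\sum_(i <- r | P i) F i).
Proof.
move=> hS hF; elim/big_ind: _ => //; first by case: hS.
by move=> x y; apply: submodD.
Qed.

Lemma submod0 M : submod (fun x : M => x = 0).
Proof. by split=> // a x y -> ->; rewrite scaler0 addr0. Qed.

Lemma submod_adjoin M (S : M -> Prop) v : submod S ->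
  submod (fun x => exists2 w, S w & exists r : R, x = w + r *: v).
Proof.
move=> [s0 s]; split; first by exists 0 => //; exists 0; rewrite scale0r addr0.
move=> a _ _ [w Sw [r ->]] [w' Sw' [r' ->]]; exists (a *: w + w'); first exact: s.
by exists (a * r + r'); rewrite scalerDr scalerDl scalerA addrACA.
Qed.

(** Stability under combinations turns uniqueness at 0 into uniqueness everywhere, so any choice of
    values is linear. Lifts, factorisations and projections, whose values are given by a property
    and not by a formula, are all built in this way. *)
Lemma linear_of_rel A B (r : A -> B -> Prop) :
  (forall x, exists y, r x y) ->
  (forall a x y x' y', r x y -> r x' y' -> r (a *: x + x') (a *: y + y')) ->
  (forall y, r 0 y -> y = 0) ->
  exists f : {linear A -> B}, forall x, r x (f x).
Proof.
move=> tot lin fun0; have [f hf] := choice tot.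
have uniq x y : r x y -> y = f x.
  move=> hxy; apply/eqP; rewrite -subr_eq0; apply/eqP; apply: fun0.
  have := lin (-1) _ _ _ _ (hf x) hxy.
  by rewrite !scaleN1r addNr addrC.
have flin : linear f by move=> a x y; apply/esym/uniq/lin.
pose g : {linear A -> B} := HB.pack f (GRing.isLinear.Build _ _ _ _ f flin).
by exists g.
Qed.

Lemma linear_of_fun A B (f : A -> B) :
  (forall a x y, f (a *: x + y) = a *: f x + f y) ->
  exists g : {linear A -> B}, forall x, g x = f x.
Proof.
move=> flin.
pose g : {linear A -> B} := HB.pack f (GRing.isLinear.Build _ _ _ _ f flin).
by exists g.
Qed.

Section Sub.
Variables (M : lmodType R) (S : M -> Prop) (hS : submod S).

(* The beta-redex makes hS a parameter, for instance resolution. *)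
Definition submod_pred : {pred M} := fun x => `[< (fun _ : submod S => S x) hS >].
Lemma sub_pred_closed : submod_closed submod_pred.
Proof.
case: (hS) => h0 h; split; first exact/asboolP.
by move=> a x y /asboolP hx /asboolP hy; apply/asboolP/h.
Qed.
HB.instance Definition _ := GRing.isSubmodClosed.Build R M submod_pred sub_pred_closed.
Definition submod_type := {x : M | x \in submod_pred}.
HB.instance Definition _ := SubChoice.on submod_type.
HB.instance Definition _ := [SubChoice_isSubLmodule of submod_type by <:].
End Sub.

Lemma sub_exists M (S : M -> Prop) : submod S ->
  exists (K : lmodType R) (i : {linear K -> M}),
    injective i /\ forall x, S x <-> exists y, i y = x.
Proof.
move=> hS; exists (submod_type hS : lmodType R), (val : {linear submod_type hS -> M}).
split; first exact: val_inj.
move=> x; split=> [hx|[y <-]]; last exact/asboolP/(valP y).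
have hx' : x \in submod_pred hS by apply/asboolP.
by exists (exist (fun x => x \in submod_pred hS) x hx').
Qed.

Section Quot.
Variables (M : lmodType R) (S : M -> Prop) (hS : submod S).

(** Congruent elements determine the same coset, by extensionality, and so receive the same chosen
    representative; the quotient is then realised on the fixed points of this map. The beta-redex
    again makes [hS] a parameter. *)
Definition coset_repr (x : M) : M :=
  xget 0 (fun y => (fun _ : submod S => S (x - y)) hS).

Lemma coset_reprP x : S (x - coset_repr x).
Proof.
rewrite /coset_repr; case: xgetP => [y _ //|] /(_ x) [].
by rewrite /= subrr; case: hS.
Qed.

Lemma coset_repr_eq x y : S (x - y) <-> coset_repr x = coset_repr y.
Proof.
split=> [hxy|e]; last first.
  have := submodB hS (coset_reprP x) (coset_reprP y).
  by rewrite e opprB addrA addrNK.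
rewrite /coset_repr; congr (xget _ _); apply/funext => z; apply/propext.
split=> h.
  by have := submodB hS h hxy; rewrite opprB addrC addrA addrNK.
by have := submodD hS hxy h; rewrite addrA addrNK.
Qed.

Lemma coset_reprK x : coset_repr (coset_repr x) == coset_repr x.
Proof.
apply/eqP/coset_repr_eq; rewrite -opprB; apply: submodN => //.
exact: coset_reprP.
Qed.

Definition quotmod_type := {x : M | coset_repr x == x}.
HB.instance Definition _ := SubChoice.on quotmod_type.
Definition quot_proj (x : M) : quotmod_type :=
  exist (fun y => coset_repr y == y) _ (coset_reprK x).

Lemma quot_projK (u : quotmod_type) : quot_proj (val u) = u.
Proof. by apply/val_inj/eqP; case: u. Qed.

Lemma quot_proj_eq x y : S (x - y) -> quot_proj x = quot_proj y.
Proof. by move=> h; apply/val_inj/coset_repr_eq. Qed.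

Let S0 x y : x = y -> S (x - y).
Proof. by move=> ->; rewrite subrr; case: hS. Qed.

Definition quot_add (u v : quotmod_type) := quot_proj (val u + val v).
Definition quot_opp (u : quotmod_type) := quot_proj (- val u).
Definition quot_scale a (u : quotmod_type) := quot_proj (a *: val u).

Lemma quot_addE x y : quot_add (quot_proj x) (quot_proj y) = quot_proj (x + y).
Proof.
apply: quot_proj_eq => /=; rewrite -opprB; apply: submodN => //.
rewrite opprD addrACA; apply: submodD => //; exact: coset_reprP.
Qed.

Lemma quot_scaleE a x : quot_scale a (quot_proj x) = quot_proj (a *: x).
Proof.
apply: quot_proj_eq => /=; rewrite -opprB; apply: submodN => //.
rewrite -scalerBr; apply: submodZ => //; exact: coset_reprP.
Qed.

Lemma quot_addA : associative quot_add.
Proof.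
move=> u v w; rewrite -(quot_projK u) -(quot_projK v) -(quot_projK w).
by rewrite !quot_addE addrA.
Qed.
Lemma quot_addC : commutative quot_add.
Proof. by move=> u v; rewrite /quot_add addrC. Qed.
Lemma quot_add0 : left_id (quot_proj 0) quot_add.
Proof. by move=> u; rewrite -(quot_projK u) quot_addE add0r. Qed.
Lemma quot_addN : left_inverse (quot_proj 0) quot_opp quot_add.
Proof.
move=> u; rewrite /quot_opp -[in X in quot_add _ X](quot_projK u).
by rewrite quot_addE addNr.
Qed.
HB.instance Definition _ :=
  GRing.isZmodule.Build quotmod_type quot_addA quot_addC quot_add0 quot_addN.

Lemma quot_scaleA a b u : quot_scale a (quot_scale b u) = quot_scale (a * b) u.
Proof. by rewrite -(quot_projK u) !quot_scaleE scalerA. Qed.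
Lemma quot_scale1 : left_id 1 quot_scale.
Proof. by move=> u; rewrite -(quot_projK u) quot_scaleE scale1r. Qed.
Lemma quot_scaleDr : right_distributive quot_scale +%R.
Proof.
move=> a u v; rewrite -(quot_projK u) -(quot_projK v) [LHS]/=.
by rewrite /GRing.add /= !(quot_addE, quot_scaleE) scalerDr.
Qed.
Lemma quot_scaleDl u : {morph quot_scale^~ u : a b / a + b}.
Proof.
move=> a b; rewrite /= -(quot_projK u) !quot_scaleE.
by rewrite /GRing.add /= quot_addE scalerDl.
Qed.
HB.instance Definition _ := GRing.Zmodule_isLmodule.Build R quotmod_type
  quot_scaleA quot_scale1 quot_scaleDr quot_scaleDl.

Lemma quot_proj_linear : linear quot_proj.
Proof. by move=> a x y; rewrite -quot_addE -quot_scaleE. Qed.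

Lemma quot_proj0 x : quot_proj x = 0 <-> S x.
Proof.
split=> [[/coset_repr_eq]|h]; first by rewrite subr0.
by apply: quot_proj_eq; rewrite subr0.
Qed.
End Quot.

Lemma quot_exists M (S : M -> Prop) : submod S ->
  exists (Q : lmodType R) (p : {linear M -> Q}),
    surj p /\ forall x, p x = 0 <-> S x.
Proof.
move=> hS; have [p pE] := linear_of_fun (@quot_proj_linear M S hS).
exists (quotmod_type hS : lmodType R), p; split; last first.
  by move=> x; rewrite pE quot_proj0.
by move=> u; exists (val u); rewrite pE quot_projK.
Qed.

Section Dprod.
Variables (I : Type) (M : I -> lmodType R).
Definition dprod := forall i, M i.
HB.instance Definition _ := gen_eqMixin dprod.
HB.instance Definition _ := gen_choiceMixin dprod.
Definition dprod_add (f g : dprod) : dprod := fun i => f i + g i.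
Definition dprod_opp (f : dprod) : dprod := fun i => - f i.
Definition dprod_scale a (f : dprod) : dprod := fun i => a *: f i.
Lemma dprod_addA : associative dprod_add.
Proof. by move=> f g h; apply/functional_extensionality_dep => i; exact: addrA. Qed.
Lemma dprod_addC : commutative dprod_add.
Proof. by move=> f g; apply/functional_extensionality_dep => i; exact: addrC. Qed.
Lemma dprod_add0 : left_id (fun i => 0) dprod_add.
Proof. by move=> f; apply/functional_extensionality_dep => i; exact: add0r. Qed.
Lemma dprod_addN : left_inverse (fun i => 0) dprod_opp dprod_add.
Proof. by move=> f; apply/functional_extensionality_dep => i; exact: addNr. Qed.
HB.instance Definition _ :=
  GRing.isZmodule.Build dprod dprod_addA dprod_addC dprod_add0 dprod_addN.
Lemma dprod_scaleA a b f : dprod_scale a (dprod_scale b f) = dprod_scale (a * b) f.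
Proof. by apply/functional_extensionality_dep => i; exact: scalerA. Qed.
Lemma dprod_scale1 : left_id 1 dprod_scale.
Proof. by move=> f; apply/functional_extensionality_dep => i; exact: scale1r. Qed.
Lemma dprod_scaleDr : right_distributive dprod_scale +%R.
Proof. by move=> a f g; apply/functional_extensionality_dep => i; exact: scalerDr. Qed.
Lemma dprod_scaleDl f : {morph dprod_scale^~ f : a b / a + b}.
Proof. by move=> a b; apply/functional_extensionality_dep => i; exact: scalerDl. Qed.
HB.instance Definition _ := GRing.Zmodule_isLmodule.Build R dprod
  dprod_scaleA dprod_scale1 dprod_scaleDr dprod_scaleDl.
End Dprod.

Lemma prod_exists (I : Type) (M : I -> lmodType R) :
  exists (P : lmodType R) (pr : forall i, {linear P -> M i}),
    (forall x y, (forall i, pr i x = pr i y) -> x = y) /\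
    forall (f : forall i, M i), exists x, forall i, pr i x = f i.
Proof.
pose prf i (f : dprod M) : M i := f i.
have prl i : linear (prf i) by [].
pose pr i : {linear dprod M -> M i} :=
  HB.pack (prf i) (GRing.isLinear.Build _ _ _ _ (prf i) (prl i)).
exists (dprod M : lmodType R), pr; split=> [x y h|f]; last by exists f.
by apply/functional_extensionality_dep => i; exact: h.
Qed.

Lemma prod_pair (I : Type) (M : I -> lmodType R) (P : lmodType R)
    (pr : forall i, {linear P -> M i}) :
  (forall x y, (forall i, pr i x = pr i y) -> x = y) ->
  (forall (f : forall i, M i), exists x, forall i, pr i x = f i) ->
  forall N (f : forall i, {linear N -> M i}),
    exists g : {linear N -> P}, forall x i, pr i (g x) = f i x.
Proof.
move=> inj sur N f.
apply: (@linear_of_rel N P (fun x y => forall i, pr i y = f i x)).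
- by move=> x; have [y hy] := sur (fun i => f i x); exists y.
- by move=> a x y x' y' h h' i; rewrite !linearP h h'.
- by move=> y h; apply: inj => i; rewrite h !linear0.
Qed.

(** Realised as the finitely supported families in the product. The expansion is stated for every
    sequence containing the support, so that finitely many elements can be expanded along one common
    sequence. *)
Lemma dsum_exists (I : choiceType) (M : I -> lmodType R) :
  exists (D : lmodType R) (inj : forall i, {linear M i -> D})
      (pr : forall i, {linear D -> M i}),
    [/\ forall i x, pr i (inj i x) = x,
        forall i j x, i <> j -> pr j (inj i x) = 0,
        forall x, exists2 s : seq I, uniq s &
          forall s', uniq s' -> {subset s <= s'} ->
            x = \sum_(i <- s') inj i (pr i x)
      & forall N (f : forall i, {linear M i -> N}),
          exists g : {linear D -> N}, forall i x, g (inj i x) = f i x].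
Proof.
have [P [pr [prI prS]]] := prod_exists M.
pose supp (s : seq I) (x : P) := forall i, i \notin s -> pr i x = 0.
pose S x := exists s, supp s x.
have hS : submod S.
  split; first by exists [::] => i _; rewrite linear0.
  move=> a x y [s hs] [t ht]; exists (s ++ t) => i.
  rewrite mem_cat negb_or => /andP [hi hj].
  by rewrite linearP hs // ht // scaler0 addr0.
have [D [v [vinj hv]]] := sub_exists hS.
have injE i : exists f : {linear M i -> D},
    forall x, pr i (v (f x)) = x /\ forall j, i <> j -> pr j (v (f x)) = 0.
  apply: (@linear_of_rel _ _ (fun x y =>
    pr i (v y) = x /\ forall j, i <> j -> pr j (v y) = 0)).
  - move=> x; have [y hy] := prS (fun j => match pselect (i = j) with
        left e => ecast j (M j) e x | right _ => 0 end).
    have : S y.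
      exists [:: i] => j; rewrite inE => /eqP hj; rewrite hy.
      by case: pselect => // e; case: hj.
    case/(hv y).1 => z zy; rewrite -{y}zy in hy; exists z; split.
      by rewrite hy; case: pselect => // e; rewrite eq_axiomK.
    by move=> j hj; rewrite hy; case: pselect.
  - move=> a x y x' y' [h1 h2] [h1' h2']; split; first by rewrite !linearP h1 h1'.
    by move=> j hj; rewrite !linearP h2 // h2' // scaler0 addr0.
  - move=> y [h1 h2]; apply: vinj; apply: prI => j.
    case: (pselect (i = j)) => [<-|/h2->]; first by rewrite h1 !linear0.
    by rewrite !linear0.
have [inj hinj] := dchoice injE.
have supp_uniq x : exists2 s, uniq s & supp s (v x).
  have [s hs] : S (v x) by apply/hv; exists x.
  exists (undup s); first exact: undup_uniq.
  by move=> i; rewrite mem_undup; exact: hs.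
have sumE x s : uniq s -> supp s (v x) ->
    x = \sum_(i <- s) inj i (pr i (v x)).
  move=> us hs; apply: vinj; apply: prI => j; rewrite !raddf_sum.
  case: (boolP (j \in s)) => hj; last first.
    rewrite (hs _ hj) big1_seq // => i /andP [_ hi] /=.
    by have [_ ->//] := hinj i (pr i (v x)) => e; rewrite -e hi in hj.
  rewrite (bigD1_seq j) //= (hinj j _).1 big1 ?addr0 // => i hij.
  by have [_ ->//] := hinj i (pr i (v x)); apply/eqP.
exists D, inj, (fun i => pr i \o v : {linear D -> M i}).
split.
- by move=> i x; case: (hinj i x).
- by move=> i j x; case: (hinj i x) => _; exact.
- move=> x; have [s us hs] := supp_uniq x; exists s => // s' us' ss'.
  by apply: sumE => // i hi; apply: hs; apply: contra hi; exact: ss'.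
move=> N f.
have [g hg] : exists g : {linear D -> N}, forall x, exists s,
    [/\ uniq s, supp s (v x) & g x = \sum_(i <- s) f i (pr i (v x))].
  have indep x s t : uniq s -> uniq t -> supp s (v x) -> supp t (v x) ->
      \sum_(i <- s) f i (pr i (v x)) = \sum_(i <- t) f i (pr i (v x)).
    have main r r' : uniq r -> uniq r' -> {subset r <= r'} -> supp r (v x) ->
        \sum_(i <- r) f i (pr i (v x)) = \sum_(i <- r') f i (pr i (v x)).
      move=> ur ur' rr' hr; rewrite [RHS](bigID (mem r)) /=.
      rewrite [X in _ = _ + X]big1 ?addr0; last first.
        by move=> i hi; rewrite hr // linear0.
      rewrite -[RHS]big_filter; apply: perm_big; apply: uniq_perm => //.
        exact: filter_uniq.
      move=> i; rewrite mem_filter; case: (boolP (i \in r)) => //= hi.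
      by rewrite (rr' _ hi).
    move=> us ut hs ht; rewrite (main s (undup (s ++ t))) ?undup_uniq //; last first.
      by move=> i hi; rewrite mem_undup mem_cat hi.
    rewrite [in RHS](main t (undup (s ++ t))) ?undup_uniq //.
    by move=> i hi; rewrite mem_undup mem_cat hi orbT.
  apply: (@linear_of_rel _ _ (fun x y => exists s,
    [/\ uniq s, supp s (v x) & y = \sum_(i <- s) f i (pr i (v x))])).
  - by move=> x; have [s us hs] := supp_uniq x; eexists; exists s; split.
  - move=> a x y x' y' [s [us hs ->]] [t [ut ht ->]].
    have hs' : supp (undup (s ++ t)) (v x).
      by move=> i; rewrite mem_undup mem_cat negb_or => /andP [/hs ->].
    have ht' : supp (undup (s ++ t)) (v x').
      by move=> i; rewrite mem_undup mem_cat negb_or => /andP [_ /ht ->].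
    exists (undup (s ++ t)); split; first exact: undup_uniq.
      by move=> i hi; rewrite !linearP hs' // ht' // scaler0 addr0.
    rewrite (indep x s (undup (s ++ t))) ?undup_uniq //.
    rewrite (indep x' t (undup (s ++ t))) ?undup_uniq // scaler_sumr -big_split.
    by apply: eq_bigr => i _; rewrite !linearP.
  - move=> y [s [_ _ ->]]; rewrite big1 // => i _.
    by rewrite !linear0.
exists g => i x; have [s [us hs ->]] := hg (inj i x).
case: (boolP (i \in s)) => hi; last first.
  have h0 := hs _ hi; rewrite (hinj i x).1 in h0; rewrite h0 !linear0.
  by rewrite big1 // => j _; rewrite !linear0.
rewrite (bigD1_seq i) //= (hinj i x).1 big1 ?addr0 // => j hij.
have [_ ->] := hinj i x; first by rewrite linear0.
by move=> e; rewrite e eqxx in hij.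
Qed.

End Constructions.

(** * Short exact sequences and Ext^1 *)

Section PairFun.
Variable R : pzRingType.
Variables A B N : lmodType R.
Variables (f : {linear N -> A}) (g : {linear N -> B}).
Definition pair_fun x := (f x, g x).
Lemma pair_fun_linear : linear pair_fun.
Proof. by move=> a x y; rewrite /pair_fun !linearP. Qed.
HB.instance Definition _ :=
  GRing.isLinear.Build R N (A * B)%type *:%R pair_fun pair_fun_linear.
End PairFun.

Section CopairFun.
Variable R : pzRingType.
Variables A B N : lmodType R.
Variables (f : {linear A -> N}) (g : {linear B -> N}).
Definition copair_fun (x : A * B) := f x.1 + g x.2.
Lemma copair_fun_linear : linear copair_fun.
Proof.
move=> a x y; rewrite /copair_fun /= !linearP /= scalerDr -!addrA.
by congr (_ + _); rewrite addrCA.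
Qed.
HB.instance Definition _ :=
  GRing.isLinear.Build R (A * B)%type N *:%R copair_fun copair_fun_linear.
End CopairFun.

Section Sequences.
Variable R : pzRingType.
Implicit Types A B C D E F I K L M N P Q X Y Z : lmodType R.

Definition ses A B C (i : A -> B) (p : B -> C) : Prop :=
  [/\ injective i, surj p & exact i p].

Definition retract A B : Prop :=
  exists (u : {linear A -> B}) (v : {linear B -> A}), forall x, v (u x) = x.

(** Vanishing of Yoneda's Ext^1. No resolution enters, so the formal properties come directly from
    pushouts and pullbacks; [Ext_zero_vanish] makes the link with resolutions. *)
Definition ext1 A B : Prop :=
  forall E (i : {linear B -> E}) (p : {linear E -> A}), ses i p ->
    exists r : {linear E -> B}, forall x, r (i x) = x.

Lemma submod_ker A B (f : {linear A -> B}) : submod (fun x => f x = 0).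
Proof.
by split=> [|a x y hx hy]; rewrite ?linear0 // linearP hx hy scaler0 addr0.
Qed.

Lemma submod_im A B (f : {linear A -> B}) : submod (fun y => exists x, f x = y).
Proof.
split=> [|a _ _ [x <-] [y <-]]; first by exists 0; rewrite linear0.
by exists (a *: x + y); rewrite linearP.
Qed.

Lemma factor_surj A Q B (p : {linear A -> Q}) (f : {linear A -> B}) :
  surj p -> (forall x, p x = 0 -> f x = 0) ->
  exists g : {linear Q -> B}, forall x, g (p x) = f x.
Proof.
move=> ps pf.
have [g hg] : exists g : {linear Q -> B},
    forall y, exists x, p x = y /\ f x = g y.
  apply: (@linear_of_rel _ _ _ (fun y z => exists x, p x = y /\ f x = z)).
  - by move=> y; have [x <-] := ps y; exists (f x), x.
  - move=> a _ _ _ _ [x [<- <-]] [y [<- <-]].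
    by exists (a *: x + y); rewrite !linearP.
  - by move=> y [x [/pf <-]].
exists g => x; have [y [hy <-]] := hg (p x).
by apply/eqP; rewrite -subr_eq0 -linearB; apply/eqP/pf; rewrite linearB hy subrr.
Qed.

Lemma linear_lift_inj K M N (i : {linear K -> M}) (f : {linear N -> M}) :
  injective i -> (forall x, exists y, i y = f x) ->
  exists g : {linear N -> K}, forall x, i (g x) = f x.
Proof.
move=> inj h; apply: (@linear_of_rel _ _ _ (fun x y => i y = f x)) => //.
- by move=> a x y x' y' h1 h2; rewrite !linearP h1 h2.
- by move=> y hy; apply: inj; rewrite hy !linear0.
Qed.

Lemma linear_inverse A B (f : {linear A -> B}) : injective f -> surj f ->
  exists g : {linear B -> A}, cancel f g /\ cancel g f.
Proof.
move=> inj sur; have [g hg] := linear_lift_inj (f := idfun : {linear B -> B}) inj sur.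
by exists g; split=> // x; apply: inj; rewrite hg.
Qed.

Lemma ses_prod A B :
  ses (pair_fun idfun \0 : {linear A -> (A * B)%type}) (snd : {linear (A * B)%type -> B}).
Proof.
split=> [x y [->]//|y|[x y]]; first by exists (0, y).
by split=> /= [->|[z [_ <-]]] //; exists x.
Qed.

Lemma ker_ses B C (p : {linear B -> C}) : surj p ->
  exists K (i : {linear K -> B}), ses i p.
Proof.
move=> sp; have [K [i [ii hi]]] := sub_exists (submod_ker p).
by exists K, i; split=> // y; rewrite hi.
Qed.

Lemma coker_ses A B (i : {linear A -> B}) : injective i ->
  exists C (p : {linear B -> C}), ses i p.
Proof.
move=> ii; have [C [p [sp hp]]] := quot_exists (submod_im i).
by exists C, p; split=> // y; rewrite hp.
Qed.

Lemma ses0 A B C (i : {linear A -> B}) (p : {linear B -> C}) x :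
  ses i p -> p (i x) = 0.
Proof. by move=> [_ _ e]; apply/e; exists x. Qed.

Lemma linear_inj A B (f : {linear A -> B}) :
  (forall x, f x = 0 -> x = 0) -> injective f.
Proof.
move=> h x y e; apply/eqP; rewrite -subr_eq0; apply/eqP/h.
by rewrite linearB e subrr.
Qed.

Lemma section_retraction A B C (i : {linear A -> B}) (p : {linear B -> C})
    (s : {linear C -> B}) : ses i p -> (forall x, p (s x) = x) ->
  exists r : {linear B -> A}, forall x, r (i x) = x.
Proof.
move=> e hs; have [ii sp ex] := e.
have [r hr] : exists r : {linear B -> A}, forall x, i (r x) = (idfun \- (s \o p)) x.
  by apply: linear_lift_inj => // x; apply/ex; rewrite linearB /= hs subrr.
by exists r => x; apply: ii; rewrite hr /= (ses0 _ e) linear0 subr0.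
Qed.

Lemma retraction_section A B C (i : {linear A -> B}) (p : {linear B -> C})
    (r : {linear B -> A}) : ses i p -> (forall x, r (i x) = x) ->
  exists s : {linear C -> B}, forall x, p (s x) = x.
Proof.
move=> e hr; have [ii sp ex] := e.
have [s hs] : exists s : {linear C -> B}, forall x, s (p x) = (idfun \- (i \o r)) x.
  by apply: factor_surj => // x /ex [y <-] /=; rewrite hr subrr.
exists s => y; have [x <-] := sp y.
by rewrite hs linearB /= (ses0 _ e) subr0.
Qed.

Lemma ext1_split A B C (i : {linear A -> B}) (p : {linear B -> C}) :
  ses i p -> ext1 C A -> retract C B.
Proof.
move=> e /(_ _ _ _ e) [r hr]; have [s hs] := retraction_section e hr.
by exists s, p.
Qed.

Lemma ext1_of_section A B :
  (forall E (i : {linear B -> E}) (p : {linear E -> A}), ses i p ->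
    exists s : {linear A -> E}, forall x, p (s x) = x) -> ext1 A B.
Proof. by move=> h E i p e; have [s /(section_retraction e)] := h _ _ _ e. Qed.

(** The quotient of B x E by the antidiagonal copy of K. The construction is symmetric, whence the
    last clause: if f is also a monomorphism, the other leg has the same cokernel as f. Salce's
    argument uses both exact sequences. *)
Lemma pushout K B E A (f : {linear K -> B}) (i : {linear K -> E}) (p : {linear E -> A}) :
  ses i p -> exists Q (j : {linear B -> Q}) (l : {linear E -> Q}) (t : {linear Q -> A}),
  [/\ ses j t, forall x, j (f x) = l (i x), forall x, t (l x) = p x,
      forall X (u : {linear B -> X}) (v : {linear E -> X}),
        (forall x, u (f x) = v (i x)) ->
        exists w : {linear Q -> X}, (forall x, w (j x) = u x) /\ forall x, w (l x) = v x
    & forall L (q : {linear B -> L}), ses f q -> exists s : {linear Q -> L}, ses l s].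
Proof.
move=> e; have [ii sp ex] := e.
pose d : {linear K -> (B * E)%type} := pair_fun f (\- i).
have dE x : d x = (f x, - i x) by [].
have [Q [q [sq hq]]] := quot_exists (submod_im d).
have [j hj] : exists j : {linear B -> Q}, forall x, j x = q (x, 0).
  by exists (q \o pair_fun idfun \0).
have [l hl] : exists l : {linear E -> Q}, forall x, l x = q (0, x).
  by exists (q \o pair_fun \0 idfun).
have qE x y : q (x, y) = j x + l y.
  by rewrite hj hl -linearD; congr (q _); congr pair; rewrite /= ?addr0 ?add0r.
have univ X (u : {linear B -> X}) (v : {linear E -> X}) :
    (forall x, u (f x) = v (i x)) ->
    exists w : {linear Q -> X}, (forall x, w (j x) = u x) /\ forall x, w (l x) = v x.
  move=> uv; have [w hw] : exists w : {linear Q -> X}, forall x, w (q x) = copair_fun u v x.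
    apply: factor_surj => // x /hq [y <-]; rewrite dE.
    by rewrite -[LHS]/(u (f y) + v (- i y)) linearN uv subrr.
  by exists w; split=> x; rewrite ?hj ?hl hw /copair_fun /= linear0 ?addr0 ?add0r.
have jl x : j (f x) = l (i x).
  by apply/eqP; rewrite -subr_eq0 -linearN -qE; apply/eqP/hq; exists x.
have [t [tj tl]] : exists t : {linear Q -> A},
    (forall x, t (j x) = (\0 : {linear B -> A}) x) /\ forall x, t (l x) = p x.
  by apply: univ => x; rewrite (ses0 _ e).
exists Q, j, l, t; split=> //.
- split.
  + apply: linear_inj => x; rewrite hj => /hq [y]; rewrite dE => - [<- /eqP].
    by rewrite oppr_eq0 -(linear0 i) => /eqP /ii ->; rewrite linear0.
  + by move=> x; have [y <-] := sp x; exists (l y).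
  + move=> y; have [[x z] <-] := sq y; rewrite qE linearD tj tl add0r.
    split=> [/ex [w <-]|[w /(congr1 t)]]; first by exists (x + f w); rewrite linearD jl.
    by rewrite linearD !tj tl add0r.
- move=> L r e'; have [jf sr ex'] := e'.
  have [s [sj sl]] : exists s : {linear Q -> L},
      (forall x, s (j x) = r x) /\ forall x, s (l x) = (\0 : {linear E -> L}) x.
    by apply: univ => x; rewrite (ses0 _ e').
  exists s; split.
  + apply: linear_inj => x; rewrite hl => /hq [y]; rewrite dE => - [y0 <-].
    by move: y0; rewrite -(linear0 f) => /jf ->; rewrite linear0 oppr0.
  + by move=> x; have [y <-] := sr x; exists (j y).
  + move=> y; have [[x z] <-] := sq y; rewrite qE linearD sj sl addr0.
    split=> [/ex' [w <-]|[w /(congr1 s)]]; first by exists (i w + z); rewrite linearD jl.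
    by rewrite linearD sj !sl addr0.
Qed.

Lemma pullback A B E C (i : {linear B -> E}) (p : {linear E -> C}) (f : {linear A -> C}) :
  ses i p -> exists Q (j : {linear B -> Q}) (t : {linear Q -> A}) (l : {linear Q -> E}),
  [/\ ses j t, forall x, p (l x) = f (t x)
    & forall X (u : {linear X -> E}) (v : {linear X -> A}),
        (forall x, p (u x) = f (v x)) ->
        exists w : {linear X -> Q}, (forall x, l (w x) = u x) /\ forall x, t (w x) = v x].
Proof.
move=> e; have [ii sp ex] := e.
have [Q [q [iq hq]]] :=
  sub_exists (submod_ker (copair_fun p (\- f) : {linear (E * A)%type -> C})).
have hq' x a : p x = f a -> exists y, q y = (x, a).
  by move=> h; apply/hq; rewrite -[LHS]/(p x - f a) h subrr.
have qE y : p (q y).1 = f (q y).2.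
  by apply/eqP; rewrite -subr_eq0; apply/eqP; apply/hq; exists y.
have univ X (u : {linear X -> E}) (v : {linear X -> A}) : (forall x, p (u x) = f (v x)) ->
    exists w : {linear X -> Q}, forall x, q (w x) = (u x, v x).
  by move=> uv; apply: (linear_lift_inj (f := pair_fun u v)) => // x; apply: hq'.
have [j hj] : exists j : {linear B -> Q},
    forall x, q (j x) = (i x, (\0 : {linear B -> A}) x).
  by apply: univ => x; rewrite (ses0 _ e) linear0.
exists Q, j, (snd \o q), (fst \o q); split=> //; last first.
  by move=> X u v /univ [w hw]; exists w; split=> x /=; rewrite hw.
split.
- apply: linear_inj => x h; apply: ii; have := hj x.
  by rewrite h !linear0 => - [<-].
- by move=> a; have [x hx] := sp (f a); have [y hy] := hq' _ _ hx; exists y; rewrite /= hy.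
- move=> y; split=> [/= h|[x <-]]; last by rewrite /= hj.
  have := qE y; rewrite h linear0 => /ex [x hx]; exists x; apply: iq.
  by rewrite hj -[LHS]/(i x, 0) hx -h; case: (q y).
Qed.

Lemma ext1_extend A B K E (i : {linear K -> E}) (p : {linear E -> A})
    (f : {linear K -> B}) : ext1 A B -> ses i p ->
  exists g : {linear E -> B}, forall x, g (i x) = f x.
Proof.
move=> eAB /(pushout f) [Q [j [l [t [/eAB [r hr] jl _ _ _]]]]].
by exists (r \o l) => x; rewrite /= -jl hr.
Qed.

Lemma ext1_lift A B E C (i : {linear B -> E}) (p : {linear E -> C})
    (f : {linear A -> C}) : ext1 A B -> ses i p ->
  exists g : {linear A -> E}, forall x, p (g x) = f x.
Proof.
move=> eAB /(pullback f) [Q [j [t [l [e pl _]]]]].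
have [r hr] := eAB _ _ _ e; have [s hs] := retraction_section e hr.
by exists (l \o s) => x; rewrite /= pl hs.
Qed.

(** Exactness of Hom(P, B) -> Hom(K, B) -> Ext^1(A, B) -> Ext^1(P, B) as a criterion: a lift of P to
    the extension is corrected by extending its restriction to K, and then descends to A. *)
Lemma ext1_of_extend A B K P (i : {linear K -> P}) (p : {linear P -> A}) :
  ses i p -> ext1 P B ->
  (forall f : {linear K -> B}, exists g : {linear P -> B}, forall x, g (i x) = f x) ->
  ext1 A B.
Proof.
move=> e eP h; have [ii sp ex] := e; apply: ext1_of_section => E j q e2.
have [ij sq ex2] := e2.
have [l hl] := ext1_lift p eP e2.
have [f hf] : exists f : {linear K -> B}, forall x, j (f x) = (l \o i) x.
  by apply: linear_lift_inj => // x; apply/ex2; rewrite /= hl (ses0 _ e).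
have [g hg] := h f.
have [s hs] : exists s : {linear A -> E}, forall x, s (p x) = (l \- (j \o g)) x.
  by apply: factor_surj => // x /ex [y <-] /=; rewrite hg hf subrr.
exists s => y; have [x <-] := sp y.
by rewrite hs linearB /= hl (ses0 _ e2) subr0.
Qed.

Lemma ext1_of_lift A B I C (j : {linear B -> I}) (q : {linear I -> C}) :
  ses j q -> ext1 A I ->
  (forall f : {linear A -> C}, exists g : {linear A -> I}, forall x, q (g x) = f x) ->
  ext1 A B.
Proof.
move=> e eI h E i p e2; have [ij sq ex] := e; have [ii sp ex2] := e2.
have [l hl] := ext1_extend j eI e2.
have [f hf] : exists f : {linear A -> C}, forall x, f (p x) = (q \o l) x.
  by apply: factor_surj => // x /ex2 [y <-] /=; rewrite hl (ses0 _ e).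
have [g hg] := h f.
have [r hr] : exists r : {linear E -> B}, forall x, j (r x) = (l \- (g \o p)) x.
  by apply: linear_lift_inj => // x; apply/ex; rewrite linearB /= hg hf subrr.
by exists r => x; apply: ij; rewrite hr /= hl (ses0 _ e2) linear0 subr0.
Qed.

Lemma projective_ext1 P B : projective P -> ext1 P B.
Proof.
by move=> hP; apply: ext1_of_section => E i p [_ sp _]; apply: (hP _ _ p idfun).
Qed.

Lemma injective_ext1 A I : injective_mod I -> ext1 A I.
Proof. by move=> hI E i p [ii _ _]; apply: (hI _ _ i idfun). Qed.

(** A1 lifts to the given extension E of A by B, and E modulo the lifted copy is an extension of A2
    by B. *)
Lemma ext1_ext_l A1 A A2 B (i : {linear A1 -> A}) (p : {linear A -> A2}) :
  ses i p -> ext1 A1 B -> ext1 A2 B -> ext1 A B.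
Proof.
move=> e e1 e2; have [ii sp ex] := e; move=> E j q e'; have [ij sq ex'] := e'.
have [h hh] := ext1_lift i e1 e'.
have [Q [t et]] := coker_ses (i := h) (fun x y e => ii _ _ (esym
  (etrans (esym (hh y)) (etrans (congr1 q (esym e)) (hh x))))).
have [ih st ext] := et.
have [w hw] : exists w : {linear Q -> A2}, forall x, w (t x) = (p \o q) x.
  by apply: factor_surj => // x /ext [y <-] /=; rewrite hh (ses0 _ e).
have e'' : ses (t \o j) w.
  split.
  - apply: linear_inj => x /= /ext [y hy].
    have y0 : y = 0 by apply: ii; rewrite -hh hy (ses0 _ e') linear0.
    by apply: ij; rewrite -hy y0 !linear0.
  - move=> a; have [b <-] := sp a; have [c <-] := sq b.
    by exists (t c); rewrite hw.
  - move=> y; have [x <-] := st y; rewrite hw; split=> /= [/ex [a ha]|[b]].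
      have [b hb] : exists b, j b = x - h a.
        by apply/ex'; rewrite linearB hh ha subrr.
      by exists b; rewrite hb linearB (ses0 _ et) subr0.
    by move=> /(congr1 w); rewrite !hw /= (ses0 _ e') linear0.
have [r hr] := e2 _ _ _ e''.
by exists (r \o t) => x; rewrite /= -[RHS]hr.
Qed.

Lemma ext1_retract_r A B C : retract C B -> ext1 A B -> ext1 A C.
Proof.
move=> [u [v vu]] eAB E i p e; have [g hg] := ext1_extend u eAB e.
by exists (v \o g) => x; rewrite /= hg vu.
Qed.

(* Dimension shift: Ext^1(K, B) = Ext^2(A, B) = Ext^1(A, C). *)
Lemma ext1_shift_down K P A B I C (i : {linear K -> P}) (p : {linear P -> A})
    (j : {linear B -> I}) (q : {linear I -> C}) :
  ses i p -> projective P -> ses j q -> injective_mod I -> ext1 A C -> ext1 K B.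
Proof.
move=> e hP e' hI eAC; apply: (ext1_of_lift e') => [|f]; first exact: injective_ext1.
have [g hg] := ext1_extend f eAC e.
have [_ sq _] := e'; have [h hh] := hP _ _ q g sq.
by exists (h \o i) => x; rewrite /= hh hg.
Qed.

(** Ext^1(Z2, Y) = Ext^2(Z2, Y1) sits between Ext^1(Z, Y1) and Ext^2(Z1, Y1) = Ext^1(Z1, Y).
    Concretely, a map Z -> Y lifts to I and extends from there to Z1. *)
Lemma ext1_coker_l Z Z1 Z2 Y Y1 I (i : {linear Z -> Z1}) (p : {linear Z1 -> Z2})
    (j : {linear Y1 -> I}) (q : {linear I -> Y}) :
  ses i p -> ses j q -> injective_mod I -> ext1 Z Y1 -> ext1 Z1 Y -> ext1 Z2 Y.
Proof.
move=> e e' hI e1 e2; apply: (ext1_of_extend e) => // f.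
have [g hg] := ext1_lift f e1 e'.
have [h hh] := ext1_extend g (injective_ext1 hI) e.
by exists (q \o h) => x; rewrite /= hh hg.
Qed.

(** Ext^1(X, C) sits between Ext^1(X, P) and Ext^2(X, A) = Ext^1(L, A). *)
Lemma ext1_coker_r A P C L Q X (a : {linear A -> P}) (c : {linear P -> C})
    (l : {linear L -> Q}) (x : {linear Q -> X}) :
  ses a c -> ses l x -> projective Q -> ext1 L A -> ext1 X P -> ext1 X C.
Proof.
move=> e e' hQ e1 e2; apply: (ext1_of_extend e') => [|f]; first exact: projective_ext1.
have [g hg] := ext1_lift f e1 e.
have [h hh] := ext1_extend g e2 e'.
by exists (c \o h) => z; rewrite /= hh hg.
Qed.

(** Replacing X by its cosyzygy X1 controls maps X -> A: they extend to the projective F, and from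
    there lift to P. *)
Lemma ext1_ker_r K P A L Q X F X1 (i : {linear K -> P}) (p : {linear P -> A})
    (l : {linear L -> Q}) (x : {linear Q -> X})
    (m : {linear X -> F}) (n : {linear F -> X1}) :
  ses i p -> ses l x -> projective Q -> ses m n -> projective F ->
  ext1 X1 A -> ext1 X P -> ext1 X K.
Proof.
move=> e e' hQ e'' hF e1 e2; apply: (ext1_of_lift e) => // f.
have [g hg] := ext1_extend f e1 e''.
have [_ sp _] := e; have [h hh] := hF _ _ p g sp.
by exists (h \o m) => z; rewrite /= hh hg.
Qed.

Lemma ext1_ext_r A B1 B B2 K P (i : {linear B1 -> B}) (p : {linear B -> B2})
    (l : {linear K -> P}) (x : {linear P -> A}) :
  ses i p -> ses l x -> projective P -> ext1 A B1 -> ext1 A B2 -> ext1 A B.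
Proof.
move=> e e' hP e1 e2; apply: (ext1_of_extend e') => [|f]; first exact: projective_ext1.
have [ii sp ex] := e.
have [g hg] := ext1_extend (p \o f) e2 e'.
have [h hh] := hP _ _ p g sp.
have [k hk] : exists k : {linear K -> B1}, forall x, i (k x) = (f \- (h \o l)) x.
  by apply: linear_lift_inj => // z; apply/ex; rewrite linearB /= hh hg subrr.
have [m hm] := ext1_extend k e1 e'.
by exists (h \+ (i \o m)) => z; rewrite /= hm hk /= addrC subrK.
Qed.

(** A direct summand in the stable category modulo projectives. Syzygies depend on the chosen
    presentation, and are well defined and functorial only up to this relation. *)
Definition stable_retract X Y : Prop :=
  exists P (u : {linear X -> Y}) (v : {linear Y -> X}) (a : {linear X -> P})
    (b : {linear P -> X}), projective P /\ forall x, v (u x) + b (a x) = x.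

Lemma projective0 : projective ('rV[R]_0 : lmodType R).
Proof.
move=> A B g f sg; exists \0 => x.
have -> : x = 0 by apply/rowP => - [].
by rewrite !linear0.
Qed.

Lemma retract_stable_retract X Y : retract X Y -> stable_retract X Y.
Proof.
move=> [u [v vu]]; exists ('rV[R]_0 : lmodType R), u, v, \0, \0.
by split=> [|x]; [exact: projective0 | rewrite /= addr0].
Qed.

Lemma stable_retract_refl X : stable_retract X X.
Proof. by apply: retract_stable_retract; exists idfun, idfun. Qed.

Lemma ext1_stable_retract X Y B : stable_retract X Y -> ext1 Y B -> ext1 X B.
Proof.
move=> [P [u [v [a [b [hP h]]]]]] eY; apply: ext1_of_section => E i p e.
have [v' hv'] := ext1_lift v eY e.
have [b' hb'] := ext1_lift b (projective_ext1 hP) e.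
by exists ((v' \o u) \+ (b' \o a)) => x; rewrite linearD /= hv' hb'.
Qed.

Lemma projective_retract P Q : retract P Q -> projective Q -> projective P.
Proof.
move=> [u [v vu]] hQ A B g f sg; have [h hh] := hQ _ _ g (f \o v) sg.
by exists (h \o u) => x; rewrite /= hh /= vu.
Qed.

Lemma projective_prod P Q : projective P -> projective Q -> projective (P * Q)%type.
Proof.
move=> hP hQ A B g f sg.
have [h hh] := hP _ _ g (f \o pair_fun idfun \0) sg.
have [k hk] := hQ _ _ g (f \o pair_fun \0 idfun) sg.
exists (copair_fun h k) => x; rewrite /= linearD hh hk /= -linearD.
by case: x => x y; rewrite /pair_fun /=; congr (f (_, _)); rewrite /= ?addr0 ?add0r.
Qed.

Lemma stable_retract_retract X Y : stable_retract X Y ->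
  exists2 P : lmodType R, projective P & retract X (Y * P)%type.
Proof.
move=> [P [u [v [a [b [hP h]]]]]]; exists P => //.
by exists (pair_fun u a), (copair_fun v b).
Qed.

(** Lift u, v and b to the projectives. The defect of the lifts is an endomorphism of P with values
    in K, and on K it supplies the correction through a projective. For X = Y this is a weak form of
    Schanuel's lemma. *)
Lemma stable_retract_syzygy X Y K P L Q (i : {linear K -> P}) (p : {linear P -> X})
    (j : {linear L -> Q}) (q : {linear Q -> Y}) :
  stable_retract X Y -> ses i p -> projective P -> ses j q -> projective Q -> stable_retract K L.
Proof.
move=> [F [u [v [a [b [hF h]]]]]] e hP e' hQ.
have [ii sp ex] := e; have [ij sq ex'] := e'.
have [U hU] := hP _ _ q (u \o p) sq.
have [V hV] := hQ _ _ p (v \o q) sp.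
have [W hW] := hF _ _ p b sp.
have [k hk] : exists k : {linear P -> K},
    forall x, i (k x) = (idfun \- ((V \o U) \+ (W \o (a \o p)))) x.
  apply: linear_lift_inj => // x; apply/ex.
  by rewrite linearB linearD /= hV /= hU /= hW h subrr.
have [u' hu'] : exists u' : {linear K -> L}, forall x, j (u' x) = (U \o i) x.
  by apply: linear_lift_inj => // x; apply/ex'; rewrite /= hU /= (ses0 _ e) linear0.
have [v' hv'] : exists v' : {linear L -> K}, forall x, i (v' x) = (V \o j) x.
  by apply: linear_lift_inj => // x; apply/ex; rewrite /= hV /= (ses0 _ e') linear0.
exists P, u', v', i, k; split=> // x; apply: ii.
rewrite linearD hv' hk /= hu' /= (ses0 _ e) !linear0 addr0.
by rewrite addrC subrK.
Qed.

(** Dual to the case of syzygies, except that projectives need not be injective: the maps f and g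
    between the middle terms have to be given. *)
Lemma stable_retract_cosyzygy A F A2 X P X2 (a : {linear A -> F}) (q : {linear F -> A2})
    (c : {linear X -> P}) (r : {linear P -> X2})
    (u : {linear A -> X}) (v : {linear X -> A})
    (f : {linear F -> P}) (g : {linear P -> F}) :
  ses a q -> ses c r -> projective F -> (forall x, v (u x) = x) ->
  (forall x, f (a x) = c (u x)) -> (forall x, g (c x) = a (v x)) -> stable_retract A2 X2.
Proof.
move=> e e' hF vu fa gc; have [ia sq ex] := e; have [ic sr ex'] := e'.
have [u2 hu2] : exists u2 : {linear A2 -> X2}, forall x, u2 (q x) = (r \o f) x.
  by apply: factor_surj => // x /ex [y <-] /=; rewrite fa (ses0 _ e').
have [v2 hv2] : exists v2 : {linear X2 -> A2}, forall x, v2 (r x) = (q \o g) x.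
  by apply: factor_surj => // x /ex' [y <-] /=; rewrite gc (ses0 _ e).
have [h hh] : exists h : {linear A2 -> F}, forall x, h (q x) = (idfun \- (g \o f)) x.
  by apply: factor_surj => // x /ex [y <-] /=; rewrite fa gc vu subrr.
exists F, u2, v2, h, q; split=> // y; have [x <-] := sq y.
by rewrite hu2 /= hv2 /= hh linearB /= addrC subrK.
Qed.

End Sequences.

(** * Resolutions, higher Ext and coinductive descriptions of GProj and GInj *)

Section Resolutions.
Variable R : pzRingType.
Implicit Types A B C D E F I K L M N P Q X Y Z : lmodType R.

Lemma rV_map n M (e : 'I_n -> M) :
  exists f : {linear 'rV[R]_n -> M}, forall v, f v = \sum_i v 0 i *: e i.
Proof.
apply: linear_of_fun => a v w; rewrite scaler_sumr -big_split.
by apply: eq_bigr => i _; rewrite !mxE scalerDl scalerA.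
Qed.

Lemma rV_coord n (j : 'I_n) :
  exists f : {linear 'rV[R]_n -> R^o}, forall v, f v = v 0 j.
Proof. by apply: (linear_of_fun (B := R^o)) => a v w; rewrite !mxE. Qed.

Lemma rV_tuple n M (g : 'I_n -> {linear M -> R^o}) :
  exists f : {linear M -> 'rV[R]_n}, forall x, f x = \row_j g j x.
Proof.
apply: linear_of_fun => a x y; apply/rowP => j; rewrite !mxE; exact: linearP.
Qed.

Lemma rV_basis n (v : 'rV[R]_n) : v = \sum_i v 0 i *: delta_mx 0 i.
Proof. exact: row_sum_delta. Qed.

Lemma projective_rV n : projective ('rV[R]_n : lmodType R).
Proof.
move=> A B g f sg.
have [x hx] := choice (fun i : 'I_n => sg (f (delta_mx 0 i))).
have [h hh] := rV_map x; exists h => v.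
rewrite hh linear_sum [in RHS](rV_basis v) linear_sum.
by apply: eq_bigr => i _; rewrite !linearZ hx.
Qed.

Lemma fin_genP M :
  fin_gen M <-> exists n (p : {linear 'rV[R]_n -> M}), surj p.
Proof.
split=> [[n [e he]]|[n [p sp]]].
  have [p hp] := rV_map e; exists n, p => x; have [c ->] := he x.
  by exists (\row_i c i); rewrite hp; apply: eq_bigr => i _; rewrite mxE.
exists n, (fun i => p (delta_mx 0 i)) => x; have [v <-] := sp x.
exists (fun i => v 0 i); rewrite [in LHS](rV_basis v) linear_sum.
by apply: eq_bigr => i _; rewrite linearZ.
Qed.

Lemma fin_gen_rV n : fin_gen ('rV[R]_n : lmodType R).
Proof. by apply/fin_genP; exists n, idfun => x; exists x. Qed.

Lemma fin_gen_regular : fin_gen (R^o : lmodType R).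
Proof.
exists 1%N, (fun=> 1) => x; exists (fun=> x); rewrite big_ord1.
by rewrite -[RHS]/(x * 1) mulr1.
Qed.

Lemma fin_gen_surj M N (p : {linear M -> N}) : surj p -> fin_gen M -> fin_gen N.
Proof.
move=> sp /fin_genP [n [q sq]]; apply/fin_genP; exists n, (p \o q) => x.
by have [y <-] := sp x; have [z <-] := sq y; exists z.
Qed.

Lemma fin_gen_retract M N : retract M N -> fin_gen N -> fin_gen M.
Proof. by move=> [u [v vu]]; apply: (fin_gen_surj (p := v)) => x; exists (u x). Qed.

Lemma fin_gen_prod M N : fin_gen M -> fin_gen N -> fin_gen (M * N)%type.
Proof.
move=> /fin_genP [m [p sp]] /fin_genP [n [q sq]]; apply/fin_genP.
exists (m + n)%N.
have [f hf] : exists f : {linear 'rV[R]_(m + n) -> (M * N)%type},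
    forall v, f v = (p (lsubmx v), q (rsubmx v)).
  by apply: linear_of_fun => a v w; rewrite !linearP.
exists f => - [x y]; have [v <-] := sp x; have [w <-] := sq y.
by exists (row_mx v w); rewrite hf row_mxKl row_mxKr.
Qed.

Lemma fin_gen_ext K M C (i : {linear K -> M}) (p : {linear M -> C}) : ses i p ->
  fin_gen K -> fin_gen C -> fin_gen M.
Proof.
move=> [ii sp ex] /fin_genP [m [f sf]] /fin_genP [n [g sg]].
have [h hh] := projective_rV g sp.
apply: (fin_gen_surj (p := copair_fun (i \o f) h)) (fin_gen_prod (fin_gen_rV m) (fin_gen_rV n)) => x.
have [w hw] := sg (p x).
have /ex [y hy] : p (x - h w) = 0 by rewrite linearB hh hw subrr.
have [v hv] := sf y; exists (v, w).
by rewrite -[LHS]/(i (f v) + h w) hv hy subrK.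
Qed.

(* The last clause says that maps from finitely generated modules to D factor
   through finitely generated free direct summands. *)
Lemma free_cover A : exists D (p : {linear D -> A}), [/\ surj p, projective D &
  forall N (h : {linear N -> D}), fin_gen N ->
    exists n (a : {linear N -> 'rV[R]_n}) (b : {linear 'rV[R]_n -> D})
      (c : {linear D -> 'rV[R]_n}),
      (forall x, c (b x) = x) /\ forall x, b (a x) = h x].
Proof.
have [D [inj [pr [h1 h2 h3 h4]]]] :=
  @dsum_exists R {classic A} (fun=> R^o : lmodType R).
have mulE N (y : N) : exists f : {linear R^o -> N}, forall r : R, f r = r *: y.
  by apply: linear_of_fun => a x z; rewrite scalerDl scalerA.
exists D.
have [f hf] := choice (mulE A); have [p hp] := h4 _ (fun a : {classic A} => f a).
exists p; split.
- by move=> a; exists (inj (a : {classic A}) 1); rewrite hp hf scale1r.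
- move=> X Y g q sg.
  have [l hl] := choice (fun a : {classic A} => sg (q (inj a 1))).
  have [m hm] := choice (fun a : {classic A} => mulE X (l a)).
  have [h hh] := h4 _ m; exists h => x.
  have [s us /(_ s us (fun _ => id)) ->] := h3 x.
  rewrite !linear_sum; apply: eq_bigr => i _ /=.
  rewrite hh hm linearZ hl -linearZ; congr (q _).
  by rewrite -linearZ /=; congr (inj i _); exact: mulr1.
move=> N h [n [e he]].
have hs j : exists s : seq {classic A}, uniq s /\
    forall s', uniq s' -> {subset s <= s'} ->
      h (e j) = \sum_(i <- s') inj i (pr i (h (e j))).
  by have [s us hs] := h3 (h (e j)); exists s.
have {hs} [s hs] := choice hs.
pose t := undup (flatten [seq s j | j <- enum 'I_n]).
have ut : uniq t := undup_uniq _.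
have st j : {subset s j <= t}.
  move=> i hi; rewrite mem_undup; apply/flattenP; exists (s j) => //.
  by apply: map_f; rewrite mem_enum.
pose T := in_tuple t.
have injT : injective (tnth T) by exact: (elimT (tuple_uniqP T) ut).
exists (size t).
have [b hb] : exists b : {linear 'rV[R]_(size t) -> D},
    forall v, b v = \sum_j inj (tnth T j) (v 0 j).
  apply: linear_of_fun => a v w; rewrite scaler_sumr -big_split.
  by apply: eq_bigr => i _; rewrite !mxE; exact: linearP.
have [c hc] := rV_tuple (fun j => pr (tnth T j)).
have hcb x : c (b x) = x.
  apply/rowP => j; rewrite hc hb mxE linear_sum (bigD1 j) //= h1 big1 ?addr0 //.
  move=> i ij; rewrite h2 // => /injT e'.
  by rewrite e' eqxx in ij.
exists (c \o h), b, c; split=> // x /=.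
rewrite hb; under eq_bigr => j _ do rewrite hc mxE.
have [k ->] := he x; rewrite linear_sum.
under eq_bigr => j _ do rewrite !linear_sum.
rewrite exchange_big; apply: eq_bigr => j _ /=.
rewrite linearZ /= [in RHS]((hs j).2 t ut (st j)) (big_tnth _ _ t) scaler_sumr.
by apply: eq_bigr => i _; rewrite !linearZ.
Qed.

Record presentation A := Presentation {
  pres_syz : lmodType R;
  pres_obj : lmodType R;
  pres_inj : {linear pres_syz -> pres_obj};
  pres_proj : {linear pres_obj -> A};
  pres_projective : projective pres_obj;
  pres_ses : ses pres_inj pres_proj
}.

Lemma cover_ses A : exists K P (i : {linear K -> P}) (p : {linear P -> A}),
  projective P /\ ses i p.
Proof.
have [P [p [sp hP _]]] := free_cover A; have [K [i e]] := ker_ses sp.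
by exists K, P, i, p.
Qed.

Lemma presentation_inhabited A : exists _ : presentation A, True.
Proof. by have [K [P [i [p [hP e]]]]] := cover_ses A; exists (Presentation hP e). Qed.

Definition cover A : presentation A := projT1 (cid (presentation_inhabited A)).

Definition syzygy n A := iter n (fun B => pres_syz (cover B)) A.

Definition resolution A : proj_resolution A.
Proof.
refine (@ProjResolution R A (fun n => pres_obj (cover (syzygy n A)))
  (fun n => pres_inj (cover (syzygy n A)) \o pres_proj (cover (syzygy n.+1 A)))
  (pres_proj (cover A)) _ _ _ _).
- by move=> n; apply: pres_projective.
- move=> n y; have [ii _ _] := pres_ses (cover (syzygy n A)).
  have [_ sp _] := pres_ses (cover (syzygy n.+2 A)).
  have [_ _ ex] := pres_ses (cover (syzygy n.+1 A)); split=> /= [h|[x <-]].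
    have /ex [z <-] : pres_proj (cover (syzygy n.+1 A)) y = 0.
      by apply: ii; rewrite h linear0.
    by have [x <-] := sp z; exists x.
  by rewrite (ses0 _ (pres_ses (cover (syzygy n.+1 A)))) linear0.
- move=> y; have [_ sp _] := pres_ses (cover (syzygy 1 A)).
  have [_ _ ex] := pres_ses (cover A); rewrite ex; split=> [[z <-]|[x <-]].
    by have [x <-] := sp z; exists x.
  by eexists.
- by have [_ sp _] := pres_ses (cover A).
Defined.

Section ResolutionCons.
Variables (A K P : lmodType R) (i : {linear K -> P}) (p : {linear P -> A}).
Hypotheses (hP : projective P) (e : ses i p).
Variable r : proj_resolution K.

Definition cons_obj n : lmodType R := if n is m.+1 then res_obj r m else P.
Definition cons_diff n : {linear cons_obj n.+1 -> cons_obj n} :=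
  match n return {linear cons_obj n.+1 -> cons_obj n} with
  | 0 => i \o res_aug r
  | m.+1 => res_diff r m
  end.

(** Transparent, like [resolution_tail]: [Ext_zero_vanish] identifies cochains on the new resolution
    with cochains on [r] by conversion. *)
Definition resolution_cons : proj_resolution A.
Proof.
refine (@ProjResolution R A cons_obj cons_diff p _ _ _ _).
- by case=> //= n; apply: res_proj.
- move=> [|n]; last exact (@res_exact _ _ r n).
  move=> y; have [ii sp ex] := e.
  rewrite -(@res_exact0 _ _ (r) y) /=; split=> [h|->]; last by rewrite linear0.
  by apply: ii; rewrite h linear0.
- move=> y; have [ii sp ex] := e.
  rewrite ex; split=> [[z <-]|[x <-]]; last by eexists.
  by have [x <-] := res_aug_surj r z; exists x.
- by have [_ sp _] := e.
Defined.
End ResolutionCons.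

Section ResolutionTail.
Variables (A K : lmodType R) (r : proj_resolution A).
Variables (i : {linear K -> res_obj r 0}) (e : ses i (res_aug r)).

Lemma resolution_tail_aug : exists t : {linear res_obj r 1 -> K},
  forall x, i (t x) = res_diff r 0 x.
Proof.
have [ii _ ex] := e; apply: (linear_lift_inj (f := res_diff r 0)) => // x.
by apply/ex/res_exact0; exists x.
Qed.

Variables (t : {linear res_obj r 1 -> K}) (ht : forall x, i (t x) = res_diff r 0 x).

Definition resolution_tail : proj_resolution K.
Proof.
refine (@ProjResolution R K (fun n => res_obj r n.+1) (fun n => res_diff r n.+1)
  t _ _ _ _).
- by move=> n; apply: res_proj.
- by move=> n; apply: res_exact.
- move=> y; have [ii sp ex] := e.
  rewrite -(@res_exact _ _ r 0 y) -ht; split=> [->|h].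
    by rewrite linear0.
  by apply: ii; rewrite h linear0.
- move=> y; have [ii sp ex] := e.
  have : exists x, i x = i y by exists y.
  by move=> /ex /res_exact0 [x hx]; exists x; apply: ii; rewrite ht.
Defined.
End ResolutionTail.

(* Vanishing of Ext^(n+1)(A, B), by dimension shifting. *)
Fixpoint Ext_vanish n A B : Prop :=
  match n with
  | 0 => ext1 A B
  | m.+1 => forall K P (i : {linear K -> P}) (p : {linear P -> A}),
      projective P -> ses i p -> Ext_vanish m K B
  end.

(** Prolonging a resolution of a syzygy, or cutting off the term of degree 0, shifts cohomology by
    one degree. [Ext_zero] speaks of all resolutions, so the one adapted to a given presentation may
    be chosen. *)
Lemma Ext_zero_vanish n A B : Ext_zero n.+1 A B <-> Ext_vanish n A B.
Proof.
elim: n A => [|n IH] A; split.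
- move=> h; have [K [P [i [p [hP e]]]]] := cover_ses A.
  apply: (ext1_of_extend e) => [|f]; first exact: projective_ext1.
  have [|g hg] := h (resolution_cons hP e (resolution K)) (f \o res_aug (resolution K)).
    move=> x /=; suff -> : res_aug (resolution K) (res_diff (resolution K) 0 x) = 0.
      by rewrite linear0.
    by apply/(@res_exact0 _ _ (resolution K)); exists x.
  exists g => y; have [x <-] := res_aug_surj (resolution K) y.
  by rewrite -hg.
- move=> h r f hf; have [K [i e]] := ker_ses (res_aug_surj (r)).
  have [ii sp ex] := e; have [t ht] := resolution_tail_aug e.
  have [f' hf'] : exists f' : {linear K -> B}, forall x, f' (t x) = f x.
    apply: factor_surj => [y|x hx].
      have : exists x, i x = i y by exists y.
      by move=> /ex /res_exact0 [x hx]; exists x; apply: ii; rewrite ht.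
    have /res_exact [y <-] : res_diff r 0 x = 0 by rewrite -ht hx linear0.
    exact: hf.
  have [g hg] := ext1_extend f' h e.
  by exists g => x; rewrite -ht hg.
- move=> h K P i p hP e; apply/IH => r f hf.
  exact: (h (resolution_cons hP e r) f hf).
- move=> h r f hf; have [K [i e]] := ker_ses (res_aug_surj (r)).
  have [t ht] := resolution_tail_aug e.
  have /IH h' := h _ _ _ _ (@res_proj _ _ r 0) e.
  exact: (h' (resolution_tail e ht) f hf).
Qed.

(** * Vanishing of Ext in all positive degrees *)

Definition perp A B : Prop := forall n, Ext_vanish n A B.

Lemma perpP A B : (forall n, (1 <= n)%N -> Ext_zero n A B) <-> perp A B.
Proof.
split=> h n; first by apply/Ext_zero_vanish/h.
by case: n => // n _; apply/Ext_zero_vanish.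
Qed.

Lemma Ext_vanish_stable_retract n X Y B : stable_retract X Y -> Ext_vanish n Y B -> Ext_vanish n X B.
Proof.
elim: n X Y => [|n IH] X Y s; first exact: ext1_stable_retract.
move=> h K P i p hP e; have [L [Q [j [q [hQ e']]]]] := cover_ses Y.
by apply: (IH K L); [apply: (stable_retract_syzygy s e hP e' hQ) | apply: h hQ e'].
Qed.

Lemma Ext_vanish_syzygy n A K P (i : {linear K -> P}) (p : {linear P -> A}) B :
  projective P -> ses i p -> Ext_vanish n K B -> Ext_vanish n.+1 A B.
Proof.
move=> hP e h L Q j q hQ e'; apply: Ext_vanish_stable_retract h.
exact: stable_retract_syzygy (stable_retract_refl A) e' hQ e hP.
Qed.

Lemma perp_syzygy A K P (i : {linear K -> P}) (p : {linear P -> A}) B :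
  projective P -> ses i p -> perp A B -> perp K B.
Proof. by move=> hP e h n; apply: (h n.+1) hP e. Qed.

Lemma perp_of_syzygy A K P (i : {linear K -> P}) (p : {linear P -> A}) B :
  projective P -> ses i p -> ext1 A B -> perp K B -> perp A B.
Proof. by move=> hP e h h' [//|n]; apply: Ext_vanish_syzygy hP e (h' n). Qed.

Lemma perp_stable_retract X Y B : stable_retract X Y -> perp Y B -> perp X B.
Proof. by move=> s h n; apply: Ext_vanish_stable_retract s (h n). Qed.

(** One syzygy inside the class is enough for dimension shifting, because any two syzygies are
    stable retracts of each other. *)
Lemma perp_class (S : lmodType R -> Prop) B :
  (forall A, S A -> ext1 A B /\ exists K P (i : {linear K -> P}) (p : {linear P -> A}),
    [/\ projective P, ses i p & S K]) ->
  forall A, S A -> perp A B.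
Proof.
move=> h A hA n; elim: n A hA => [|n IH] A hA; have [e [K [P [i [p [hP e' hK]]]]]] := h A hA => //.
exact: Ext_vanish_syzygy hP e' (IH K hK).
Qed.

Lemma perp_projective P B : projective P -> perp P B.
Proof.
apply: (perp_class (S := fun P => projective P)) => {P} P hP.
split; first exact: projective_ext1.
exists ('rV[R]_0 : lmodType R), P, \0, idfun; split=> //; last exact: projective0.
split=> [x y _|x|y]; [by apply/rowP => - [] | by exists x |].
by split=> [/= ->|[x <-]] //; exists 0.
Qed.

Lemma horseshoe A1 A A2 K1 P1 K2 P2 (i : {linear A1 -> A}) (p : {linear A -> A2})
    (i1 : {linear K1 -> P1}) (p1 : {linear P1 -> A1})
    (i2 : {linear K2 -> P2}) (p2 : {linear P2 -> A2}) :
  ses i p -> ses i1 p1 -> ses i2 p2 -> projective P2 ->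
  exists K (j : {linear K -> (P1 * P2)%type}) (q : {linear (P1 * P2)%type -> A})
    (k : {linear K1 -> K}) (l : {linear K -> K2}), ses j q /\ ses k l.
Proof.
move=> e e1 e2 hP2; have [ii sp ex] := e; have [ii1 sp1 ex1] := e1.
have [ii2 sp2 ex2] := e2.
have [h hh] := hP2 _ _ p p2 sp.
pose q : {linear (P1 * P2)%type -> A} := copair_fun (i \o p1) h.
have qE x : q x = i (p1 x.1) + h x.2 by [].
have sq : surj q.
  move=> a; have [y hy] := sp2 (p a).
  have /ex [b hb] : p (a - h y) = 0 by rewrite linearB hh hy subrr.
  have [x hx] := sp1 b; exists (x, y).
  by rewrite qE /= hx hb subrK.
have [K [j ej]] := ker_ses sq; have [ij _ exj] := ej.
have [k hk] : exists k : {linear K1 -> K}, forall x,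
    j (k x) = (pair_fun i1 \0 : {linear K1 -> (P1 * P2)%type}) x.
  apply: linear_lift_inj => // x; apply/exj.
  by rewrite qE /= (ses0 _ e1) !linear0 addr0.
have [l hl] : exists l : {linear K -> K2}, forall x, i2 (l x) = (j x).2.
  apply: (linear_lift_inj (f := snd \o j : {linear K -> P2})) => // x; apply/ex2.
  have := ses0 x ej; rewrite qE /= => /(congr1 p).
  by rewrite linearD (ses0 _ e) hh linear0 add0r.
exists K, j, q, k, l; split=> //; split.
- apply: linear_inj => x hx; apply: ii1; have := hk x; rewrite hx !linear0.
  by rewrite -[RHS]/(i1 x, 0) => - [<-].
- move=> y; have /ex [b hb] : p (h (i2 y)) = 0 by rewrite hh (ses0 _ e2).
  have [x hx] := sp1 b.
  have /exj [z hz] : q (- x, i2 y) = 0.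
    by rewrite qE /= !linearN hx hb addNr.
  by exists z; apply: ii2; rewrite hl hz.
- move=> z; split=> [hz|[x <-]]; last first.
    by apply: ii2; rewrite hl hk linear0.
  have z2 : (j z).2 = 0 by rewrite -hl hz linear0.
  have := ses0 z ej; rewrite qE z2 linear0 addr0 -(linear0 i) => /ii /ex1 [x hx].
  exists x; apply: ij; rewrite hk -[LHS]/(i1 x, 0) hx -z2; by case: (j z).
Qed.

Lemma perp_ext A1 A A2 (i : {linear A1 -> A}) (p : {linear A -> A2}) B :
  ses i p -> perp A1 B -> perp A2 B -> perp A B.
Proof.
move=> e h1 h2; apply: (perp_class (S := fun A => exists A1 A2
  (i : {linear A1 -> A}) (p : {linear A -> A2}), [/\ ses i p, perp A1 B & perp A2 B]));
  last by exists A1, A2, i, p.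
move=> {A1 A A2 i p e h1 h2} A [A1 [A2 [i [p [e h1 h2]]]]].
split; first by apply: ext1_ext_l e (h1 0%N) (h2 0%N).
have [K1 [P1 [i1 [p1 [hP1 e1]]]]] := cover_ses A1.
have [K2 [P2 [i2 [p2 [hP2 e2]]]]] := cover_ses A2.
have [K [j [q [k [l [ej ek]]]]]] := horseshoe e e1 e2 hP2.
exists K, (P1 * P2)%type, j, q; split=> //; first exact: projective_prod.
by exists K1, K2, k, l; split=> //; [apply: perp_syzygy e1 h1 | apply: perp_syzygy e2 h2].
Qed.

(* Rotating Y -> X -> A to K -> Z -> X, where P -> A is a projective cover
   with kernel K and Z is an extension of P by Y. *)
Lemma perp_ker Y X A (i : {linear Y -> X}) (p : {linear X -> A}) B :
  ses i p -> perp X B -> perp A B -> perp Y B.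
Proof.
move=> e hX hA; have [ii sp ex] := e.
have [K [P [j [q [hP e']]]]] := cover_ses A; have [ij sq ex'] := e'.
have [h hh] := hP _ _ p q sp.
pose z : {linear (Y * P)%type -> X} := copair_fun i h.
have zE x : z x = i x.1 + h x.2 by [].
have [k hk] : exists k : {linear K -> Y}, forall x, i (k x) = (h \o j) x.
  by apply: linear_lift_inj => // x; apply/ex; rewrite /= hh (ses0 _ e').
have e2 : ses (pair_fun (\- k) j : {linear K -> (Y * P)%type}) z.
  split.
  - by move=> x y [_ /ij].
  - move=> x; have [y hy] := sq (p x).
    have /ex [b hb] : p (x - h y) = 0 by rewrite linearB hh hy subrr.
    by exists (b, y); rewrite zE /= hb subrK.
  - move=> [a b]; rewrite zE /=; split=> [h0|[x [<- <-]]]; last first.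
      by rewrite linearN /= hk addNr.
    have /ex' [x hx] : q b = 0.
      by have := congr1 p h0; rewrite linearD (ses0 _ e) linear0 add0r hh.
    exists x; rewrite -[LHS]/(- k x, j x) hx; congr pair.
    apply: ii; rewrite linearN hk /= hx; apply/eqP.
    by rewrite eq_sym -addr_eq0 h0.
apply: (perp_stable_retract (Y := (Y * P)%type)).
  by apply: retract_stable_retract; exists (pair_fun idfun \0), fst.
by apply: (perp_ext e2) => //; apply: perp_syzygy e' hA.
Qed.

(** * Complexes spliced from short exact sequences *)

Lemma int_chain (T : Type) (r : T -> T -> Prop) :
  (forall x, exists y, r x y) -> (forall y, exists x, r x y) ->
  forall x0 (z : int), exists s : int -> T, s z = x0 /\ forall j, r (s j) (s (j + 1)).
Proof.
move=> tot sur x0 z; have [f hf] := choice tot; have [g hg] := choice sur.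
pose s (j : int) := match j with Posz n => iter n f x0 | Negz n => iter n.+1 g x0 end.
have sP j : r (s j) (s (j + 1)).
  case: j => [n|[|n]].
  - by rewrite -PoszD addn1; exact: hf.
  - exact: hg.
  - have -> : Negz n.+1 + 1 = Negz n by rewrite !NegzE -[in LHS]addn1 PoszD opprD addrNK.
    exact: hg.
exists (fun j => s (j - z)); split; first by rewrite subrr.
by move=> j; rewrite addrAC; exact: sP.
Qed.

(* GProj is the largest such class. *)
Definition gp_class (S : lmodType R -> Prop) : Prop := forall A, S A ->
  [/\ forall Q, projective Q -> ext1 A Q,
      exists K P (i : {linear K -> P}) (p : {linear P -> A}),
        [/\ S K, projective P & ses i p]
    & exists P B (i : {linear A -> P}) (p : {linear P -> B}),
        [/\ S B, projective P & ses i p]].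

Definition gi_class (S : lmodType R -> Prop) : Prop := forall A, S A ->
  [/\ forall I, injective_mod I -> ext1 I A,
      exists K I (i : {linear K -> I}) (p : {linear I -> A}),
        [/\ S K, injective_mod I & ses i p]
    & exists I B (i : {linear A -> I}) (p : {linear I -> B}),
        [/\ S B, injective_mod I & ses i p]].

Lemma splice (S T : lmodType R -> Prop) :
  (forall A, S A -> exists K P (i : {linear K -> P}) (p : {linear P -> A}),
        [/\ S K, T P & ses i p]) ->
  (forall A, S A -> exists P B (i : {linear A -> P}) (p : {linear P -> B}),
        [/\ S B, T P & ses i p]) ->
  forall A (z : int), S A ->
  exists (N P : int -> lmodType R) (i : forall j, {linear N j -> P j})
    (p : forall j, {linear P j -> N (j + 1)}),
    [/\ N z = A, forall j, S (N j), forall j, T (P j) & forall j, ses (i j) (p j)].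
Proof.
move=> hl hr A z hA.
pose r (X Y : {X | S X}) := exists P (i : {linear sval X -> P}) (p : {linear P -> sval Y}),
  T P /\ ses i p.
have [|| s [sz sr]] := @int_chain _ r _ _ (exist _ A hA) z.
- move=> [X hX]; have [P [B [i [p [hB hP e]]]]] := hr X hX.
  by exists (exist _ B hB), P, i, p.
- move=> [X hX]; have [K [P [i [p [hK hP e]]]]] := hl X hX.
  by exists (exist _ K hK), P, i, p.
pose P j := projT1 (cid (sr j)).
pose i j : {linear sval (s j) -> P j} := projT1 (cid (projT2 (cid (sr j)))).
pose p j : {linear P j -> sval (s (j + 1))} :=
  projT1 (cid (projT2 (cid (projT2 (cid (sr j)))))).
have h j : T (P j) /\ ses (i j) (p j) :=
  projT2 (cid (projT2 (cid (projT2 (cid (sr j)))))).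
exists (fun j => sval (s j)), P, i, p; split; first by rewrite sz.
- by move=> j; exact: (svalP (s j)).
- by move=> j; case: (h j).
- by move=> j; case: (h j).
Qed.

Section Spliced.
Variables (N P : int -> lmodType R) (i : forall j, {linear N j -> P j})
  (p : forall j, {linear P j -> N (j + 1)}) (e : forall j, ses (i j) (p j)).

Definition spliced : cochain R :=
  Cochain (fun j => (i (j + 1) \o p j : {linear P j -> P (j + 1)})).

Lemma spliced_acyclic : acyclic spliced.
Proof.
move=> j y; split=> /= [h|[x <-]]; last by rewrite (ses0 _ (e _)) linear0.
have [ii _ _] := e (j + 1 + 1); have [_ _ ex] := e (j + 1).
have /ex [z <-] : p (j + 1) y = 0 by apply: ii; rewrite h linear0.
by have [_ sp _] := e j; have [x <-] := sp z; exists x.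
Qed.

Lemma spliced_from M : (forall j, ext1 (N j) M) -> Hom_from_acyclic spliced M.
Proof.
move=> h j f; split=> [f0|[g hg] x]; last first.
  by rewrite -hg /= (ses0 _ (e _)) !linear0.
have [f' hf'] : exists f' : {linear N (j + 1 + 1) -> M}, forall x, f' (p (j + 1) x) = f x.
  have [_ sp ex] := e (j + 1); apply: factor_surj => // x /ex [z <-].
  by have [_ sp' _] := e j; have [y <-] := sp' z; exact: f0.
have [g hg] := ext1_extend f' (h _) (e (j + 1 + 1)).
by exists g => x; rewrite /= hg hf'.
Qed.

Lemma spliced_to M : (forall j, ext1 M (N j)) -> Hom_to_acyclic M spliced.
Proof.
move=> h j f; split=> [f0|[g hg] x]; last first.
  by rewrite -hg /= (ses0 _ (e _)) !linear0.
have [f' hf'] : exists f' : {linear M -> N (j + 1)}, forall x, i (j + 1) (f' x) = f x.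
  have [ii _ ex] := e (j + 1); apply: linear_lift_inj => // x; apply/ex.
  by have [ii' _ _] := e (j + 1 + 1); apply: ii'; rewrite linear0 -(f0 x).
have [g hg] := ext1_lift f' (h _) (e j).
by exists g => x; rewrite /= hg hf'.
Qed.
End Spliced.

Lemma GProj_of_class S A : gp_class S -> S A -> GProj A.
Proof.
move=> hS hA.
(* A is placed at index 0 + 1, the target of [p 0]: the cokernel of the differential from degree -1
   to degree 0 is [N (0 + 1)]. *)
have [||N [P [i [p [NA hN hP e]]]]] := @splice S (fun P => projective P) _ _ A (0 + 1) hA.
- by move=> X /hS [].
- by move=> X /hS [].
exists (spliced i p).
  split=> //; first exact: spliced_acyclic.
  by move=> Q hQ; apply: spliced_from => // j; have [h _ _] := hS _ (hN j); apply: h.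
move: NA => <-.
exists (p 0); have [_ sp ex] := e 0; split=> // y.
rewrite (ex y); split=> [[z <-]|[x <-]]; last by eexists.
by have [_ sp' _] := e (-1); have [x <-] := sp' z; exists x.
Qed.

Lemma GInj_of_class S A : gi_class S -> S A -> GInj A.
Proof.
move=> hS hA.
have [||N [P [i [p [NA hN hP e]]]]] := @splice S (fun I => injective_mod I) _ _ A 0 hA.
- by move=> X /hS [].
- by move=> X /hS [].
exists (spliced i p).
  split=> //; first exact: spliced_acyclic.
  by move=> Q hQ; apply: spliced_to => // j; have [h _ _] := hS _ (hN j); apply: h.
move: NA => <-.
exists (i 0); have [ii _ ex] := e 0; split=> // y.
rewrite -(ex y); split=> [h|/= ->]; last by rewrite linear0.
by have [ii' _ _] := e (0 + 1); apply: ii'; rewrite linear0 -h.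
Qed.

(** The auxiliary class admits the cokernel in any degree of the complex, so it is visibly stable
    under syzygies and cosyzygies and no complex has to be reindexed. *)
Lemma gp_class_GProj : gp_class (@GProj R).
Proof.
pose S A := exists C : cochain R, totally_acyclic_proj C /\ exists j
  (pi : {linear cobj C (j + 1) -> A}), surj pi /\ exact (cdiff C j) pi.
suff hS : gp_class S.
  have SG A : S A -> GProj A by apply: GProj_of_class.
  have GS A : GProj A -> S A by move=> [C hC [pi h]]; exists C; split=> //; exists (-1), pi.
  move=> A /GS /hS [h1 [K [P [i [p [hK hP e]]]]] [Q [B [j [q [hB hQ e']]]]]].
  split=> //; first by exists K, P, i, p; split=> //; exact: SG.
  by exists Q, B, j, q; split=> //; exact: SG.
move=> A [C [[hP aC hC] [j0 [pi0 [sp0 ex0]]]]].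
have [j ej] : exists j, j0 = j + 1 by exists (j0 - 1); rewrite subrK.
subst j0; have [K [i e]] := ker_ses sp0; have [ii _ ex] := e.
have [t ht] : exists t : {linear cobj C (j + 1) -> K},
    forall x, i (t x) = cdiff C (j + 1) x.
  by apply: linear_lift_inj => // x; apply/ex/ex0; exists x.
have st : surj t.
  move=> y; have /ex0 [x hx] : pi0 (i y) = 0 by apply: ses0 e.
  by exists x; apply: ii; rewrite ht.
split.
- move=> Q hQ; apply: (ext1_of_extend e) => [|f]; first exact: projective_ext1.
  have /(hC Q hQ j (f \o t)) [g hg] : forall x, (f \o t) (cdiff C j x) = 0.
    move=> x /=; suff -> : t (cdiff C j x) = 0 by rewrite linear0.
    by apply: ii; rewrite ht linear0; apply/aC; exists x.
  by exists g => y; have [x <-] := st y; rewrite ht hg.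
- exists K, (cobj C (j + 1 + 1)), i, pi0; split=> //.
  exists C; split=> //; exists j, t; split=> // y.
  by rewrite -(aC j y) -ht; split=> [->|h]; [rewrite linear0 | apply: ii; rewrite h linear0].
- have [v hv] : exists v : {linear A -> cobj C (j + 1 + 1 + 1)},
      forall x, v (pi0 x) = cdiff C (j + 1 + 1) x.
    by apply: factor_surj => // x /ex0 hx; apply/aC.
  have iv : injective v.
    apply: linear_inj => x; have [y <-] := sp0 x.
    by rewrite hv => /aC /ex0.
  have [B [q eq]] := coker_ses iv; have [_ sq exq] := eq.
  exists (cobj C (j + 1 + 1 + 1)), B, v, q; split=> //.
  exists C; split=> //; exists (j + 1 + 1), q; split=> // y.
  rewrite exq; split=> [[x <-]|[x <-]]; last by exists (pi0 x); rewrite hv.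
  by have [z <-] := sp0 x; exists z; rewrite hv.
Qed.

Lemma gi_class_GInj : gi_class (@GInj R).
Proof.
pose S A := exists C : cochain R, totally_acyclic_inj C /\ exists j
  (i : {linear A -> cobj C j}), injective i /\ exact i (cdiff C j).
suff hS : gi_class S.
  have SG A : S A -> GInj A by apply: GInj_of_class.
  have GS A : GInj A -> S A by move=> [C hC [i h]]; exists C; split=> //; exists 0, i.
  move=> A /GS /hS [h1 [K [P [i [p [hK hP e]]]]] [Q [B [j [q [hB hQ e']]]]]].
  split=> //; first by exists K, P, i, p; split=> //; exact: SG.
  by exists Q, B, j, q; split=> //; exact: SG.
move=> A [C [[hP aC hC] [j0 [i0 [ii0 ex0]]]]].
have [j ej] : exists j, j0 = j + 1 by exists (j0 - 1); rewrite subrK.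
subst j0.
have [B [k [ik hk]]] := sub_exists (submod_ker (cdiff C (j + 1 + 1))).
have [t ht] : exists t : {linear cobj C (j + 1) -> B},
    forall x, k (t x) = cdiff C (j + 1) x.
  by apply: linear_lift_inj => // x; apply/hk/aC; exists x.
have e : ses i0 t.
  split=> // [y|y]; last first.
    rewrite -ex0 -ht; split=> [->|h]; first by rewrite linear0.
    by apply: ik; rewrite h linear0.
  have /hk /aC [x hx] : exists z, k z = k y by exists y.
  by exists x; apply: ik; rewrite ht.
split.
- move=> I hI; apply: (ext1_of_lift e) => [|f]; first exact: injective_ext1.
  have [g hg] := (hC I hI (j + 1) (k \o f)).1 (fun x => (hk _).2 (ex_intro _ (f x) erefl)).
  by exists g => x; apply: ik; rewrite ht hg.
- have [K [l [il hl]]] := sub_exists (submod_ker (cdiff C j)).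
  have [q hq] : exists q : {linear cobj C j -> A}, forall x, i0 (q x) = cdiff C j x.
    by apply: linear_lift_inj => // x; apply/ex0/aC; exists x.
  exists K, (cobj C j), l, q; split=> //; last first.
    split=> // [y|y].
      have /ex0 /aC [x hx] : exists z, i0 z = i0 y by exists y.
      by exists x; apply: ii0; rewrite hq.
    rewrite -hl -hq; split=> [->|h]; first by rewrite linear0.
    by apply: ii0; rewrite h linear0.
  by exists C; split=> //; exists j, l; split=> // y; rewrite hl.
- exists (cobj C (j + 1)), B, i0, t; split=> //.
  by exists C; split=> //; exists (j + 1 + 1), k; split=> // y; rewrite hk.
Qed.

End Resolutions.

(** * Chain conditions and Hopkins' theorem *)

Section Chains.
Variable R : pzRingType.
Implicit Types K M N : lmodType R.

Definition span M n (e : 'I_n -> M) (x : M) : Prop :=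
  exists c : 'I_n -> R, x = \sum_i c i *: e i.

Definition fin_gen_submod M (S : M -> Prop) : Prop :=
  exists n (e : 'I_n -> M), (forall i, S (e i)) /\ forall x, S x -> span e x.

Definition noetherian M : Prop :=
  forall S : M -> Prop, submod S -> fin_gen_submod S.

Definition dcc M : Prop := forall u : nat -> M -> Prop,
  (forall n, submod (u n)) -> (forall n x, u n.+1 x -> u n x) ->
  exists n, forall m, (n <= m)%N -> forall x, u n x -> u m x.

Lemma zorn_submod M (P : (M -> Prop) -> Prop) (S0 : M -> Prop) :
  submod S0 -> P S0 ->
  (forall F : (M -> Prop) -> Prop, (exists S, F S) ->
     (forall S, F S -> [/\ submod S, P S & forall x, S0 x -> S x]) ->
     (forall S T, F S -> F T -> (forall x, S x -> T x) \/ (forall x, T x -> S x)) ->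
     submod (fun x => exists2 S, F S & S x) ->
     P (fun x => exists2 S, F S & S x)) ->
  exists S, [/\ submod S, P S, forall x, S0 x -> S x
    & forall T, submod T -> P T -> (forall x, S x -> T x) -> forall x, T x -> S x].
Proof.
move=> hS0 PS0 chain.
pose Q (S : M -> Prop) := [/\ submod S, P S & forall x, S0 x -> S x].
pose T := {S : M -> Prop | Q S}; pose mk S (h : Q S) : T := exist Q S h.
pose r (S S' : T) := `[< forall x, sval S x -> sval S' x >].
have q0 : Q S0 by [].
have [|||[S hS] mS] := @ZL_preorder T (mk S0 q0) r.
- by move=> t; apply/asboolP.
- by move=> a b c /asboolP ab /asboolP bc; apply/asboolP => x /ab /bc.
- move=> A tot; have [[[S1 hS1] AS1]|Ae] := pselect (exists s, A s); last first.
    by exists (mk S0 q0) => s As; case: Ae; exists s.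
  pose F S := exists h, A (mk S h).
  have FS S : F S -> Q S by move=> [h _].
  have Ftot S S' : F S -> F S' -> (forall x, S x -> S' x) \/ (forall x, S' x -> S x).
    by move=> [h1 a1] [h2 a2]; have [/asboolP|/asboolP] := tot _ _ a1 a2; [left|right].
  have F1 : F S1 by exists hS1.
  have hU : submod (fun x => exists2 S, F S & S x).
    split; first by exists S1 => //; case: (hS1) => - [].
    move=> a x y [S2 F2 S2x] [S3 F3 S3y].
    have [[h2 _ _] [h3 _ _]] := (FS _ F2, FS _ F3).
    have [h|h] := Ftot _ _ F2 F3; [exists S3 | exists S2] => //.
      by case: h3 => _; apply=> //; exact: h.
    by case: h2 => _; apply=> //; exact: h.
  have qU : Q (fun x => exists2 S, F S & S x).
    split=> //; first by apply: chain => //; exists S1.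
    by move=> x hx; exists S1 => //; case: (hS1) => _ _; exact.
  exists (mk _ qU) => - [S hS] AS; apply/asboolP => /= x Sx.
  by exists S => //; exists hS.
have [h1 h2 h3] := hS; exists S; split=> // S' hS' PS' SS'.
have q' : Q S'.
  by split=> // x /h3 /SS'.
have rr : r (mk S hS) (mk S' q') by apply/asboolP.
by have /asboolP := mS _ rr.
Qed.

Lemma dcc_min M (P : (M -> Prop) -> Prop) (S0 : M -> Prop) :
  dcc M -> submod S0 -> P S0 ->
  exists S, [/\ submod S, P S
    & forall T, submod T -> P T -> (forall x, T x -> S x) -> forall x, S x -> T x].
Proof.
move=> hM hS0 PS0; apply: contrapT => no.
pose T := {S : M -> Prop | submod S /\ P S}.
have next (S : T) : exists S' : T,
    (forall x, sval S' x -> sval S x) /\ exists x, sval S x /\ ~ sval S' x.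
  case: S => S [hS PS]; apply: contrapT => no'; apply: no; exists S; split=> //.
  move=> S' hS' PS' sub x Sx; apply: contrapT => nx; apply: no'.
  by exists (exist _ S' (conj hS' PS')); split=> //; exists x.
have [f hf] := choice next.
pose u n := iter n f (exist _ S0 (conj hS0 PS0)).
have [||n hn] := hM (fun n => sval (u n)).
- by move=> n; case: (svalP (u n)).
- by move=> n x; have [h _] := hf (u n); exact: h.
have [_ [x [hx]]] := hf (u n); apply.
by apply: (hn n.+1).
Qed.

Lemma fin_gen_submod_ext M (S T : M -> Prop) n (e : 'I_n -> M) :
  fin_gen_submod T -> (forall x, T x -> S x) -> (forall i, S (e i)) ->
  (forall x, S x -> exists c : 'I_n -> R, T (x - \sum_i c i *: e i)) ->
  fin_gen_submod S.
Proof.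
move=> [m [t [tT ht]]] TS eS h.
exists (m + n)%N, (fun i => match split i with inl j => t j | inr j => e j end).
split=> [i|x /h [c /ht [d hd]]]; first by case: split => j //; exact/TS.
exists (fun i => match split i with inl j => d j | inr j => c j end).
rewrite big_split_ord /=.
under eq_bigr => i _ do rewrite (unsplitK (inl _ i)).
under [X in _ + X]eq_bigr => i _ do rewrite (unsplitK (inr _ i)).
by rewrite -hd subrK.
Qed.

Definition noetherian_ring : Prop := noetherian R^o.

(** The left ideal of coefficients of the last generator in elements of S, analogous to leading
    coefficients. Both finiteness conditions pass from R to finitely generated modules by induction
    on the number of generators, through this ideal and the part of S spanned by the other
    generators. *)
Let lastgen M n (e : 'I_n.+1 -> M) (S : M -> Prop) (c : R^o) : Prop :=
  exists2 y, span (fun i : 'I_n => e (widen_ord (leqnSn n) i)) y & S (y + (c : R) *: e ord_max).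

Lemma noetherian_sub K M (i : {linear K -> M}) : injective i -> noetherian M -> fin_gen K.
Proof.
move=> ii hM; have [n [e [eS he]]] := hM _ (submod_im i).
have [f hf] := choice eS; exists n, f => x.
have [|c hc] := he (i x); first by exists x.
exists c; apply: ii; rewrite hc linear_sum; apply: eq_bigr => j _.
by rewrite linearZ hf.
Qed.

Lemma submod_span M n (e : 'I_n -> M) : submod (span e).
Proof.
split; first by exists (fun=> 0); rewrite big1 // => i _; rewrite scale0r.
move=> a _ _ [c ->] [d ->]; exists (fun i => a * c i + d i).
rewrite scaler_sumr -big_split; apply: eq_bigr => i _ /=.
by rewrite scalerDl scalerA.
Qed.

Let submod_lastgen M n (e : 'I_n.+1 -> M) (S : M -> Prop) :
  submod S -> submod (lastgen e S).
Proof.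
move=> hS; split.
  exists 0; first by case: (submod_span (fun i : 'I_n => e (widen_ord (leqnSn n) i))).
  by rewrite scale0r addr0; case: hS.
move=> a c d [y hy Sc] [z hz Sd]; exists (a *: y + z).
  by case: (submod_span (fun i : 'I_n => e (widen_ord (leqnSn n) i))) => _; apply.
rewrite scalerDl -scalerA addrACA -scalerDr.
by case: hS => _; apply.
Qed.

Lemma submodI M (S T : M -> Prop) : submod S -> submod T ->
  submod (fun x => S x /\ T x).
Proof.
move=> [s0 s] [t0 t]; split=> // a x y [sx tx] [sy ty].
by split; [apply: s | apply: t].
Qed.

Let spanS M n (e : 'I_n.+1 -> M) x : span e x ->
  exists y c, span (fun i : 'I_n => e (widen_ord (leqnSn n) i)) y /\
    x = y + c *: e ord_max.
Proof.
move=> [c ->]; rewrite big_ord_recr /=; eexists; exists (c ord_max); split=> //.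
by exists (fun i => c (widen_ord (leqnSn n) i)).
Qed.

Lemma noetherian_fin_gen M : noetherian_ring -> fin_gen M -> noetherian M.
Proof.
move=> hR [n [e he]] S hS.
have {he} : forall x, S x -> span e x by move=> x _; exact: he.
elim: n e S hS => [|n IH] e S hS Se; first by exists 0%N, e; split=> [[]|].
set e' := fun i : 'I_n => e (widen_ord (leqnSn n) i).
have [r [c [cI hc]]] := hR _ (submod_lastgen e hS).
have [y hy] := choice (fun j => let: ex_intro2 y a b := cI j in
  ex_intro (fun y => span e' y /\ S (y + (c j : R) *: e ord_max)) y (conj a b)).
apply: (@fin_gen_submod_ext M S (fun x => S x /\ span e' x) r
  (fun j => y j + (c j : R) *: e ord_max)).
- apply: (IH e') => [|x []//]; apply: submodI => //; exact: submod_span.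
- by move=> x [].
- by move=> j; case: (hy j).
move=> x Sx; have [z [b [hz xE]]] := spanS (Se x Sx).
have [d hd] : span c b by apply: hc; exists z => //; rewrite -xE.
exists d; split.
  by apply: submodB => //; apply: submod_sum => // j _; apply: submodZ => //; case: (hy j).
have -> : x - \sum_i d i *: (y i + (c i : R) *: e ord_max) = z - \sum_i d i *: y i.
  rewrite xE hd scaler_suml.
  under [X in _ - X = _]eq_bigr => i _ do rewrite scalerDr.
  rewrite big_split opprD addrACA -[RHS]addr0; congr (_ + _).
  by apply/eqP; rewrite subr_eq0; apply/eqP/eq_bigr => i _; rewrite scalerA.
apply: submodB => //; first exact: submod_span.
apply: submod_sum => [|j _]; first exact: submod_span.
by apply: submodZ; [exact: submod_span | case: (hy j)].
Qed.

Lemma dcc_fin_gen M : dcc R^o -> fin_gen M -> dcc M.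
Proof.
move=> hR [n [e he]] u hu du.
have {he} : forall m x, u m x -> span e x by move=> m x _; exact: he.
elim: n e u hu du => [|n IH] e u hu du ue.
  exists 0%N => m _ x /ue [c ->]; rewrite big_ord0; by case: (hu m).
set e' := fun i : 'I_n => e (widen_ord (leqnSn n) i).
have mono m m' : (m <= m')%N -> forall x, u m' x -> u m x.
  move=> /subnK <-; elim: (m' - m)%N => [//|d IHd] x; rewrite addSn => /du; exact: IHd.
have [|||n1 h1] := IH e' (fun m x => u m x /\ span e' x).
- by move=> m; apply: submodI => //; exact: submod_span.
- by move=> m x [/du h]; split.
- by move=> m x [].
have [||n2 h2] := hR (fun m => lastgen e (u m)).
- by move=> m; apply: submod_lastgen.
- by move=> m c [y hy /du h]; exists y.
exists (maxn n1 n2) => m; rewrite geq_max => /andP [m1 m2] x ux.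
have [z [b [hz xE]]] := spanS (ue _ _ ux).
have [|y hy uy] := h2 m m2 b.
  by exists z => //; rewrite -xE; apply: (mono _ _ (leq_maxr n1 n2)).
have [|ud _] := h1 m m1 (x - (y + b *: e ord_max)).
  split.
    apply: (mono _ _ (leq_maxl n1 n2)); apply: submodB => //.
    have hm : (maxn n1 n2 <= m)%N by rewrite geq_max m1.
    exact: mono hm _ uy.
  rewrite xE opprD addrACA subrr addr0; apply: submodB => //; exact: submod_span.
by rewrite -(subrK (y + b *: e ord_max) x); apply: submodD.
Qed.

Lemma chain_fin M (F : (M -> Prop) -> Prop) n (e : 'I_n -> M) :
  (exists S, F S) ->
  (forall S T, F S -> F T -> (forall x, S x -> T x) \/ (forall x, T x -> S x)) ->
  (forall i, exists2 S, F S & S (e i)) -> exists2 S, F S & forall i, S (e i).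
Proof.
move=> [S1 F1] tot; elim: n e => [|n IH] e he; first by exists S1 => // - [].
have [S2 F2 h2] := IH (fun i => e (lift ord0 i)) (fun i => he _).
have [S3 F3 h3] := he ord0.
have [h|h] := tot _ _ F2 F3; [exists S3 | exists S2] => // i;
  case: (unliftP ord0 i) => [j ->|->] //; exact: h.
Qed.

Lemma noetherian_max M (P : (M -> Prop) -> Prop) (S0 : M -> Prop) :
  noetherian M -> submod S0 -> P S0 ->
  exists S, [/\ submod S, P S, forall x, S0 x -> S x
    & forall T, submod T -> P T -> (forall x, S x -> T x) -> forall x, T x -> S x].
Proof.
move=> hM hS0 PS0; apply: zorn_submod => // F F0 FS tot hU.
have [n [e [eU he]]] := hM _ hU.
have [S FSS Se] := chain_fin F0 tot eU.
have [hS PS _] := FS _ FSS.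
suff -> : (fun x => exists2 S, F S & S x) = S by [].
apply/funext => x; apply/propext; split=> [/he [c ->]|Sx]; last by exists S.
by apply: submod_sum => // i _; apply: submodZ.
Qed.

Lemma linear_eq_gen M N n (e : 'I_n -> M) (f g : {linear M -> N}) :
  (forall x, span e x) -> (forall i, f (e i) = g (e i)) -> forall x, f x = g x.
Proof.
move=> he h x; have [c ->] := he x; rewrite !linear_sum.
by apply: eq_bigr => i _; rewrite !linearZ h.
Qed.

Lemma fin_gen_finType M (I : finType) (e : I -> M) :
  (forall x, exists c : I -> R, x = \sum_i c i *: e i) -> fin_gen M.
Proof.
move=> h; exists #|I|, (fun j => e (enum_val j)) => x; have [c ->] := h x.
exists (fun j => c (enum_val j)).
by rewrite (reindex (fun j : 'I_#|I| => enum_val j)) //=; apply/onW_bij/enum_val_bij.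
Qed.

End Chains.

Section ArtinianCommutative.
Variable k : comPzRingType.
Hypothesis hk : artinian k^o.

Lemma artinian_dcc : dcc k^o.
Proof.
move=> u hu du; have [||n hn] := hk (S := fun n => [pred x | `[< u n x >]]).
- move=> n; case: (hu n) => h0 h; split; first exact/asboolP.
  by move=> a x y /asboolP hx /asboolP hy; apply/asboolP/h.
- by move=> n x /asboolP /du h; apply/asboolP.
exists n => m /hn h x ux; have := h x; rewrite !inE => e.
by apply/asboolP; rewrite e; apply/asboolP.
Qed.

(* If b is minimal among the ideals that are not finitely generated, then
   every scalar either kills b or acts invertibly on it, so that b behaves
   like a vector space whose hyperplanes are finitely generated. *)
Lemma artinian_noetherian : noetherian_ring k.
Proof.
apply: contrapT => /existsNP [S0 /not_implyP [hS0 nS0]].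
have [b [hb nb bmin]] :=
  dcc_min (P := fun S => ~ fin_gen_submod S) artinian_dcc hS0 nS0.
have small (T : k^o -> Prop) : submod T -> (forall x, T x -> b x) ->
    ~ (forall x, b x -> T x) -> fin_gen_submod T.
  by move=> hT Tb nbT; apply: contrapT => nT; apply: nbT; apply: bmin.
have b0 : exists2 x, b x & x <> 0.
  apply: contrapT => no; apply: nb; exists 0%N, (fun=> 0); split=> [[]//|x bx].
  exists (fun=> 0); rewrite big_ord0; apply: contrapT => nx; apply: no.
  by exists x.
(* b is an extension of x b by the kernel of x on b. If both were proper subideals, both would be
   finitely generated, and b with them. *)
have dich (x : k) : (forall y : k^o, b y -> x * y = 0) \/
    (forall y : k^o, b y -> exists2 z : k^o, b z & x * z = y).
  have [?|nx] := pselect (forall y : k^o, b y -> x * y = 0); [by left | right].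
  have hA : submod (fun y : k^o => b y /\ x * y = 0).
    apply: submodI => //; split=> [|a y z hy hz]; first exact: mulr0.
    by rewrite mulrDr mulrCA hy hz mulr0 addr0.
  have [n [e [eI he]]] : fin_gen_submod (fun y : k^o => b y /\ x * y = 0).
    by apply: small => // [y []//|h]; apply: nx => y /h [].
  apply: contrapT => ny; apply: nb.
  have hI : submod (fun y : k^o => exists2 z : k^o, b z & x * z = y).
    split; first by exists 0; [case: hb | exact: mulr0].
    move=> a _ _ [z bz <-] [w bw <-]; exists (a *: z + w); first by case: hb => _; apply.
    by rewrite mulrDr mulrCA.
  have [m [c [cI hc]]] : fin_gen_submod (fun y : k^o => exists2 z : k^o, b z & x * z = y).
    apply: small => //; move=> _ [z bz <-]; exact: (submodZ x hb bz).
  have [z hz] := choice (fun j => let: ex_intro2 y p q := cI j in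
    ex_intro (fun y => b y /\ x * y = c j) y (conj p q)).
  apply: (@fin_gen_submod_ext k k^o b (fun y => b y /\ x * y = 0) m z).
  - by exists n, e.
  - by move=> y [].
  - by move=> j; case: (hz j).
  move=> y By; have [|d hd] := hc (x * y); first by exists y.
  exists d; split.
    apply: submodB => //; apply: submod_sum => // j _; apply: submodZ => //.
    by case: (hz j).
  rewrite mulrBr hd mulr_sumr; apply/eqP; rewrite subr_eq0; apply/eqP/eq_bigr => j _.
  by have [_ <-] := hz j; rewrite [RHS]mulrCA.
(* The chain of ideals (x^n) stops, so x^n = y x^(n+1) for some y; as b = x^n b, multiplication by y
   inverts x on b. *)
have inv (x : k) : ~ (forall y : k^o, b y -> x * y = 0) ->
    exists y : k, forall z : k^o, b z -> y * (x * z) = z.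
  move=> nx; have surx : forall y : k^o, b y -> exists2 z : k^o, b z & x * z = y.
    by have [|] := dich x.
  have surn n (y : k^o) : b y -> exists2 z : k^o, b z & x ^+ n * z = y.
    elim: n y => [|n IH] y by_; first by exists y => //; rewrite expr0 mul1r.
    have [z bz <-] := surx y by_; have [w bw <-] := IH z bz.
    by exists w => //; rewrite exprS mulrA.
  have [||n hn] := artinian_dcc (u := fun n (y : k^o) => exists z, y = z * x ^+ n).
  - move=> n; split; first by exists 0; rewrite mul0r.
    by move=> a _ _ [y ->] [z ->]; exists (a * y + z); rewrite mulrDl -mulrA.
  - by move=> n _ [z ->]; exists (z * x); rewrite exprS mulrA.
  have [|y hy] := hn n.+1 (leqnSn n) (x ^+ n); first by exists 1; rewrite mul1r.
  exists y => z /(surn n) [w bw <-].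
  by rewrite [in RHS]hy exprS !mulrA.
have [x0 bx0 x0n0] := b0.
(* U plays the role of a hyperplane: it is maximal among the subideals of b avoiding x0. For v in b
   outside U, x0 = u + c v with c invertible on b, so U and x0 generate b. *)
have [|||U [hU [Ub nU] _ Umax]] := @zorn_submod k k^o
   (fun S => (forall x, S x -> b x) /\ ~ S x0) (fun x => x = 0).
- exact: submod0.
- by split=> // x ->; case: hb.
- move=> F _ FS _ _; split; first by move=> x [S /FS [_ [h _] _]] /h.
  by move=> [S /FS [_ [_ h] _]] /h.
apply: nb; apply: (@fin_gen_submod_ext k k^o b U 1 (fun=> x0)) => //.
  by apply: small => // h; apply: nU; apply: h.
move=> v bv; apply: contrapT => nv.
pose T (x : k^o) := exists2 u, U u & exists c : k, x = u + c *: (v : k^o).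
have Tx0 : T x0.
  apply: contrapT => nT; apply: nv; exists (fun=> 0).
  rewrite big_ord1 scale0r subr0; apply: (Umax T).
  - exact: submod_adjoin.
  - split=> // _ [u Uu [c ->]]; apply: submodD => //; first exact: Ub.
    exact: (submodZ c hb bv).
  - by move=> u Uu; exists u => //; exists 0; rewrite scale0r addr0.
  - by exists 0; [case: hU | exists 1; rewrite scale1r add0r].
have [u Uu [c x0E]] := Tx0.
have [|y hy] := inv c.
  by move=> /(_ v bv) cv; apply: nU; rewrite x0E -[c *: _]/(c * v) cv addr0.
apply: nv; exists (fun=> y); rewrite big_ord1.
have -> : v - (y : k) *: (x0 : k^o) = - ((y : k) *: u).
  have -> : (y : k) *: (x0 : k^o) = y *: u + v by rewrite x0E scalerDr -[in RHS](hy v bv).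
  by rewrite opprD addrCA subrr addr0.
by apply: submodN => //; apply: submodZ.
Qed.

End ArtinianCommutative.

(** * Modules over an Artin algebra *)

Section Restriction.
Variables (k : comPzRingType) (R : pzRingType) (iota : {rmorphism k -> R}).
Variable M : lmodType R.
Definition restriction (_ : {rmorphism k -> R}) : Type := M.
HB.instance Definition _ := GRing.Zmodule.on (restriction iota).
Definition restriction_scale (a : k) (x : restriction iota) : restriction iota :=
  iota a *: (x : M).
Lemma restriction_scaleA a b x :
  restriction_scale a (restriction_scale b x) = restriction_scale (a * b) x.
Proof. by rewrite /restriction_scale scalerA rmorphM. Qed.
Lemma restriction_scale1 : left_id 1 restriction_scale.
Proof. by move=> x; rewrite /restriction_scale rmorph1 scale1r. Qed.
Lemma restriction_scaleDr : right_distributive restriction_scale +%R.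
Proof. by move=> a x y; exact: scalerDr. Qed.
Lemma restriction_scaleDl x : {morph restriction_scale^~ x : a b / a + b}.
Proof. by move=> a b; rewrite /restriction_scale rmorphD scalerDl. Qed.
HB.instance Definition _ := GRing.Zmodule_isLmodule.Build k (restriction iota)
  restriction_scaleA restriction_scale1 restriction_scaleDr restriction_scaleDl.
End Restriction.

Section ArtinAlgebra.
Variables (k : comPzRingType) (R : pzRingType) (iota : {rmorphism k -> R}).
Hypothesis hk : artinian k^o.
Hypothesis central : forall a r, iota a * r = r * iota a.
Hypothesis finite : exists (n : nat) (e : 'I_n -> R),
  forall r, exists c : 'I_n -> k, r = \sum_i iota (c i) * e i.
Implicit Types A B C D E F I K L M N P Q X Y Z : lmodType R.

Local Notation res M := (restriction M iota : lmodType k).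

Lemma fin_gen_restriction M : fin_gen M -> fin_gen (res M).
Proof.
move=> [m [e he]]; have [n [f hf]] := finite.
apply: (@fin_gen_finType k (res M) ('I_m * 'I_n)%type (fun ij => f ij.2 *: e ij.1)) => x.
have [c ->] := he x; have [d hd] := choice (fun i => hf (c i)).
exists (fun ij => d ij.1 ij.2).
rewrite -(pair_bigA _ (fun i j => (d i j : k) *: (f j *: e i : res M))) /=.
apply: eq_bigr => i _; rewrite [in LHS]hd scaler_suml.
by apply: eq_bigr => j _; rewrite -scalerA.
Qed.

Lemma submod_restriction M (S : M -> Prop) : submod S -> submod (S : res M -> Prop).
Proof. by move=> [s0 s]; split=> // a x y; exact: s. Qed.

Lemma fin_gen_submod_restriction M (S : M -> Prop) : submod S ->
  fin_gen_submod (S : res M -> Prop) -> fin_gen_submod S.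
Proof.
move=> hS [n [e [eS he]]]; exists n, e; split=> // x /he [c ->].
by exists (fun i => iota (c i)).
Qed.

Lemma fin_gen_noetherian M : fin_gen M -> noetherian M.
Proof.
move=> hM S hS; apply: fin_gen_submod_restriction => //.
apply: noetherian_fin_gen; first exact: artinian_noetherian.
  exact: fin_gen_restriction.
exact: submod_restriction.
Qed.

Lemma fin_gen_dcc M : fin_gen M -> dcc M.
Proof.
move=> hM u hu du.
apply: (dcc_fin_gen (artinian_dcc hk) (fin_gen_restriction hM)) => // n.
exact: submod_restriction.
Qed.

Lemma fin_gen_sub K M (i : {linear K -> M}) : injective i -> fin_gen M -> fin_gen K.
Proof. by move=> ii fM; exact: noetherian_sub ii (fin_gen_noetherian fM). Qed.

Lemma fin_gen_ffun n M : fin_gen M -> fin_gen ({ffun 'I_n -> res M} : lmodType k).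
Proof.
move=> hM; have [m [e he]] := fin_gen_restriction hM.
apply: (@fin_gen_finType k _ ('I_n * 'I_m)%type
  (fun ij => [ffun i => if i == ij.1 then e ij.2 else 0])) => f.
have [c hc] := choice (fun i => he (f i)).
exists (fun ij => c ij.1 ij.2); apply/ffunP => i.
rewrite sum_ffunE (eq_bigr (fun ij => c ij.1 ij.2 *: (if i == ij.1 then e ij.2 else 0))); last first.
  by move=> ij _; rewrite !ffunE.
rewrite -(pair_bigA _ (fun i' j => c i' j *: (if i == i' then e j else 0))) /=.
rewrite (bigD1 i) //= [X in _ = _ + X]big1 ?addr0 => [|i' ii'].
  by rewrite [LHS]hc; apply: eq_bigr => j _; rewrite eqxx.
by rewrite big1 // => j _; rewrite eq_sym (negPf ii') scaler0.
Qed.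

Lemma combination_exists A B n (h : 'I_n -> {linear A -> B}) (c : 'I_n -> k) :
  exists f : {linear A -> B}, forall x, f x = \sum_i iota (c i) *: h i x.
Proof.
apply: linear_of_fun => a x y; rewrite scaler_sumr -big_split.
apply: eq_bigr => i _ /=.
by rewrite linearP scalerDr !scalerA central.
Qed.

(** Evaluation at m generators of A embeds Hom(A, B) into B^m, a finitely generated module over the
    noetherian ring k. *)
Lemma fin_gen_hom A B : fin_gen A -> fin_gen B ->
  exists n (h : 'I_n -> {linear A -> B}), forall f : {linear A -> B},
    exists c : 'I_n -> k, forall x, f x = \sum_i iota (c i) *: h i x.
Proof.
move=> [m [e he]] hB.
pose S (g : {ffun 'I_m -> res B}) := exists f : {linear A -> B}, forall i, g i = f (e i).
have hS : submod (S : ({ffun 'I_m -> res B} : lmodType k) -> Prop).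
  split; first by exists \0 => i; rewrite ffunE.
  move=> a g g' [f hf] [f' hf'].
  have [h hh] : exists h : {linear A -> B}, forall x, h x = iota a *: f x + f' x.
    apply: linear_of_fun => b x y; rewrite !linearP !scalerDr !scalerA central.
    by rewrite addrACA.
  by exists h => i; rewrite !ffunE hf hf' hh.
have [n [g [gS hg]]] :=
  noetherian_fin_gen (artinian_noetherian hk) (fin_gen_ffun m hB) hS.
have [h hh] := choice gS; exists n, h => f.
have [|c hc] := hg [ffun i => f (e i)]; first by exists f => i; rewrite ffunE.
exists c; have [f' hf'] := combination_exists h c => x.
rewrite -hf'; apply: (linear_eq_gen he) => i; rewrite hf'.
have := congr1 (fun g : {ffun 'I_m -> res B} => g i) hc.
rewrite ffunE sum_ffunE => ->; apply: eq_bigr => j _.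
by rewrite ffunE hh.
Qed.

Definition essential N E (i : {linear N -> E}) : Prop :=
  forall S : E -> Prop, submod S -> (exists2 x, S x & x <> 0) ->
    exists2 n, S (i n) & i n <> 0.

(* Every left ideal U has the property that E is finitely generated over k
   modulo the elements killed by U; for U = R this is the claim.  In a minimal
   counterexample U with maximal submodule V, an element y killed by V has U y
   simple or zero, hence contained in N, and these y are controlled by the
   finitely generated k-module N^m, m being the number of generators of U. *)
Lemma essential_fin_gen N E (i : {linear N -> E}) :
  injective i -> essential i -> fin_gen N -> fin_gen E.
Proof.
move=> ii hi hN.
pose good (U : R^o -> Prop) := exists (I : finType) (x : I -> E), forall y,
  exists c : I -> k, forall u : R, U u -> u *: (y - \sum_j iota (c j) *: x j) = 0.
have fR := fin_gen_regular R.
suff [I [x hx]] : good (fun=> True).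
  apply: (@fin_gen_finType R E I x) => y; have [c hc] := hx y.
  exists (fun j => iota (c j)); apply/eqP; rewrite -subr_eq0 -[X in X == 0]scale1r.
  exact/eqP/hc.
apply: contrapT => bad.
have [U [hU bU Umin]] := dcc_min (P := fun U => ~ good U) (fin_gen_dcc fR)
  (conj I (fun _ _ _ _ _ => I) : submod (fun _ : R^o => True)) bad.
apply: bU.
have [U0|/existsNP [u0 /not_implyP [Uu0 u00]]] := pselect (forall u, U u -> u = 0).
  exists 'I_0, (fun=> 0) => y; exists (fun=> 0) => u /U0 ->.
  by rewrite scale0r.
have [V [hV [VU pV] _ Vmax]] := noetherian_max
  (P := fun V => (forall v, V v -> U v) /\ exists2 u, U u & ~ V u)
  (fin_gen_noetherian fR) (submod0 (R^o : lmodType R))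
  (conj (fun v (e : v = 0) => eq_ind_r U hU.1 e) (ex_intro2 _ _ u0 Uu0 u00)).
have [I [x hx]] : good V.
  apply: contrapT => bV; have [u Uu] := pV; apply.
  by apply: Umin => // v /VU.
have simple y : (forall v : R, V v -> v *: y = 0) ->
    forall u : R, U u -> exists n, u *: y = i n.
  move=> Vy u Uu; have [u1y|/existsNP [u1 /not_implyP [Uu1 u1y]]] :=
      pselect (forall u : R, U u -> u *: y = 0).
    by exists 0; rewrite linear0 u1y.
  (* Essentiality yields a nonzero r y in N. As V kills y, r lies outside V, so U = V + R r by
     maximality, and U y = R r y is contained in N. *)
  have [||n [r Ur ry] n0] := hi (fun z => exists2 u : R, U u & u *: y = z).
  - split; first by exists 0; [case: hU | rewrite scale0r].
    move=> a _ _ [v Uv <-] [w Uw <-]; exists (a * v + w).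
      by case: hU => _ h; exact: h.
    by rewrite scalerDl scalerA.
  - by exists (u1 *: y) => //; exists u1.
  pose W (v : R^o) := exists2 w, V w & exists s : R, v = w + s *: (r : R^o).
  have hW : submod W by exact: submod_adjoin.
  have WU v : W v -> U v.
    move=> [w Vw [s ->]]; apply: submodD => //; first exact: VU.
    exact: (submodZ (M := R^o) s hU Ur).
  have Wr : W r by exists 0; [case: hV | exists 1; rewrite scale1r add0r].
  have nVr : ~ V r by move=> /Vy h; apply: n0; rewrite -ry.
  have UW v : U v -> W v.
    move=> Uv; apply: contrapT => nWv; apply: nVr; apply: (Vmax W) => //.
      by split=> //; exists v.
    by move=> w Vw; exists w => //; exists 0; rewrite scale0r addr0.
  have [w Vw [s ->]] := UW u Uu; exists (s *: n).
  by rewrite scalerDl (Vy w Vw) add0r -[s *: (r : R^o)]/(s * r) -scalerA ry linearZ.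
have [m [g [gU hg]]] := fin_gen_noetherian fR hU.
pose S (f : {ffun 'I_m -> res N}) := exists2 y,
  (forall v : R, V v -> v *: y = 0) & forall a, (g a : R) *: y = i (f a).
have hS : submod (S : ({ffun 'I_m -> res N} : lmodType k) -> Prop).
  split; first by exists 0 => [v _|a]; rewrite scaler0 // ffunE linear0.
  move=> a f f' [y Vy hy] [y' Vy' hy']; exists (iota a *: y + y').
    move=> v Vv; rewrite scalerDr scalerA -central -scalerA Vy // Vy' //.
    by rewrite scaler0 addr0.
  move=> b; rewrite !ffunE scalerDr scalerA -central -scalerA hy hy'.
  by rewrite -linearP.
have [n [f [fS hf]]] :=
  noetherian_fin_gen (artinian_noetherian hk) (fin_gen_ffun m hN) hS.
have [z hz] := choice (fun b => let: ex_intro2 y p q := fS b in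
  ex_intro (fun y => (forall v : R, V v -> v *: y = 0) /\
                     forall a, (g a : R) *: y = i (f b a)) y (conj p q)).
exists (I + 'I_n)%type, (fun j => match j with inl j => x j | inr j => z j end) => y.
have [c hc] := hx y; set y1 := y - _ in hc.
have [h hh] := choice (fun a => simple y1 hc (g a) (gU a)).
have [|d hd] := hf [ffun a => h a].
  by exists y1 => // a; rewrite hh ffunE.
exists (fun j => match j with inl j => c j | inr j => d j end) => u /hg [r ->].
rewrite big_sumType /= opprD addrA -/y1.
suff key a : (g a : R) *: (y1 - \sum_j iota (d j) *: z j) = 0.
  rewrite scaler_suml big1 // => a _; rewrite -[r a *: g a]/(r a * g a).
  by rewrite -scalerA key scaler0.
have := congr1 (fun g : {ffun 'I_m -> res N} => g a) hd.
rewrite ffunE sum_ffunE => ha.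
rewrite scalerBr hh ha linear_sum; apply/eqP; rewrite subr_eq0 scaler_sumr; apply/eqP.
apply: eq_bigr => j _; rewrite ffunE [in LHS]linearZ scalerA -central -scalerA.
by rewrite (hz j).2.
Qed.

End ArtinAlgebra.

(** * Fitting's lemma, minimal approximations and decompositions *)

Section Fitting.
Variable R : pzRingType.
Implicit Types A B C D E F K L M N P Q T X Y Z : lmodType R.

Lemma iter_linear M (f : {linear M -> M}) n :
  exists g : {linear M -> M}, forall x, g x = iter n f x.
Proof.
elim: n => [|n [g hg]]; first by exists idfun.
by exists (f \o g) => x; rewrite /= hg.
Qed.

Lemma noetherian_acc M (u : nat -> M -> Prop) : noetherian M ->
  (forall n, submod (u n)) -> (forall n x, u n x -> u n.+1 x) ->
  exists n, forall m, (n <= m)%N -> forall x, u m x -> u n x.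
Proof.
move=> hM hu du.
have mono m m' : (m <= m')%N -> forall x, u m x -> u m' x.
  move=> /subnK <-; elim: (m' - m)%N => [//|d IHd] x /IHd; rewrite addSn; exact: du.
have [S [_ [n nS] _ Smax]] := noetherian_max (P := fun S => exists n, u n = S) hM
  (hu 0%N) (ex_intro _ 0%N erefl).
exists n => m nm x; rewrite nS; apply: Smax => //; first by exists m.
by move=> y; rewrite -nS; exact: mono.
Qed.

(* e is the projection onto the image of a high power of f along its kernel. *)
Lemma fitting M (f : {linear M -> M}) : noetherian M -> dcc M ->
  exists n (e : {linear M -> M}),
    [/\ forall x, exists y, e x = iter n.+1 f y,
        forall x, iter n.+1 f (x - e x) = 0,
        forall x, e (iter n.+1 f x) = iter n.+1 f x,
        forall x, f (e x) = 0 -> e x = 0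
      & forall x, exists y, e x = f (e y)].
Proof.
move=> nM dM; have [g hg] := choice (iter_linear f).
have [||n1 h1] := @noetherian_acc _ (fun n x => g n x = 0) nM.
- by move=> n; exact: submod_ker.
- by move=> n x; rewrite !hg /= => ->; rewrite linear0.
have [||n2 h2] := dM (fun n x => exists y, g n y = x).
- by move=> n; exact: submod_im.
- by move=> n x [y <-]; exists (f y); rewrite !hg -iterSr.
(* Kernels and images of the powers of f are stable from n on. The positive exponent [n.+1] used
   below also puts the image of e inside the image of f. *)
pose n := maxn n1 n2.
have nn : (n <= n.+1 + n.+1)%N by exact: leq_trans (leqnSn n) (leq_addr _ _).
have kerE m y : (n <= m)%N -> iter m f y = 0 -> iter n f y = 0.
  move=> nm hy; have : g n1 y = 0.
    by apply: (h1 m); [exact: leq_trans (leq_maxl _ _) nm | rewrite hg].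
  by rewrite hg => hy1; rewrite /n -(subnK (leq_maxl n1 n2)) iterD hy1 -hg linear0.
have imE m y : (n <= m)%N -> exists z, iter n f y = iter m f z.
  move=> nm; have [|z hz] := h2 m (leq_trans (leq_maxr _ _) nm) (iter n f y).
    exists (iter (n - n2) f y).
    by rewrite hg -iterD subnKC // leq_maxr.
  by exists z; rewrite -hz hg.
have [e he] : exists e : {linear M -> M}, forall x,
    (exists y, e x = iter n.+1 f y) /\ iter n.+1 f (x - e x) = 0.
  apply: (@linear_of_rel _ _ _ (fun x z => (exists y, z = iter n.+1 f y) /\
     iter n.+1 f (x - z) = 0)).
  - move=> x; have [z hz] := imE _ (f x) nn.
    exists (iter n.+1 f z); split; first by exists z.
    by rewrite -hg linearB !hg iterSr hz iterD subrr.
  - move=> a x y x' y' [[z ->] h] [[z' ->] h']; split.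
      by exists (a *: z + z'); rewrite -!hg linearP.
    rewrite opprD addrACA -scalerBr -[LHS]hg linearP !hg h h'.
    by rewrite scaler0 addr0.
  - move=> y [[z ->]]; rewrite sub0r -!hg linearN => /eqP; rewrite oppr_eq0 => /eqP.
    rewrite !hg -iterD => /(kerE _ _ nn) hz; by rewrite iterS hz linear0.
have heq y : e (iter n.+1 f y) = iter n.+1 f y.
  have [[z hz] h] := he (iter n.+1 f y); apply/esym/eqP; rewrite -subr_eq0; apply/eqP.
  move: h; rewrite hz -!hg -linearB !hg -iterD => /(kerE _ _ nn) h.
  by rewrite iterS h linear0.
exists n, e; split.
- by move=> x; case: (he x).
- by move=> x; case: (he x).
- exact: heq.
- move=> x; have [[z ->] _] := he x; rewrite -iterS => /kerE h.
  by rewrite iterS h ?linear0 // leqW.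
- move=> x; have [[z ->] _] := he x.
  have [w hw] := imE _ (f z) nn.
  exists (iter n.+1 f (iter n f w)); rewrite heq iterSr hw.
  by rewrite -!iterD -iterS addnS.
Qed.

Lemma idempotent_split M (e : {linear M -> M}) : (forall x, e (e x) = e x) ->
  exists K (i : {linear K -> M}) (r : {linear M -> K}),
    (forall x, r (i x) = x) /\ forall x, i (r x) = e x.
Proof.
move=> ee; have [K [i [ii hi]]] := sub_exists (submod_im e).
have [r hr] : exists r : {linear M -> K}, forall x, i (r x) = e x.
  by apply: linear_lift_inj => // x; apply/hi; exists x.
exists K, i, r; split=> // x; apply: ii; rewrite hr.
by have /hi [y <-] : exists y, i y = i x by exists x.
Qed.

(** Take an idempotent with property Q and minimal image. The Fitting idempotent of e f e has
    property Q and image inside that of e, so e f e is bijective on this image. Q will be the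
    equation p f = p or f p = p of an approximation, which treats both sides at once. *)
Lemma minimal_idempotent M (Q : (M -> M) -> Prop) : noetherian M -> dcc M ->
  Q id -> (forall a b, Q a -> Q b -> Q (a \o b)) ->
  (forall (f e : {linear M -> M}) n, Q f ->
     (forall x, exists y, e x = iter n.+1 f y) ->
     (forall x, iter n.+1 f (x - e x) = 0) ->
     (forall x, e (iter n.+1 f x) = iter n.+1 f x) -> Q e) ->
  exists e : {linear M -> M}, [/\ Q e, forall x, e (e x) = e x &
    forall f : {linear M -> M}, Q f ->
      (forall x, e (f (e x)) = 0 -> e x = 0) /\
      (forall x, exists y, e x = e (f (e y)))].
Proof.
move=> nM dM Qid Qc Qf.
pose P (S : M -> Prop) := exists e : {linear M -> M},
  [/\ Q e, forall x, e (e x) = e x & S = fun x => exists y, e y = x].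
have P0 : P (fun x => exists y, (idfun : {linear M -> M}) y = x) by exists idfun.
have [S [_ [e [Qe ee ->]] Smin]] := dcc_min dM (submod_im _) P0.
exists e; split=> // f Qf'.
have Qg : Q (e \o f \o e : {linear M -> M}) by apply: (Qc) => //; apply: (Qc).
have [n [e' [h1 h2 h3 h4 h5]]] := fitting (e \o f \o e : {linear M -> M}) nM dM.
have sub x : (exists y, e y = x) -> exists y, e' y = x.
  apply: (Smin (fun x => exists y, e' y = x)); first exact: submod_im.
    exists e'; split=> //; first exact: (Qf _ _ _ Qg h1 h2).
    by move=> y; have [z ->] := h1 y.
  by move=> _ [y <-]; have [z ->] := h1 y; rewrite iterS /=; eexists.
split=> x.
  move=> h; have [y hy] := sub (e x) (ex_intro _ x erefl).
  by rewrite -hy; apply: h4; rewrite hy /= ee.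
have [y <-] := sub (e x) (ex_intro _ x erefl).
by have [z ->] := h5 y; exists (e' z).
Qed.

(** * Minimal approximations *)

Definition right_approx (S : lmodType R -> Prop) A X (p : {linear X -> A}) : Prop :=
  S X /\ forall Y (f : {linear Y -> A}), S Y ->
    exists h : {linear Y -> X}, forall x, p (h x) = f x.

Definition left_approx (S : lmodType R -> Prop) A X (f : {linear A -> X}) : Prop :=
  S X /\ forall Y (g : {linear A -> Y}), S Y ->
    exists h : {linear X -> Y}, forall x, h (f x) = g x.

Lemma minimal_right_approx S A X (p : {linear X -> A}) :
  (forall X Y, retract X Y -> S Y -> S X) -> noetherian X -> dcc X ->
  right_approx S p -> exists X' (p' : {linear X' -> A}), right_approx S p' /\
    forall f : {linear X' -> X'}, (forall x, p' (f x) = p' x) ->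
      injective f /\ surj f.
Proof.
move=> Sr nX dX [SX hp].
have [|||e [Qe ee me]] :=
  @minimal_idempotent X (fun g => forall x, p (g x) = p x) nX dX.
- by [].
- by move=> a b ha hb x; rewrite /= ha hb.
- move=> f e n Qf h1 h2 h3 x.
  have pf m y : p (iter m f y) = p y by elim: m => //= m <-; rewrite Qf.
  apply/esym/eqP; rewrite -subr_eq0 -linearB -(pf n.+1); apply/eqP.
  by rewrite h2 linear0.
have [K [i [r [ri ir]]]] := idempotent_split ee.
exists K, (p \o i); split.
  split; first by apply: (Sr _ X) => //; exists i, r.
  move=> Y f SY; have [h hh] := hp Y f SY; exists (r \o h) => x.
  by rewrite /= ir Qe hh.
move=> f hf; have [|m1 m2] := me (i \o f \o r : {linear X -> X}).
  by move=> x; rewrite /= -[LHS]/((p \o i) (f (r x))) hf /= ir Qe.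
have ei x : e (i x) = i x by rewrite -ir ri.
have rE x : r (e x) = r x by rewrite -ir ri.
split.
  apply: linear_inj => x fx; rewrite -[LHS]ri -ei m1 ?linear0 //.
  by rewrite /= rE ri fx !linear0.
move=> x; have [y hy] := m2 (i x); exists (r y).
by move: hy; rewrite /= ei rE ei => /(congr1 r); rewrite !ri.
Qed.

Lemma minimal_left_approx S A X (p : {linear A -> X}) :
  (forall X Y, retract X Y -> S Y -> S X) -> noetherian X -> dcc X ->
  left_approx S p -> exists X' (p' : {linear A -> X'}), left_approx S p' /\
    forall f : {linear X' -> X'}, (forall x, f (p' x) = p' x) ->
      injective f /\ surj f.
Proof.
move=> Sr nX dX [SX hp].
have [|||e [Qe ee me]] :=
  @minimal_idempotent X (fun g => forall x, g (p x) = p x) nX dX.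
- by [].
- by move=> a b ha hb x; rewrite /= hb ha.
- move=> f e n Qf h1 h2 h3 x.
  have pf m : iter m f (p x) = p x by elim: m => //= m ->.
  by rewrite -[in LHS](pf n.+1) h3 pf.
have [K [i [r [ri ir]]]] := idempotent_split ee.
have ei x : e (i x) = i x by rewrite -ir ri.
have rE x : r (e x) = r x by rewrite -ir ri.
have irp x : i (r (p x)) = p x by rewrite ir Qe.
exists K, (r \o p); split.
  split; first by apply: (Sr _ X) => //; exists i, r.
  move=> Y f SY; have [h hh] := hp Y f SY; exists (h \o i) => x.
  by rewrite /= irp hh.
move=> f hf; have [|m1 m2] := me (i \o f \o r : {linear X -> X}).
  by move=> x; rewrite /= -[f _]/(f ((r \o p) x)) hf /= irp.
split.
  apply: linear_inj => x fx; rewrite -[LHS]ri -ei m1 ?linear0 //.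
  by rewrite /= rE ri fx !linear0.
move=> x; have [y hy] := m2 (i x); exists (r y).
by move: hy; rewrite /= ei rE ei => /(congr1 r); rewrite !ri.
Qed.

(** * Indecomposable modules and decompositions *)

Lemma isom_of_inj_surj A B (f : {linear A -> B}) : injective f -> surj f -> isom A B.
Proof. by move=> inj sur; have [g [h1 h2]] := linear_inverse inj sur; exists f, g. Qed.

Lemma isom_inverse A B : isom A B -> exists (f : {linear A -> B}) (g : {linear B -> A}),
  cancel f g /\ cancel g f.
Proof.
move=> [f [g h1 h2]]; have [|g' [h1' h2']] := linear_inverse (can_inj h1).
  by move=> y; exists (g y).
by exists f, g'.
Qed.

Lemma indecomposable_idempotent M (e : {linear M -> M}) : indecomposable M ->
  (forall x, e (e x) = e x) -> (forall x, e x = 0) \/ (forall x, e x = x).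
Proof.
move=> [_ hM] ee.
have [K [i [r [ri ir]]]] := idempotent_split ee.
have ee' x : (idfun \- e : {linear M -> M}) ((idfun \- e : {linear M -> M}) x) = (idfun \- e) x.
  by rewrite /= linearB ee subrr subr0.
have [K' [i' [r' [ri' ir']]]] := idempotent_split ee'.
have ei x : e (i' x) = 0.
  have := ir' (i' x); rewrite ri' /= => /eqP.
  by rewrite -subr_eq0 opprB addrCA subrr addr0 => /eqP.
have ri0 x : r (i' x) = 0 by rewrite -[LHS]ri ir ei linear0.
have ri0' x : r' (i x) = 0.
  by rewrite -[LHS]ri' ir' /= -ir ri subrr linear0.
have iso : isom M (K * K')%type.
  apply: (isom_of_inj_surj (f := pair_fun r r')).
    apply: linear_inj => x [hx hx']; have := ir' x; rewrite /= -ir hx hx' !linear0.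
    by rewrite addr0 => <-.
  move=> [a b]; exists (i a + i' b); rewrite -[LHS]/(r (i a + i' b), r' (i a + i' b)) !linearD.
  by rewrite ri ri' ri0 ri0' addr0 add0r.
have [z|z] := hM _ _ iso; [left | right] => x.
  by rewrite -ir (z (r x)) linear0.
have := ir' x; rewrite (z (r' x)) linear0 /= => /eqP; rewrite eq_sym subr_eq0 => /eqP.
exact: esym.
Qed.

Lemma retract_indecomposable X E : indecomposable E -> ~ zero_mod X ->
  retract X E -> isom X E.
Proof.
move=> hE nX [u [v vu]].
have [h|h] := @indecomposable_idempotent _ (u \o v : {linear E -> E}) hE
    (fun x => congr1 u (vu (v x))).
  by case: nX => x; have := h (u x); rewrite /= vu => ux; rewrite -(vu x) ux linear0.
apply: (isom_of_inj_surj (f := u)); first exact: can_inj vu.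
by move=> y; exists (v y); exact: h.
Qed.

Lemma indecomposable_end M (f : {linear M -> M}) : noetherian M -> dcc M ->
  indecomposable M ->
  (exists n, forall x, iter n f x = 0) \/ (injective f /\ surj f).
Proof.
move=> nM dM hM; have [n [e [h1 h2 h3 h4 h5]]] := fitting f nM dM.
have ee x : e (e x) = e x by have [y ->] := h1 x.
have [h|h] := indecomposable_idempotent hM ee; [left | right].
  by exists n.+1 => x; have := h2 x; rewrite h subr0.
split; first by apply: linear_inj => x; rewrite -{1}(h x) => /h4; rewrite h.
by move=> y; have [x] := h5 y; rewrite !h => ->; exists x.
Qed.

(** Locality of the endomorphism ring. With h inverse to g, either h f_i is bijective or it is
    nilpotent; in the second case 1 - h f_i is injective, hence not nilpotent, hence bijective, and
    so is g - f_i, the sum of the remaining terms. *)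
Lemma indecomposable_local M (I : Type) (s : seq I) (f : I -> {linear M -> M})
    (g : {linear M -> M}) : noetherian M -> dcc M -> indecomposable M ->
  (forall x, g x = \sum_(i <- s) f i x) -> injective g -> surj g ->
  exists i, injective (f i) /\ surj (f i).
Proof.
move=> nM dM hM; elim: s g => [|i s IH] g gE ig sg.
  case: hM => nz _; case: nz => x; apply: ig.
  by rewrite !gE !big_nil.
have [h [gh hg]] := linear_inverse ig sg.
have [[n hn]|[iu su]] := indecomposable_end (h \o f i : {linear M -> M}) nM dM hM; last first.
  exists i; split; first by move=> x y e; apply: iu; rewrite /= e.
  by move=> y; have [x hx] := su (h y); exists x; rewrite -[LHS]hg -[h _]/((h \o f i) x) hx hg.
have [[m hm]|[iu su]] :=
    indecomposable_end (idfun \- (h \o f i) : {linear M -> M}) nM dM hM.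
  case: hM => nz _; case: nz => x.
  have inj y : (idfun \- (h \o f i) : {linear M -> M}) y = 0 -> y = 0.
    move=> /= /eqP; rewrite subr_eq0 => /eqP hy; rewrite -(hn y).
    by elim: n {hn} => //= n <-.
  by elim: m hm => [|m IHm] hm; [exact: hm | apply: IHm => y; apply: inj; exact: hm].
have [g' hg'] : exists g' : {linear M -> M}, forall x, g' x = (g \- f i) x.
  by exists (g \- f i).
apply: (IH g').
- by move=> x; rewrite hg' /= gE big_cons addrC addKr.
- apply: linear_inj => x; rewrite hg' /= => h0; apply: iu; rewrite linear0 /= -[x in x - _]gh.
  by rewrite -linearB h0 linear0.
- move=> y; have [x hx] := su (h y); exists x; rewrite hg' /=.
  by rewrite -[RHS]hg -hx /= linearB hg.
Qed.

(** The existence half of the Krull-Schmidt theorem, encoded by inclusions and projections. *)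
Definition krull_schmidt M : Prop :=
  exists (I : finType) (E : I -> lmodType R) (a : forall i, {linear M -> E i})
    (b : forall i, {linear E i -> M}),
    [/\ forall i, indecomposable (E i), forall i x, a i (b i x) = x
      & forall x, x = \sum_i b i (a i x)].

Lemma krull_schmidt_prod M A B : isom M (A * B)%type ->
  krull_schmidt A -> krull_schmidt B -> krull_schmidt M.
Proof.
move=> /isom_inverse [f [g [fg gf]]] [I [E [a [b [h1 h2 h3]]]]] [J [F [c [d [h1' h2' h3']]]]].
pose T (s : I + J) := match s with inl i => E i | inr j => F j end.
pose p (s : I + J) : {linear M -> T s} := match s return {linear M -> T s} with
  | inl i => a i \o (fst \o f) | inr j => c j \o (snd \o f) end.
pose q (s : I + J) : {linear T s -> M} := match s return {linear T s -> M} with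
  | inl i => g \o (pair_fun idfun \0 \o b i) | inr j => g \o (pair_fun \0 idfun \o d j) end.
exists (I + J)%type, T, p, q; split.
- by case=> i; [exact: h1 | exact: h1'].
- by case=> i x /=; rewrite gf /=; [exact: h2 | exact: h2'].
- move=> x; rewrite big_sumType /=.
  have e1 : \sum_i g (pair_fun idfun \0 (b i (a i (f x).1))) = g (pair_fun idfun \0 (f x).1).
    by rewrite [in RHS](h3 (f x).1) !linear_sum.
  have e2 : \sum_i g (pair_fun \0 idfun (d i (c i (f x).2))) = g (pair_fun \0 idfun (f x).2).
    by rewrite [in RHS](h3' (f x).2) !linear_sum.
  transitivity (g (pair_fun idfun \0 (f x).1) + g (pair_fun \0 idfun (f x).2)).
    rewrite -linearD -[LHS]fg; congr (g _).
    by case: (f x) => y z; rewrite /pair_fun /=; congr pair; rewrite /= ?addr0 ?add0r.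
  by rewrite -e1 -e2.
Qed.

(** A minimal direct summand without a decomposition can be neither zero nor indecomposable, and by
    minimality its two proper summands decompose, a contradiction. *)
Lemma krull_schmidt_exists M : dcc M -> krull_schmidt M.
Proof.
move=> dM; apply: contrapT => nM.
pose P (S : M -> Prop) := exists K (i : {linear K -> M}) (r : {linear M -> K}),
  [/\ forall x, r (i x) = x, forall x, S x <-> exists y, i y = x & ~ krull_schmidt K].
have P0 : P (fun x => True) by exists M, idfun, idfun; split=> // x; split=> // _; exists x.
have [S [_ [K [i [r [ri Si nK]]]] Smin]] :=
  dcc_min dM (conj I (fun _ _ _ _ _ => I) : submod (fun _ : M => True)) P0.
have [zK|nz] := pselect (zero_mod K).
  apply: nK; exists 'I_0, (fun=> K), (fun=> idfun), (fun=> idfun).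
  by split=> [[]//|//|x]; rewrite big_ord0.
have [iK|niK] := pselect (indecomposable K).
  apply: nK; exists 'I_1, (fun=> K), (fun=> idfun), (fun=> idfun).
  by split=> // x; rewrite big_ord1.
apply: niK; split=> // A B iso; apply: contrapT => /not_orP [nA nB]; apply: nK.
have part C (u : {linear C -> K}) (v : {linear K -> C}) :
    (forall x, v (u x) = x) -> (exists2 y, v y = 0 & y <> 0) -> krull_schmidt C.
  move=> vu [y vy ny]; apply: contrapT => nC; apply: ny.
  have [||||z hz] := Smin (fun x => exists z, i (u z) = x) _ _ _ (i y).
  - exact: (submod_im (i \o u)).
  - exists C, (i \o u), (v \o r); split=> // x /=; by rewrite ri vu.
  - by move=> _ [z <-]; apply/Si; exists (u z).
  - by apply/Si; exists y.
  have := congr1 (v \o r) hz; rewrite /= !ri vu vy => z0.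
  by move: hz; rewrite z0 !linear0 => /(congr1 r); rewrite ri linear0.
have [f [g [fg gf]]] := isom_inverse iso.
apply: (krull_schmidt_prod iso).
  apply: (part _ (g \o pair_fun idfun \0) (fst \o f)) => [x|]; first by rewrite /= gf.
  have /existsNP [b nb] := nB; exists (g (0, b)); first by rewrite /= gf.
  by move=> /(congr1 f); rewrite gf linear0 => - [].
apply: (part _ (g \o pair_fun \0 idfun) (snd \o f)) => [x|]; first by rewrite /= gf.
have /existsNP [a na] := nA; exists (g (a, 0)); first by rewrite /= gf.
by move=> /(congr1 f); rewrite gf linear0 => - [].
Qed.

Lemma sum_maps M N (I : finType) (E : I -> lmodType R) (a : forall i, {linear M -> E i})
    (h : forall i, {linear E i -> N}) :
  exists g : {linear M -> N}, forall x, g x = \sum_i h i (a i x).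
Proof.
apply: linear_of_fun => c x y; rewrite scaler_sumr -big_split.
by apply: eq_bigr => i _; rewrite !linearP.
Qed.

Lemma nonprojective_summand M : dcc M -> ~ projective M ->
  exists E, [/\ indecomposable E, retract E M & ~ projective E].
Proof.
move=> /krull_schmidt_exists [I [E [a [b [h1 h2 h3]]]]] nM.
have [[i ni]|no] := pselect (exists i, ~ projective (E i)).
  by exists (E i); split=> //; exists (b i), (a i).
case: nM => A B g f sg.
have pE i : projective (E i) by apply: contrapT => n; apply: no; exists i.
have [l hl] := dchoice (fun i => pE i _ _ g (f \o b i) sg).
have [h hh] := sum_maps a l; exists h => x; rewrite hh [in RHS](h3 x) !linear_sum.
by apply: eq_bigr => i _; exact: hl.
Qed.

End Fitting.

(** * Gorenstein-projective modules *)

Section GorensteinProjective.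
Variable R : pzRingType.
Implicit Types A B C D E F K L M N P Q T X Y Z : lmodType R.

Lemma GProj_ext1 A Q : GProj A -> projective Q -> ext1 A Q.
Proof. by move=> /gp_class_GProj [h _ _]; exact: h. Qed.

Lemma ses_0l P : ses (\0 : {linear ('rV[R]_0 : lmodType R) -> P}) (idfun : {linear P -> P}).
Proof.
split=> [x y _|x|y]; [by apply/rowP => - [] | by exists x |].
by split=> [/= ->|[x <-]] //; exists 0.
Qed.

Lemma ses_0r P : ses (idfun : {linear P -> P}) (\0 : {linear P -> ('rV[R]_0 : lmodType R)}).
Proof.
split=> [x y|x|y] //; first by exists 0; apply/rowP => - [].
by split=> // _; exists y.
Qed.

Lemma projective_GProj P : projective P -> GProj P.
Proof.
apply: (GProj_of_class (S := fun P => projective P)) => {}P hP.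
split; first by move=> Q _; exact: projective_ext1.
  exists ('rV[R]_0 : lmodType R), P, \0, idfun.
  by split=> //; [exact: projective0 | exact: ses_0l].
exists P, ('rV[R]_0 : lmodType R), idfun, \0.
by split=> //; [exact: projective0 | exact: ses_0r].
Qed.

(** Coinduction on all stable retracts of Gorenstein-projective modules: the syzygy and the cosyzygy
    of A are in general only stable retracts of those of X, which is why the class is taken this
    large. *)
Lemma GProj_stable_retract A X : stable_retract A X -> GProj X -> GProj A.
Proof.
move=> s hX; apply: (GProj_of_class (S := fun A => exists2 X, GProj X & stable_retract A X));
  last by exists X.
move=> {A X s hX} A [X hX s].
have [h1 [K [P [i [p [hK hP e]]]]] [P' [X' [j [q [hX' hP' e']]]]]] := gp_class_GProj hX.
split.
- by move=> Q hQ; apply: ext1_stable_retract s _; exact: h1.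
- have [K0 [P0 [i0 [p0 [hP0 e0]]]]] := cover_ses A.
  exists K0, P0, i0, p0; split=> //; exists K => //.
  exact: stable_retract_syzygy s e0 hP0 e hP.
have [Q hQ [u [v vu]]] := stable_retract_retract s; have [ij sq ex'] := e'.
pose c : {linear (X * Q)%type -> (P' * Q)%type} := pair_fun (j \o fst) snd.
have cE x : c x = (j x.1, x.2) by [].
have ec : ses c (q \o fst : {linear (P' * Q)%type -> X'}).
  split.
  - by move=> [x y] [x' y'] [/ij -> ->].
  - by move=> x; have [y <-] := sq x; exists (y, 0).
  - move=> [x y] /=; rewrite ex'; split=> [[z <-]|[[z w] [<- _]]]; last by exists z.
    by exists (z, y).
have hPQ : projective (P' * Q)%type by apply: projective_prod.
have ic : injective (c \o u) by have [ic _ _] := ec; apply: inj_comp ic (can_inj vu).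
have [A' [r ea]] := coker_ses (i := (c \o u : {linear A -> _})) ic.
exists (P' * Q)%type, A', (c \o u), r; split=> //; exists X' => //.
(* The map back is not induced by v alone; it extends from X x Q to P' x Q because X' has no Ext^1
   into projectives. *)
have [g hg] := ext1_extend ((c \o u) \o v) (GProj_ext1 hX' hPQ) ec.
exact: (stable_retract_cosyzygy (f := idfun) ea ec hPQ vu _ hg).
Qed.

(** Injectivity of P1 in the dual horseshoe lemma is replaced by Ext^1(A2, P1) = 0, which is what
    extends [a1] to A. *)
Lemma cohorseshoe A1 A A2 P1 Y1 P2 Y2 (i : {linear A1 -> A}) (p : {linear A -> A2})
    (a1 : {linear A1 -> P1}) (q1 : {linear P1 -> Y1})
    (a2 : {linear A2 -> P2}) (q2 : {linear P2 -> Y2}) :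
  ses i p -> ses a1 q1 -> ses a2 q2 -> ext1 A2 P1 ->
  exists Y (j : {linear A -> (P1 * P2)%type}) (q : {linear (P1 * P2)%type -> Y})
    (k : {linear Y1 -> Y}) (l : {linear Y -> Y2}), ses j q /\ ses k l.
Proof.
move=> e e1 e2 hP; have [ii sp ex] := e; have [ia1 sq1 ex1] := e1.
have [ia2 sq2 ex2] := e2.
have [h hh] := ext1_extend a1 hP e.
pose j : {linear A -> (P1 * P2)%type} := pair_fun h (a2 \o p).
have jE x : j x = (h x, a2 (p x)) by [].
have ij : injective j.
  apply: linear_inj => x [hx]; rewrite -(linear0 a2) => /ia2 /ex [y yx].
  by move: hx; rewrite -yx hh -(linear0 a1) => /ia1 ->; rewrite linear0.
have [Y [q ej]] := coker_ses ij; have [_ sq exj] := ej.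
have [k hk] : exists k : {linear Y1 -> Y}, forall x,
    k (q1 x) = (q \o pair_fun idfun \0 : {linear P1 -> Y}) x.
  apply: factor_surj => // x /ex1 [y <-]; apply/exj; exists (i y).
  by rewrite jE hh (ses0 _ e) linear0.
have [l hl] : exists l : {linear Y -> Y2}, forall x,
    l (q x) = (q2 \o snd : {linear (P1 * P2)%type -> Y2}) x.
  by apply: factor_surj => // x /exj [y <-]; rewrite jE /= (ses0 _ e2).
exists Y, j, q, k, l; split=> //; split.
- apply: linear_inj => y; have [x <-] := sq1 y; rewrite hk => /exj [z].
  rewrite jE => - [<- ]; rewrite -(linear0 a2) => /ia2 /ex [w <-].
  by rewrite hh (ses0 _ e1).
- by move=> y; have [x <-] := sq2 y; exists (q (0, x)); rewrite hl.
- move=> y; have [[y1 y2] <-] := sq y; rewrite hl /=; split=> [/ex2 [z]|[x]].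
    have [w <-] := sp z => hw; exists (q1 (y1 - h w)).
    rewrite hk; apply/eqP; rewrite eq_sym -subr_eq0 -[X in _ - X]/(q (y1 - h w, 0)) -linearB.
    apply/eqP/exj; exists w; rewrite jE hw; congr pair.
      by rewrite /= opprB addrCA subrr addr0.
    by rewrite /= subr0.
  have [z <-] := sq1 x => /(congr1 l); rewrite hk !hl /= => <-.
  by rewrite linear0.
Qed.

Lemma GProj_ext A1 A A2 (i : {linear A1 -> A}) (p : {linear A -> A2}) :
  ses i p -> GProj A1 -> GProj A2 -> GProj A.
Proof.
move=> e h1 h2; apply: (GProj_of_class (S := fun A => exists A1 A2
  (i : {linear A1 -> A}) (p : {linear A -> A2}), [/\ ses i p, GProj A1 & GProj A2]));
  last by exists A1, A2, i, p.
move=> {A1 A A2 i p e h1 h2} A [A1 [A2 [i [p [e h1 h2]]]]].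
have [g1 [K1 [P1 [i1 [p1 [hK1 hP1 e1]]]]] [Q1 [B1 [j1 [q1 [hB1 hQ1 d1]]]]]] :=
  gp_class_GProj h1.
have [g2 [K2 [P2 [i2 [p2 [hK2 hP2 e2]]]]] [Q2 [B2 [j2 [q2 [hB2 hQ2 d2]]]]]] :=
  gp_class_GProj h2.
split.
- by move=> Q hQ; apply: ext1_ext_l e (g1 Q hQ) (g2 Q hQ).
- have [K [j [q [k [l [ej ek]]]]]] := horseshoe e e1 e2 hP2.
  exists K, (P1 * P2)%type, j, q; split=> //; last exact: projective_prod.
  by exists K1, K2, k, l.
have [Y [j [q [k [l [ej ek]]]]]] := cohorseshoe e d1 d2 (g2 _ hQ1).
exists (Q1 * Q2)%type, Y, j, q; split=> //; last exact: projective_prod.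
by exists B1, B2, k, l.
Qed.

Lemma GProj_syzygy A K P (i : {linear K -> P}) (p : {linear P -> A}) :
  projective P -> ses i p -> GProj A -> GProj K.
Proof.
move=> hP e /gp_class_GProj [_ [K0 [P0 [i0 [p0 [hK0 hP0 e0]]]]] _].
exact: GProj_stable_retract (stable_retract_syzygy (stable_retract_refl A) e hP e0 hP0) hK0.
Qed.

Lemma GProj_perp A Q : GProj A -> projective Q -> perp A Q.
Proof.
move=> hA hQ; move: A hA; apply: perp_class => A hA.
split; first exact: GProj_ext1.
have [_ [K [P [i [p [hK hP e]]]]] _] := gp_class_GProj hA.
by exists K, P, i, p.
Qed.

Lemma projective_rV_section A (P : lmodType R) (p : {linear A -> P}) :
  projective P -> surj p -> exists s : {linear P -> A}, forall x, p (s x) = x.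
Proof. by move=> hP sp; exact: (hP _ _ p idfun). Qed.

Lemma Gproj_retract A B : retract A B -> Gproj B -> Gproj A.
Proof.
move=> r [fB gB]; split; first exact: fin_gen_retract r fB.
by apply: GProj_stable_retract gB; exact: retract_stable_retract.
Qed.

Lemma Gproj_prod A B : Gproj A -> Gproj B -> Gproj (A * B)%type.
Proof.
move=> [fA gA] [fB gB]; split; first exact: fin_gen_prod.
exact: GProj_ext (ses_prod A B) gA gB.
Qed.

Lemma Gproj_rV n : Gproj ('rV[R]_n : lmodType R).
Proof. by split; [exact: fin_gen_rV | apply/projective_GProj/projective_rV]. Qed.

Lemma isom_retract A B : isom A B -> retract A B /\ retract B A.
Proof. by move=> /isom_inverse [f [g [fg gf]]]; split; [exists f, g | exists g, f]. Qed.

(* The totally acyclic complex that defines A need not consist of finitely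
   generated modules. *)
Lemma Gproj_cosyzygy A : Gproj A -> exists n B (a : {linear A -> 'rV[R]_n})
  (q : {linear 'rV[R]_n -> B}), ses a q /\ Gproj B.
Proof.
move=> [fA /gp_class_GProj [_ _ [P [A' [m [q [hA' hP e]]]]]]].
have [D [p [sp hD fD]]] := free_cover P.
have [s ps] := projective_rV_section hP sp.
(* The finite free summand of D through which A -> P -> D factors becomes the new middle term; its
   retraction c provides the map back that compares the two cosyzygies. *)
have [n [a [b [c [cb ba]]]]] := fD _ (s \o m) fA.
have ia : injective a.
  apply: linear_inj => x ax; have [im _ _] := e; apply: im.
  by rewrite linear0 -[LHS]ps -[s (m x)]/((s \o m) x) -ba ax !linear0.
have [B [r ea]] := coker_ses ia; exists n, B, a, r; split=> //.
split; first by have [_ sr _] := ea; apply: fin_gen_surj sr (fin_gen_rV _ _).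
apply: GProj_stable_retract hA'.
apply: (stable_retract_cosyzygy (u := idfun) (v := idfun) (f := p \o b) (g := c \o s) ea e) => //.
- exact: projective_rV.
- by move=> x /=; rewrite ba /= ps.
- by move=> x /=; rewrite -[s (m x)]/((s \o m) x) -ba cb.
Qed.

(** The pushout W of the extension along Y -> X is an extension of X' by X, so it lies in S, and the
    extension of p to W vanishing on E factors through p. By minimality the factorisation becomes a
    retraction of W onto X over A, and it carries E into Y. *)
Lemma wakamatsu_right (S : lmodType R -> Prop) A X Y (p : {linear X -> A})
    (i : {linear Y -> X}) :
  (forall A1 A A2 (i : {linear A1 -> A}) (p : {linear A -> A2}),
    ses i p -> S A1 -> S A2 -> S A) ->
  ses i p -> right_approx S p ->
  (forall f : {linear X -> X}, (forall x, p (f x) = p x) -> injective f /\ surj f) ->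
  forall X', S X' -> ext1 X' Y.
Proof.
move=> Sext e [SX hp] pmin X' SX' E j q e'.
have [ii sp ex] := e; have [ij sq ex'] := e'.
have [W [a [b [t [e2 ab _ univ _]]]]] := pushout i e'.
have [pw [pa pb]] : exists pw : {linear W -> A},
    (forall x, pw (a x) = p x) /\ forall x, pw (b x) = (\0 : {linear E -> A}) x.
  by apply: univ => x; rewrite (ses0 _ e).
have [r hr] := hp W pw (Sext _ _ _ _ _ e2 SX SX').
have [|ir sr] := pmin (r \o a); first by move=> x; rewrite /= hr pa.
have [g [g1 g2]] := linear_inverse ir sr.
have pg x : p (g x) = p x by rewrite -[x in RHS]g2 /= hr pa.
have [l hl] : exists l : {linear E -> Y}, forall x, i (l x) = (g \o (r \o b)) x.
  by apply: linear_lift_inj => // x; apply/ex; rewrite /= pg hr pb.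
exists l => x; apply: ii; rewrite hl /= -ab.
by rewrite -[RHS]g1.
Qed.

End GorensteinProjective.

(** * The equivalence of (i), (ii) and (iii), and finite CM-type *)

Section Equivalence.
Variables (k : comPzRingType) (R : pzRingType) (iota : {rmorphism k -> R}).
Hypothesis hk : artinian k^o.
Hypothesis central : forall a r, iota a * r = r * iota a.
Hypothesis finite : exists (n : nat) (e : 'I_n -> R),
  forall r, exists c : 'I_n -> k, r = \sum_i iota (c i) * e i.
Implicit Types A B C D E F K L M N P Q T X Y Z : lmodType R.

Let noeth M : fin_gen M -> noetherian M := @fin_gen_noetherian k R iota hk finite M.
Let artin M : fin_gen M -> dcc M := @fin_gen_dcc k R iota hk finite M.

Lemma fin_presentation A : fin_gen A -> exists n K (i : {linear K -> 'rV[R]_n})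
  (p : {linear 'rV[R]_n -> A}), ses i p /\ fin_gen K.
Proof.
move=> /fin_genP [n [p sp]]; have [K [i e]] := ker_ses sp.
exists n, K, i, p; split=> //.
by have [ii _ _] := e; exact: (fin_gen_sub hk finite) ii (fin_gen_rV R n).
Qed.

(** The syzygy of A is finitely generated, so a map from it to Q factors through a finite free
    module, whose coordinates are extended one at a time. *)
Lemma ext1_free A Q : fin_gen A -> ext1 A R^o -> projective Q -> ext1 A Q.
Proof.
move=> fA eA hQ; have [n [K [i [p [e fK]]]]] := fin_presentation fA.
apply: (ext1_of_extend e) => [|f]; first exact/projective_ext1/projective_rV.
have [D [q [sq hD fD]]] := free_cover Q.
have [s qs] := projective_rV_section hQ sq.
have [m [a [b [c [cb ba]]]]] := fD _ (s \o f) fK.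
have [co hco] := choice (@rV_coord R m).
have [g hg] := choice (fun j => ext1_extend (co j \o a) eA e).
have [G hG] := rV_tuple g.
exists (q \o b \o G) => x /=.
have -> : G (i x) = a x by apply/rowP => j; rewrite hG mxE hg /= hco.
by rewrite ba /= qs.
Qed.

Lemma perp_ringP A : perp_ring A <-> fin_gen A /\ perp A R^o.
Proof. by rewrite /perp_ring perpP. Qed.

(** [Gproj] contains finitely generated syzygies of its members, so vanishing of Ext^1 propagates to
    all degrees. *)
Lemma Gproj_perpP A :
  Gproj_perp A <-> fin_gen A /\ forall X, Gproj X -> ext1 X A.
Proof.
split=> [[fA h]|[fA h]]; split=> //.
  by move=> X hX; exact: ((Ext_zero_vanish 0 X A).1 (h 1%N X isT hX)).
move=> n X n1 hX; suff hp : perp X A by exact: ((perpP X A).2 hp).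
move: X hX => {n n1}; apply: perp_class => X hX; split; first exact: h.
have [m [K [i [p [e fK]]]]] := fin_presentation hX.1.
exists K, ('rV[R]_m), i, p; split=> //; first exact: projective_rV.
by split=> //; apply: GProj_syzygy e hX.2; exact: projective_rV.
Qed.

Lemma projective_regular : projective (R^o : lmodType R).
Proof.
move=> A B g f sg; have [x hx] := sg (f 1).
have [h hh] : exists h : {linear R^o -> A}, forall r : R, h r = r *: x.
  by apply: linear_of_fun => a r s; rewrite scalerDl scalerA.
exists h => r; rewrite hh linearZ hx -linearZ; congr (f _); exact: mulr1.
Qed.

Lemma Gproj_perp_ring A : Gproj A -> perp_ring A.
Proof.
move=> [fA gA]; apply/perp_ringP; split=> //.
exact: GProj_perp gA projective_regular.
Qed.

Let core A := perp_ring A /\ Gproj_perp A.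

Lemma proj_core A : proj A -> core A.
Proof.
move=> [fA hA]; split.
  by apply/perp_ringP; split=> //; exact: perp_projective.
by apply/Gproj_perpP; split=> // X [_ gX]; exact: GProj_ext1.
Qed.

(** A embeds into a finite free module with cokernel in [Gproj], and this sequence splits. *)
Lemma core_proj A : core A -> Gproj A -> proj A.
Proof.
move=> [_ /Gproj_perpP [fA hA]] gA; split=> //.
have [n [B [a [q [e gB]]]]] := Gproj_cosyzygy gA.
have [r ra] := hA B gB _ _ _ e.
by apply: (projective_retract (Q := 'rV[R]_n)); [exists a, r | exact: projective_rV].
Qed.

Lemma core_retract A B : retract A B -> core B -> core A.
Proof.
move=> r [/perp_ringP [fB pB] /Gproj_perpP [_ hB]].
have fA := fin_gen_retract r fB; split.
  by apply/perp_ringP; split=> //; apply: perp_stable_retract pB; exact: retract_stable_retract.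
by apply/Gproj_perpP; split=> // X gX; exact: ext1_retract_r r (hB X gX).
Qed.

(** A test module X is itself the syzygy of some X1 in [Gproj], so Ext^1(X, K) is squeezed between
    Ext^1(X1, A) and Ext^1(X, R^n). *)
Lemma core_syzygy A K n (i : {linear K -> 'rV[R]_n}) (p : {linear 'rV[R]_n -> A}) :
  ses i p -> core A -> core K.
Proof.
move=> e [/perp_ringP [fA pA] /Gproj_perpP [_ hA]].
have fK : fin_gen K.
  by have [ii _ _] := e; exact: (fin_gen_sub hk finite) ii (fin_gen_rV R n).
have hP := projective_rV (R := R) (n := n); split.
  by apply/perp_ringP; split=> //; exact: perp_syzygy hP e pA.
apply/Gproj_perpP; split=> // X gX.
have [m [X1 [a [q [e1 gX1]]]]] := Gproj_cosyzygy gX.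
have [L [Q [l [x [hQ e2]]]]] := cover_ses X.
apply: (ext1_ker_r e e2 hQ e1 (projective_rV (n := m)) (hA _ gX1)).
exact: GProj_ext1 gX.2 hP.
Qed.

(** For the finitely generated modules in question this amounts to embedding into a finite free
    module; the pointwise form is inherited by submodules and tested on summands. *)
Definition torsionless A : Prop := forall x, x <> 0 -> exists f : {linear A -> R^o}, f x <> 0.

Lemma torsionless_mono A B (i : {linear A -> B}) :
  injective i -> torsionless B -> torsionless A.
Proof.
move=> ii tB x nx; have [|f hf] := tB (i x); last by exists (f \o i).
by rewrite -(linear0 i) => /ii.
Qed.

Lemma torsionless_rV n : torsionless ('rV[R]_n).
Proof.
move=> v nv; have /existsNP [j nj] : ~ forall j, v 0 j = 0.
  by move=> h; apply: nv; apply/rowP => j; rewrite h mxE.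
have [f hf] := rV_coord R j.
by exists f; rewrite hf.
Qed.

Lemma torsionless_krull_schmidt A : krull_schmidt A ->
  (forall E, indecomposable E -> retract E A -> torsionless E) -> torsionless A.
Proof.
move=> [I [E [a [b [h1 h2 h3]]]]] h x nx.
have /existsNP [i ni] : ~ forall i, a i x = 0.
  by move=> h0; apply: nx; rewrite [x]h3 big1 // => i _; rewrite h0 linear0.
have [|f hf] := h (E i) (h1 i) _ (a i x) ni; first by exists (b i), (a i).
by exists (f \o a i).
Qed.

(* The cokernel of a left approximation A -> R^n by free modules. *)
Lemma core_cosyzygy A : core A -> torsionless A ->
  exists n C (a : {linear A -> 'rV[R]_n}) (q : {linear 'rV[R]_n -> C}),
    ses a q /\ core C.
Proof.
move=> cA tA; have [/perp_ringP [fA pA] /Gproj_perpP [_ hA]] := cA.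
have fR := fin_gen_regular R.
(* Generators of Hom(A, R) over k serve as coordinates of the approximation: every functional on A
   is a k-combination of them and therefore extends along [a]. *)
have [n [h hh]] := fin_gen_hom hk central finite fA fR.
have [a ha] := rV_tuple h.
have ia : injective a.
  apply: linear_inj => x ax; apply: contrapT => /tA [f]; apply.
  have [c ->] := hh f; rewrite big1 // => j _.
  by have /rowP /(_ j) := ax; rewrite ha !mxE => ->; rewrite scaler0.
have [C [q e]] := coker_ses ia; have [_ sq _] := e.
have hP := projective_rV (R := R) (n := n).
have fC : fin_gen C by apply: fin_gen_surj sq (fin_gen_rV R n).
exists n, C, a, q; split=> //; split.
  apply/perp_ringP; split=> //; apply: (perp_of_syzygy hP e) => //.
  apply: (ext1_of_extend e) => [|f]; first exact: projective_ext1.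
  have [c hc] := hh f.
  have [g hg] : exists g : {linear 'rV[R]_n -> R^o},
      forall v, g v = \sum_i (v 0 i * iota (c i) : R^o).
    apply: (linear_of_fun (B := R^o)) => r v w; rewrite scaler_sumr -big_split.
    by apply: eq_bigr => i _; rewrite !mxE mulrDl -mulrA.
  exists g => x; rewrite hg hc; apply: eq_bigr => i _.
  by rewrite ha mxE -central.
apply/Gproj_perpP; split=> // X gX.
have [m [L [l [x [e1 fL]]]]] := fin_presentation gX.1.
have hQ := projective_rV (R := R) (n := m).
apply: (ext1_coker_r e e1 hQ); last exact: GProj_ext1 gX.2 hP.
by apply: hA; split=> //; exact: GProj_syzygy e1 gX.2.
Qed.

(* If the composite A -> B -> A of the induced maps were not bijective it would
   be nilpotent, and the identity of E would factor through P. *)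
Lemma syzygy_injective A B E K L m n (i : {linear K -> 'rV[R]_m})
    (p : {linear 'rV[R]_m -> A}) (j : {linear L -> 'rV[R]_n})
    (q : {linear 'rV[R]_n -> B}) :
  ses i p -> ses j q -> fin_gen A -> fin_gen B -> ext1 A R^o -> ext1 B R^o ->
  indecomposable A -> indecomposable B ->
  ~ projective E -> retract E K -> retract E L -> isom A B.
Proof.
move=> e e' fA fB eA eB hA hB nE [e1 [r1 re1]] [e2 [r2 re2]].
have [ii sp ex] := e; have [ij sq ex'] := e'.
have hP := projective_rV (R := R) (n := m); have hQ := projective_rV (R := R) (n := n).
have [U hU] := ext1_extend (j \o (e2 \o r1)) (ext1_free fA eA hQ) e.
have [V hV] := ext1_extend (i \o (e1 \o r2)) (ext1_free fB eB hP) e'.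
have [f hf] : exists f : {linear A -> B}, forall x, f (p x) = (q \o U) x.
  by apply: factor_surj => // x /ex [y <-] /=; rewrite hU /= (ses0 _ e').
have [g hg] : exists g : {linear B -> A}, forall x, g (q x) = (p \o V) x.
  by apply: factor_surj => // x /ex' [y <-] /=; rewrite hV /= (ses0 _ e).
have [[N hN]|[igf sgf]] :=
    indecomposable_end (g \o f : {linear A -> A}) (noeth fA) (artin fA) hA; last first.
  apply: retract_indecomposable => //; first by case: hA.
  have [t [t1 _]] := linear_inverse igf sgf.
  by exists f, (t \o g) => x; rewrite -[RHS]t1.
(* V U is the identity on the copy of E in R^m, while W, a power of it, takes values in K = ker p
   because g f is nilpotent. Hence E is a direct summand of R^m. *)
case: nE; have [W hW] := iter_linear (V \o U : {linear 'rV[R]_m -> 'rV[R]_m}) N.+1.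
have pW x : p (W x) = 0.
  have step l : p (iter l (V \o U) x) = iter l (g \o f) (p x).
    by elim: l => //= l <-; rewrite hf /= hg.
  by rewrite hW step iterS hN linear0.
have [h hh] : exists h : {linear 'rV[R]_m -> K}, forall x, i (h x) = W x.
  by apply: linear_lift_inj => // x; apply/ex.
apply: (projective_retract (Q := 'rV[R]_m)) => //.
exists (i \o e1), (r1 \o h) => x /=.
suff -> : h (i (e1 x)) = e1 x by rewrite re1.
apply: ii; rewrite hh hW.
elim: N.+1 => // l; rewrite iterS => -> /=.
by rewrite hU /= re1 hV /= re2.
Qed.

Lemma core_torsionless : finite_rep_type core -> forall A, core A -> torsionless A.
Proof.
move=> [n [M hM]].
(* J selects the least index in each isomorphism class of nonprojective indecomposables of the
   class, so that isomorphic modules get equal indices. The list M may also contain other modules;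
   on their indices the map s below is the identity. *)
pose J (i : 'I_n) := [/\ core (M i), indecomposable (M i), ~ projective (M i)
  & forall j : 'I_n, (j < i)%N -> ~ isom (M j) (M i)].
have rep A : core A -> indecomposable A -> ~ projective A -> exists2 i, J i & isom A (M i).
  move=> cA iA nA; have ex : exists m : nat, `[< exists2 i : 'I_n, i = m :> nat & isom A (M i) >].
    by have [i hi] := hM A cA iA; exists i; apply/asboolP; exists i.
  have [_ /asboolP [i <- hi] imin] := ex_minnP ex.
  have [r1 r2] := isom_retract hi.
  have ci := core_retract r2 cA.
  have isom_tr X Y Z : isom X Y -> isom Y Z -> isom X Z.
    move=> [f bf] [g bg]; exists (g \o f); exact: bij_comp bg bf.
  have isom_sym X Y : isom X Y -> isom Y X.
    by move=> /isom_inverse [f [g [fg gf]]]; exists g, f.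
  exists i => //; split=> //.
  - split; first by move=> z; case: iA => nz _; case: nz => x;
      have [u [v vu]] := r1; rewrite -[LHS]vu (z (u x)) linear0.
    by move=> X Y hXY; apply: iA.2; apply: isom_tr hi hXY.
  - by move=> pM; apply: nA; exact: projective_retract r1 pM.
  - move=> j ji iso; have := imin j; rewrite leqNgt ji => /(_ _) h.
    suff : false by []. 
    by apply: h; apply/asboolP; exists j => //; apply: isom_tr hi (isom_sym _ _ iso).
pose T i j := J j /\ exists m K (a : {linear K -> 'rV[R]_m}) (p : {linear 'rV[R]_m -> M i}),
  ses a p /\ retract (M j) K.
have next i : exists j, (J i -> T i j) /\ (~ J i -> i = j).
  have [Ji|nJ] := pselect (J i); last by exists i.
  suff [j Tj] : exists j, T i j by exists j.
  have [ci ii ni _] := Ji; have [/perp_ringP [fi pi] _] := ci.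
  have [m [K [a [p [e fK]]]]] := fin_presentation fi.
  have cK := core_syzygy e ci.
  (* The syzygy has a nonprojective summand: if it were projective, its sequence would split,
     Ext^1(M i, R) being zero, and M i would be projective. *)
  have [|E [iE rE nE]] := nonprojective_summand (artin fK).
    move=> pK; apply: ni.
    exact: projective_retract (ext1_split e (ext1_free fi (pi 0%N) pK)) (@projective_rV R m).
  have [j Jj iso] := rep E (core_retract rE cK) iE nE.
  exists j; split=> //; exists m, K, a, p; split=> //.
  have [_ [u [v vu]]] := isom_retract iso; have [u' [v' vu']] := rE.
  by exists (u' \o u), (v \o v') => x; rewrite /= vu' vu.
have [s hs] := choice next.
have inj_s : injective s.
  move=> i i' eq.
  have [Ji|nJ] := pselect (J i); have [Ji'|nJ'] := pselect (J i').
  - have [[cj ij nj _] [m [K [a [p [e r]]]]]] := (hs i).1 Ji.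
    have [_ [m' [K' [a' [p' [e' r']]]]]] := (hs i').1 Ji'.
    rewrite -eq in r'.
    have [ci ii _ mi] := Ji; have [ci' ii' _ mi'] := Ji'.
    have [[/perp_ringP [fi pi] _] [/perp_ringP [fi' pi'] _]] := (ci, ci').
    have iso := syzygy_injective e e' fi fi' (pi 0%N) (pi' 0%N) ii ii' nj r r'.
    have iso' := syzygy_injective e' e fi' fi (pi' 0%N) (pi 0%N) ii' ii nj r' r.
    apply/val_inj; have [lt|lt|//] := ltngtP i i'; first by case: (mi' _ lt).
    by case: (mi _ lt).
  - have [Jj _] := (hs i).1 Ji; case: (nJ').
    by rewrite ((hs i').2 nJ') -eq.
  - have [Jj _] := (hs i').1 Ji'; case: (nJ).
    by rewrite ((hs i).2 nJ) eq.
  - by rewrite ((hs i).2 nJ) eq -((hs i').2 nJ').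
have tJ j : J j -> torsionless (M j).
  move=> Jj; have [t st ts] := injF_bij inj_s.
  have [Ji|nJ] := pselect (J (t j)); last first.
    by case: (nJ); have := (hs (t j)).2 nJ; rewrite ts => ->.
  have [_ [m [K [a [p [e [u [v vu]]]]]]]] := (hs (t j)).1 Ji.
  rewrite ts in u v vu *; have [ia _ _] := e.
  apply: (torsionless_mono (i := a \o u)); last exact: torsionless_rV.
  exact: inj_comp ia (can_inj vu).
move=> A cA; have [/perp_ringP [fA _] _] := cA.
apply: torsionless_krull_schmidt; first exact/krull_schmidt_exists/artin.
move=> E iE rE; have cE := core_retract rE cA.
have [pE|nE] := pselect (projective E); last first.
  have [j Jj /isom_retract [[u [v vu]] _]] := rep E cE iE nE.
  exact: torsionless_mono (can_inj vu) (tJ j Jj).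
have [/perp_ringP [/fin_genP [m [p sp]] _] _] := cE.
have [t ht] := projective_rV_section pE sp.
exact: torsionless_mono (can_inj ht) (@torsionless_rV m).
Qed.

Lemma core_finite_proj A : finite_rep_type core -> core A -> proj A.
Proof.
move=> hfin cA; apply: (core_proj cA).
have [/perp_ringP [fA _] _] := cA; split=> //.
apply: (GProj_of_class (S := core)) cA => {fA}A cA.
have [/perp_ringP [fA pA] _] := cA; split.
- by move=> Q hQ; exact: ext1_free (pA 0%N) hQ.
- have [m [K [a [p [e fK]]]]] := fin_presentation fA.
  by exists K, ('rV[R]_m), a, p; split=> //; [exact: core_syzygy e cA | exact: projective_rV].
have [n [C [a [q [e cC]]]]] := core_cosyzygy cA (core_torsionless hfin cA).
by exists ('rV[R]_n), C, a, q; split=> //; exact: projective_rV.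
Qed.

(** An indecomposable P in [proj] is a summand of R^n, so its identity is a sum of maps through the
    indecomposable summands of R; by locality one of them is bijective, and P is isomorphic to that
    summand. *)
Lemma proj_finite_rep_type : finite_rep_type (@proj R).
Proof.
have fR := fin_gen_regular R.
have [I [E [a [b [h1 h2 h3]]]]] := krull_schmidt_exists (artin fR).
exists #|I|, (fun j => E (enum_val j)) => P [fP hP] iP.
have [n [p sp]] := (fin_genP P).1 fP.
have [s ps] := projective_rV_section hP sp.
have [pr hpr] := choice (@rV_coord R n).
have basis (j : 'I_n) : exists inj : {linear R^o -> 'rV[R]_n},
    forall r : R, inj r = r *: delta_mx 0 j.
  by apply: linear_of_fun => r x y; rewrite scalerDl scalerA.
have [inj hinj] := choice basis.
pose f (ji : 'I_n * I) : {linear P -> P} :=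
  (p \o inj ji.1 \o b ji.2) \o (a ji.2 \o pr ji.1 \o s).
have [|||[j i] [injf surf]] := @indecomposable_local R P _ (index_enum ('I_n * I)%type) f idfun
    (noeth fP) (artin fP) iP _ _.
- move=> x; rewrite -(pair_bigA _ (fun j i => f (j, i) x)) /= -[LHS]ps.
  rewrite [X in p X](rV_basis (s x)) linear_sum; apply: eq_bigr => j _ /=.
  rewrite -hinj -hpr [X in inj j X](h3 (pr j (s x))) !linear_sum.
  by apply: eq_bigr => i _.
- by [].
- by move=> x; exists x.
exists (enum_rank i); rewrite enum_rankK.
apply: retract_indecomposable => //; first by case: iP.
have [t [t1 t2]] := linear_inverse injf surf.
exists (a i \o pr j \o s), (t \o (p \o inj j \o b i)) => x.
by rewrite -[RHS]t1.
Qed.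

Lemma perp_ring_Gproj_of_finite : contravariantly_finite (@Gproj R) ->
  finite_rep_type core -> forall A, perp_ring A -> Gproj A.
Proof.
move=> hcf hfin A pA; have [fA pA'] := (perp_ringP A).1 pA.
have [X0 [p0 [gX0 hX0]]] := hcf A fA.
have [X [p [[gX hX] pmin]]] := minimal_right_approx (@Gproj_retract R)
  (noeth gX0.1) (artin gX0.1) (conj gX0 (fun Y f => hX0 Y f)).
have sp : surj p.
  have [n [q sq]] := (fin_genP A).1 fA; have [h hh] := hX _ q (Gproj_rV R n).
  by move=> x; have [y <-] := sq x; exists (h y).
have [Y [i e]] := ker_ses sp; have [ii _ _] := e.
have fY : fin_gen Y by apply: (fin_gen_sub hk finite ii gX.1).
have Gext A1 B A2 (i' : {linear A1 -> B}) (p' : {linear B -> A2}) :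
    ses i' p' -> Gproj A1 -> Gproj A2 -> Gproj B.
  move=> e' [f1 g1] [f2 g2]; split; [exact: fin_gen_ext e' f1 f2 | exact: GProj_ext e' g1 g2].
have cY : core Y.
  split; apply/perp_ringP || apply/Gproj_perpP; split=> //.
    by apply: (perp_ker e) pA'; exact: GProj_perp gX.2 projective_regular.
  by move=> X' gX'; apply: (wakamatsu_right Gext e (conj gX hX) pmin gX').
have [_ pY] := core_finite_proj hfin cY.
exact: Gproj_retract (ext1_split e (ext1_free fA (pA' 0%N) pY)) gX.
Qed.

(** Take the map N^r -> A with components [h j]: a combination with coefficients c is its composite
    with the map N -> N^r given by c. *)
Lemma combination_cover A N r (h : 'I_r -> {linear N -> A}) : Gproj N ->
  exists X (p : {linear X -> A}), Gproj X /\ forall c : 'I_r -> k,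
    exists g : {linear N -> X}, forall x, p (g x) = \sum_j iota (c j) *: h j x.
Proof.
move=> gN; elim: r h => [|r IH] h.
  exists ('rV[R]_0), \0; split=> [|c]; first exact: Gproj_rV.
  by exists \0 => x; rewrite big_ord0.
have [X [p [gX hp]]] := IH (fun j => h (widen_ord (leqnSn r) j)).
exists (X * N)%type, (copair_fun p (h ord_max)); split; first exact: Gproj_prod.
move=> c; have [g hg] := hp (fun j => c (widen_ord (leqnSn r) j)).
have [m hm] := combination_exists central (fun _ : 'I_1 => idfun : {linear N -> N})
  (fun=> c ord_max).
exists (pair_fun g m) => x; rewrite big_ord_recr /= -[LHS]/(p (g x) + h ord_max (m x)).
by rewrite hg hm big_ord1 linearZ.
Qed.

(** The approximation is a finite sum of copies of the listed modules, one copy of M i for each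
    generator of Hom(M i, A) over k. A map from an arbitrary Z in [Gproj] is lifted on each
    indecomposable summand of Z. *)
Lemma finite_CM_contravariantly_finite : finite_CM_type R ->
  contravariantly_finite (@Gproj R).
Proof.
move=> [n [M hM]] A fA.
have cover (s : seq 'I_n) : exists X (p : {linear X -> A}), Gproj X /\
    forall i, i \in s -> Gproj (M i) -> forall f : {linear M i -> A},
      exists h : {linear M i -> X}, forall x, p (h x) = f x.
  elim: s => [|i s [X [p [gX hp]]]]; first by exists ('rV[R]_0), \0; split=> //; exact: Gproj_rV.
  (* The list may contain modules outside [Gproj]; these are skipped. *)
  have [gi|ni] := pselect (Gproj (M i)); last first.
    by exists X, p; split=> // j; rewrite inE => /orP [/eqP ->|]; [move/ni | exact: hp].
  have [r [h hh]] := fin_gen_hom hk central finite gi.1 fA.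
  have [Y [q [gY hq]]] := combination_cover h gi.
  exists (X * Y)%type, (copair_fun p q); split; first exact: Gproj_prod.
  move=> j; rewrite inE => /orP [/eqP -> _ f|js gj f].
    have [c hc] := hh f; have [g hg] := hq c.
    exists (pair_fun \0 g) => x; rewrite -[LHS]/(p 0 + q (g x)) linear0 add0r.
    by rewrite hg hc.
  have [g hg] := hp j js gj f.
  by exists (pair_fun g \0) => x; rewrite -[LHS]/(p (g x) + q 0) linear0 addr0.
have [X [p [gX hp]]] := cover (enum 'I_n).
exists X, p; split=> // Z f gZ.
have [I [E [a [b [h1 h2 h3]]]]] := krull_schmidt_exists (artin gZ.1).
have lift i : exists h : {linear E i -> X}, forall x, p (h x) = (f \o b i) x.
  have gE : Gproj (E i) by apply: Gproj_retract gZ; exists (b i), (a i).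
  have [j /isom_retract [[u [v vu]] rM]] := hM _ gE (h1 i).
  have [h hh] := hp j (mem_enum _ j) (Gproj_retract rM gE) (f \o b i \o v).
  by exists (h \o u) => x; rewrite /= hh /= vu.
have [l hl] := dchoice lift.
have [h hh] := sum_maps a l; exists h => x; rewrite hh [in RHS](h3 x) !linear_sum.
by apply: eq_bigr => i _; exact: hl.
Qed.

End Equivalence.

(** * Sequential colimits *)

Section Colimit.
Variable R : pzRingType.
Variables (M : nat -> lmodType R) (t : forall n, {linear M n -> M n.+1}).

(** Meaningful for n <= m only; below n the recursion runs into the default value 0. *)
Fixpoint transition m n (y : M n) : M m :=
  match pselect (n = m) with
  | left e => ecast j (M j) e y
  | right _ => match m return M m with 0 => 0 | m'.+1 => t m' (transition m' y) end
  end.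

Lemma transition_id n y : transition n (y : M n) = y.
Proof.
by case: n y => [|n] y /=; case: pselect => // e; rewrite eq_axiomK.
Qed.

Lemma transitionS m n (y : M n) : (n <= m)%N -> transition m.+1 y = t m (transition m y).
Proof.
move=> nm /=; case: pselect => // e.
by exfalso; move: nm; rewrite e ltnn.
Qed.

Lemma transition_linear m n a (x y : M n) : (n <= m)%N ->
  transition m (a *: x + y) = a *: transition m x + transition m y.
Proof.
elim: m => [|m IH]; first by case: n x y => // x y; rewrite !transition_id.
rewrite leq_eqVlt => /orP [/eqP e|nm]; first by subst n; rewrite !transition_id.
by rewrite !transitionS // IH // linearP.
Qed.

Lemma transition0 m n : (n <= m)%N -> transition m (0 : M n) = 0.
Proof.
move=> nm; have := transition_linear (-1) (0 : M n) 0 nm.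
by rewrite scaler0 addr0 scaleN1r addNr.
Qed.

Hypothesis ti : forall n, injective (t n).

Lemma transition_eq0 m n (x : M n) : (n <= m)%N -> transition m x = 0 -> x = 0.
Proof.
elim: m => [|m IH]; first by case: n x => // x; rewrite transition_id.
rewrite leq_eqVlt => /orP [/eqP e|nm]; first by subst n; rewrite transition_id.
by rewrite transitionS // -(linear0 (t m)) => /ti; exact: IH.
Qed.

(** Sequences that are eventually compatible with t, modulo those that are eventually zero. *)
Lemma colimit_exists : exists (C : lmodType R) (i : forall n, {linear M n -> C}),
  [/\ forall n, injective (i n), forall n x, i n.+1 (t n x) = i n x
    & forall x, exists n y, i n y = x].
Proof.
have [P [pr [prI prS]]] := prod_exists M.
pose Z x := exists N, forall n, (N <= n)%N -> pr n x = 0.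
have hZ : submod Z.
  split; first by exists 0%N => n _; rewrite linear0.
  move=> a x y [N hN] [N' hN']; exists (maxn N N') => n; rewrite geq_max => /andP [h h'].
  by rewrite linearP hN // hN' // scaler0 addr0.
have [Q [q [sq hq]]] := quot_exists hZ.
pose S x := exists y, q y = x /\ exists N, forall n, (N <= n)%N -> pr n.+1 y = t n (pr n y).
have hS : submod S.
  split.
    exists 0; split; first by rewrite linear0.
    by exists 0%N => n _; rewrite !linear0.
  move=> a _ _ [x [<- [N hN]]] [y [<- [N' hN']]]; exists (a *: x + y); split.
    by rewrite linearP.
  exists (maxn N N') => n; rewrite geq_max => /andP [h h'].
  by rewrite !linearP hN // hN'.
have [C [v [vi hv]]] := sub_exists hS.
have ex n (x : M n) : exists y, forall m, pr m y = transition m x by exact: prS.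
have qE x y N : (forall n, (N <= n)%N -> pr n x = pr n y) -> q x = q y.
  move=> h; apply/eqP; rewrite -subr_eq0 -linearB; apply/eqP/hq; exists N => n Nn.
  by rewrite linearB h // subrr.
have inc n : exists i : {linear M n -> C}, forall x, exists y,
    v (i x) = q y /\ forall m, (n <= m)%N -> pr m y = transition m x.
  apply: (@linear_of_rel R (M n) C (fun x z => exists y,
    v z = q y /\ forall m, (n <= m)%N -> pr m y = transition m x)).
  - move=> x; have [y hy] := ex n x.
    have /hv [z hz] : S (q y).
      exists y; split=> //; exists n => m nm; rewrite !hy; exact: transitionS.
    by exists z, y; split.
  - move=> a x z x' z' [y [h1 h2]] [y' [h1' h2']]; exists (a *: y + y'); split.
      by rewrite !linearP h1 h1'.
    by move=> m nm; rewrite linearP h2 // h2' // transition_linear.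
  - move=> z [y [h1 h2]]; apply: vi; rewrite h1 linear0; apply/hq; exists n => m nm.
    by rewrite h2 // transition0.
have [i hi] := dchoice inc.
exists C, i; split.
- move=> n; apply: linear_inj => x h; have [y [h1 h2]] := hi n x.
  move: h1; rewrite h linear0 => /esym /hq [N hN].
  apply: (@transition_eq0 (maxn n N)); first exact: leq_maxl.
  by rewrite -h2 ?leq_maxl // hN // leq_maxr.
- move=> n x; apply: vi; have [y [-> h]] := hi n.+1 (t n x).
  have [z [-> h']] := hi n x; apply: (qE _ _ n.+1) => m nm.
  rewrite h // h' ?(ltnW nm) //; elim: m nm => // m IH.
  rewrite leq_eqVlt => /orP [/eqP [e]|nm].
    by subst n; rewrite transition_id transitionS // transition_id.
  have nm' : (n < m)%N := nm.
  by rewrite (@transitionS m n.+1) // (@transitionS m n) ?IH // ltnW.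
- move=> x; have /hv [y [yx [N hN]]] : exists z, v z = v x by exists x.
  exists N, (pr N y); apply: vi; rewrite -yx; have [z [-> h]] := hi N (pr N y).
  apply: (qE _ _ N) => m; elim: m => [|m IH].
    by rewrite leqn0 => /eqP e; subst N; rewrite h // transition_id.
  rewrite leq_eqVlt => /orP [/eqP e|nm]; first by subst N; rewrite h // transition_id.
  by rewrite h ?leqW // transitionS // -h // IH // hN.
Qed.

Implicit Types N Y : lmodType R.
Variables (C : lmodType R) (i : forall n, {linear M n -> C}).
Hypotheses (ii : forall n, injective (i n)) (it : forall n x, i n.+1 (t n x) = i n x)
  (isur : forall x, exists n y, i n y = x).

Lemma colimit_mono m n x : (m <= n)%N -> exists y, i n y = i m x.
Proof.
move=> /subnK <-; elim: (n - m)%N => [|d [y hy]]; first by exists x.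
by rewrite addSn; exists (t _ y); rewrite it.
Qed.

Lemma colimit_fin_gen N (f : {linear N -> C}) : fin_gen N ->
  exists n (g : {linear N -> M n}), forall x, i n (g x) = f x.
Proof.
move=> [m [e he]].
have [n hn] : exists n, forall j, exists y, i n y = f (e j).
  elim: m e {he} => [|m IH] e; first by exists 0%N => - [].
  have [n hn] := IH (fun j => e (lift ord0 j)).
  have [n' [y hy]] := isur (f (e ord0)).
  exists (maxn n n') => j; case: (unliftP ord0 j) => [j' ->|->].
    have [z <-] := hn j'; exact/colimit_mono/leq_maxl.
  rewrite -hy; exact/colimit_mono/leq_maxr.
exists n; apply: linear_lift_inj => // x; have [c ->] := he x; rewrite linear_sum.
apply: (submod_sum _ (submod_im (i n))) => j _; rewrite linearZ.
exact: (submodZ _ (submod_im (i n))).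
Qed.

Lemma colimit_map Y (p : forall n, {linear M n -> Y}) :
  (forall n x, p n.+1 (t n x) = p n x) ->
  exists q : {linear C -> Y}, forall n x, q (i n x) = p n x.
Proof.
move=> hp.
have mono m n x : (m <= n)%N -> exists y, i n y = i m x /\ p n y = p m x.
  move=> /subnK <-; elim: (n - m)%N => [|d [y [hy py]]]; first by exists x.
  by rewrite addSn; exists (t _ y); rewrite it hp.
have [q hq] : exists q : {linear C -> Y}, forall x, exists n y, i n y = x /\ p n y = q x.
  apply: (@linear_of_rel R C Y (fun x z => exists n y, i n y = x /\ p n y = z)).
  - by move=> x; have [n [y <-]] := isur x; exists (p n y), n, y.
  - move=> a _ _ _ _ [n [y [<- <-]]] [n' [y' [<- <-]]].
    have [z [<- <-]] := mono _ _ y (leq_maxl n n').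
    have [z' [<- <-]] := mono _ _ y' (leq_maxr n n').
    by exists (maxn n n'), (a *: z + z'); rewrite !linearP.
  - by move=> _ [n [y [h <-]]]; have -> : y = 0; [apply: ii; rewrite h linear0 | rewrite linear0].
exists q => n x; have [m [y [h <-]]] := hq (i n x).
have [z [hz <-]] := mono _ _ y (leq_maxl m n).
have [z' [hz' <-]] := mono _ _ x (leq_maxr m n).
by congr (p _ _); apply: ii; rewrite hz hz'.
Qed.
End Colimit.

(** * The small object argument and injective modules *)

Section SmallObject.
Variable R : pzRingType.
Implicit Types A B C D E F K L M N P Q T W X Y Z : lmodType R.
Hypothesis noeth : forall M, fin_gen M -> noetherian M.

Let fin_gen_sub K M (i : {linear K -> M}) (ii : injective i) (fM : fin_gen M) :
  fin_gen K := noetherian_sub ii (noeth fM).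

Variable S : lmodType R -> Prop.

Definition fin_perp Z : Prop := fin_gen Z /\ forall Y, S Y -> ext1 Z Y.

Definition good W : Prop := forall N (f : {linear N -> W}), fin_gen N ->
  exists Z (a : {linear N -> Z}) (b : {linear Z -> W}),
    fin_perp Z /\ forall x, b (a x) = f x.

Lemma good_retract V W : retract V W -> good W -> good V.
Proof.
move=> [u [v vu]] gW N f fN; have [Z [a [b [hZ ba]]]] := gW N (u \o f) fN.
by exists Z, a, (v \o b); split=> // x; rewrite /= ba /= vu.
Qed.

Section Step.
Variables (I : choiceType) (K F : I -> lmodType R) (kap : forall i, {linear K i -> F i}).
Hypotheses (kapi : forall i, injective (kap i)) (fF : forall i, fin_gen (F i))
  (pF : forall i, projective (F i)).

Lemma fin_gen_sum X (s : seq I) (h : forall i, {linear F i -> X}) :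
  (forall x, exists y : forall i, F i, x = \sum_(i <- s) h i (y i)) -> fin_gen X.
Proof.
move=> hX; have [P [q [fP hq]]] : exists P (q : {linear P -> X}), fin_gen P /\
    forall y : forall i, F i, exists z, q z = \sum_(i <- s) h i (y i).
  elim: s {hX} => [|i s [P [q [fP hq]]]].
    exists ('rV[R]_0), \0; split=> [|y]; first exact: fin_gen_rV.
    by exists 0; rewrite big_nil.
  exists (F i * P)%type, (copair_fun (h i) q); split; first exact: fin_gen_prod.
  move=> y; have [z hz] := hq y; exists (y i, z).
  by rewrite big_cons -hz.
apply: (fin_gen_surj (p := q)) => // x.
by have [y ->] := hX x; exact: hq.
Qed.

Variables (W Y : lmodType R) (p : {linear W -> Y}) (f : forall i, {linear K i -> W}).
Hypothesis pf : forall i x, p (f i x) = 0.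

(* W' is the pushout of W <- (+) K i -> (+) F i. *)
Lemma attach_cells : exists W' (iota : {linear W -> W'}) (p' : {linear W' -> Y}),
  [/\ injective iota, forall x, p' (iota x) = p x,
      forall i, exists g : {linear F i -> W'},
        (forall x, g (kap i x) = iota (f i x)) /\ forall x, p' (g x) = 0
    & (forall i X, S X -> forall h : {linear K i -> X},
         exists g : {linear F i -> X}, forall x, g (kap i x) = h x) ->
      good W -> good W'].
Proof.
have [D [inj [pr [h1 h2 h3 h4]]]] := dsum_exists F.
have [DK [injK [prK [k1 k2 k3 k4]]]] := dsum_exists K.
have [kk hkk] := k4 D (fun i => inj i \o kap i).
have [phi hphi] := k4 W f.
have DK_eq X (u v : {linear DK -> X}) : (forall i x, u (injK i x) = v (injK i x)) ->
    forall x, u x = v x.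
  move=> h x; have [s us /(_ s us (fun _ => id)) ->] := k3 x.
  by rewrite !linear_sum; apply: eq_bigr => i _; exact: h.
have prkk i x : pr i (kk x) = kap i (prK i x).
  apply: (DK_eq _ (pr i \o kk) (kap i \o prK i)) => j y /=; rewrite hkk /=.
  have [e|ne] := pselect (j = i); first by subst j; rewrite h1 k1.
  by rewrite h2 // k2 // linear0.
have ikk : injective kk.
  apply: linear_inj => x hx; have [s us /(_ s us (fun _ => id)) ->] := k3 x.
  rewrite big1 // => i _; have -> : prK i x = 0; last by rewrite linear0.
  by apply: kapi; rewrite -prkk hx !linear0.
have [CC [cc ekk]] := coker_ses ikk; have [_ scc _] := ekk.
have [W' [io [dl [tw [eW rel twdl univ _]]]]] := pushout phi ekk; have [iio _ exW] := eW.
have [p' [pio pdl]] : exists p' : {linear W' -> Y},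
    (forall x, p' (io x) = p x) /\ forall x, p' (dl x) = (\0 : {linear D -> Y}) x.
  by apply: univ => z; apply: (DK_eq _ (p \o phi) \0) => i x /=; rewrite hphi; exact: pf.
exists W', io, p'; split=> //.
  move=> i; exists (dl \o inj i); split=> x /=; last exact: pdl.
  by rewrite -hphi rel hkk.
have sW y : exists xy, y = io xy.1 + dl xy.2.
  have [z hz] := scc (tw y).
  have /exW [x hx] : tw (y - dl z) = 0 by rewrite linearB twdl hz subrr.
  by exists (x, z); rewrite hx subrK.
have relE x y : io x + dl y = 0 -> exists2 z, phi z = x & kk z = - y.
  move=> h; have [_ _ ex] := ekk; have /ex [z hz] : cc (- y) = 0.
    by have := congr1 tw h; rewrite linearD (ses0 x eW) twdl add0r !linear0 linearN => ->; rewrite oppr0.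
  exists z => //; apply: iio; rewrite rel hz linearN; apply/eqP.
  by rewrite eq_sym -addr_eq0 h.
move=> hext gW N u fN; have [m [e he]] := fN.
have [xy hxy] := choice (fun a => sW (u (e a))).
(* The generators of N touch only the finitely many cells in s. From here on N is handled with F0
   and K0, the sums of F i and K i over s. *)
have [s us hs] : exists2 s : seq I, uniq s &
    forall a, (xy a).2 = \sum_(i <- s) inj i (pr i (xy a).2).
  have [sf hsf] := choice (fun a => let: ex_intro2 s us h := h3 (xy a).2 in
    ex_intro (fun s => forall s', uniq s' -> {subset s <= s'} ->
      (xy a).2 = \sum_(i <- s') inj i (pr i (xy a).2)) s h).
  exists (undup (flatten [seq sf a | a <- enum 'I_m])); first exact: undup_uniq.
  move=> a; apply: hsf; first exact: undup_uniq.
  move=> i ia; rewrite mem_undup; apply/flattenP; exists (sf a) => //.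
  by apply: map_f; rewrite mem_enum.
have trunc (G : I -> lmodType R) X (a : forall i, {linear G i -> X})
    (b : forall i, {linear X -> G i}) : (forall i x, b i (a i x) = x) ->
    (forall i j x, i <> j -> b j (a i x) = 0) ->
    exists F0 (v : {linear F0 -> X}) (r : {linear X -> F0}),
      (forall x, r (v x) = x) /\ forall x, v (r x) = \sum_(i <- s) a i (b i x).
  move=> ab ab0.
  have [ee hee] : exists ee : {linear X -> X}, forall x, ee x = \sum_(i <- s) a i (b i x).
    apply: linear_of_fun => c x y; rewrite scaler_sumr -big_split.
    by apply: eq_bigr => i _; rewrite !linearP.
  have idem x : ee (ee x) = ee x.
    rewrite hee [in RHS]hee !big_seq; apply: eq_bigr => i si; congr (a i _).
    rewrite hee linear_sum (bigD1_seq i) //= ab big1 ?addr0 // => j /eqP ji.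
    exact: ab0.
  have [F0 [v [r [rv vr]]]] := idempotent_split idem.
  by exists F0, v, r; split=> // x; rewrite vr hee.
have [F0 [v [r [rv vr]]]] := trunc _ _ inj pr h1 h2.
have [K0 [vK [rK [rvK vrK]]]] := trunc _ _ injK prK k1 k2.
have vrkk z : v (r (kk z)) = kk (vK (rK z)).
  rewrite vr vrK linear_sum; apply: eq_bigr => i _.
  by rewrite prkk hkk.
pose kap0 : {linear K0 -> F0} := r \o (kk \o vK).
have vkap0 z : v (kap0 z) = kk (vK z) by rewrite /kap0 /= vrkk rvK.
have ikap0 : injective kap0.
  by move=> x y /(congr1 v); rewrite !vkap0 => /ikk /(congr1 rK); rewrite !rvK.
have fF0 : fin_gen F0.
  apply: (fin_gen_sum (s := s) (h := fun i => r \o inj i)) => x.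
  exists (fun i => pr i (v x)); rewrite -[LHS]rv -[in LHS](rv x) vr.
  by rewrite linear_sum.
have fK0 : fin_gen K0 by apply: fin_gen_sub ikap0 fF0.
have pD : projective D.
  move=> A B g q sg.
  have [l hl] := dchoice (fun i => @pF i _ _ g (q \o inj i) sg).
  have [h hh] := h4 A l; exists h => x.
  have [t ut /(_ t ut (fun _ => id)) ->] := h3 x.
  by rewrite !linear_sum; apply: eq_bigr => i _; rewrite hh hl.
have pF0 : projective F0 by apply: projective_retract pD; exists v, r.
have [ge hge] := rV_map (fun a => (xy a).1).
(* N1, the image of B1, is a finitely generated piece of W containing the W-components of the
   generators of N and the images of the attaching maps over s; goodness of W is applied to it. *)
pose B1 : {linear ('rV[R]_m * K0)%type -> W} := copair_fun ge (phi \o vK).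
have B1E x z : B1 (x, z) = ge x + phi (vK z) by [].
have [N1 [n1 [in1 hn1]]] := sub_exists (submod_im B1).
have fN1 : fin_gen N1.
  have [q hq] : exists q : {linear ('rV[R]_m * K0)%type -> N1}, forall x, n1 (q x) = B1 x.
    by apply: linear_lift_inj => // x; apply/hn1; exists x.
  apply: (fin_gen_surj (p := q)); last exact: fin_gen_prod (fin_gen_rV _ _) fK0.
  move=> y; have /hn1 [x hx] : exists z, n1 z = n1 y by exists y.
  by exists x; apply: in1; rewrite hq.
have [Z [a [b [[fZ eZ] ba]]]] := gW N1 n1 fN1.
have [psi hpsi] : exists psi : {linear K0 -> N1}, forall x, n1 (psi x) = (phi \o vK) x.
  by apply: linear_lift_inj => // x; apply/hn1; exists (0, x); rewrite B1E linear0 add0r.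
(* The same cells are now attached to Z in place of W. E is an extension of F0 / K0 by Z, and F0 /
   K0 is orthogonal to S because maps from K0 into members of S extend to F0. *)
have [C0 [c0 e0]] := coker_ses ikap0; have [_ sc0 _] := e0.
have [E [jE [lE [tE [eE jlE _ univE _]]]]] := pushout (a \o psi) e0.
have [tau [tauj taul]] : exists tau : {linear E -> W'},
    (forall x, tau (jE x) = (io \o b) x) /\ forall x, tau (lE x) = (dl \o v) x.
  by apply: univE => x; rewrite /= ba hpsi /= vkap0 rel.
pose th : {linear (N1 * F0)%type -> W'} := copair_fun (io \o n1) (dl \o v).
have thE n y : th (n, y) = io (n1 n) + dl (v y) by [].
have [Im [mm [imm hmm]]] := sub_exists (submod_im th).
have [th' hth'] : exists th' : {linear (N1 * F0)%type -> Im}, forall x, mm (th' x) = th x.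
  by apply: linear_lift_inj => // x; apply/hmm; exists x.
have sth' : surj th'.
  move=> y; have /hmm [x hx] : exists z, mm z = mm y by exists y.
  by exists x; apply: imm; rewrite hth'.
(* By [relE] a relation between N1 and F0 in W' comes from some z, which [vrkk] places in K0. It
   therefore holds in E as well, and the image of N1 x F0 in W' maps to E. *)
have [sg hsg] : exists sg : {linear Im -> E}, forall x,
    sg (th' x) = copair_fun (jE \o a) lE x.
  apply: factor_surj => // - [n y] /(congr1 mm); rewrite hth' linear0 thE.
  move=> /relE [z zn kz].
  have zE : z = vK (rK z) by apply: ikk; rewrite -vrkk kz -linearN rv.
  have -> : y = - kap0 (rK z).
    by apply: (can_inj rv); rewrite linearN vkap0 -zE kz opprK.
  rewrite -[LHS]/(jE (a n) + lE (- kap0 (rK z))) linearN -jlE /=.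
  have -> : psi (rK z) = n by apply: in1; rewrite hpsi /= -zE.
  by rewrite subrr.
have [u' hu'] : exists u' : {linear N -> Im}, forall x, mm (u' x) = u x.
  apply: linear_lift_inj => // x; apply/hmm.
  have [co ->] := he x; rewrite linear_sum.
  apply: (submod_sum _ (submod_im th)) => j _; rewrite linearZ.
  apply: (submodZ _ (submod_im th)).
  have /hn1 [nn hnn] : exists z, B1 z = (xy j).1.
    exists (delta_mx 0 j, 0); rewrite B1E !linear0 addr0 hge (bigD1 j) //= big1 ?addr0.
      by rewrite mxE !eqxx scale1r.
    by move=> j' /negPf jj; rewrite mxE jj andbF scale0r.
  by exists (nn, r (xy j).2); rewrite thE hnn vr -hs -hxy.
exists E, (sg \o u'), tau; split; last first.
  move=> x /=; have [[n y] hny] := sth' (u' x).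
  by rewrite -hu' -hny hsg hth' thE /copair_fun /= linearD tauj taul /= ba.
split; first exact: fin_gen_ext eE fZ (fin_gen_surj sc0 fF0).
move=> X SX; apply: (ext1_ext_l eE); first exact: eZ.
apply: (ext1_of_extend e0) => [|h]; first exact: projective_ext1.
have ext i : exists g : {linear F i -> X}, forall x, g (kap i x) = (h \o rK \o injK i) x.
  exact: hext.
have [g0 hg0] := dchoice ext.
have [G hG] := h4 X g0.
have Gkk z : G (kk z) = h (rK z).
  by apply: (DK_eq _ (G \o kk) (h \o rK)) => i x /=; rewrite hkk /= hG hg0.
by exists (G \o v) => x; rewrite /= vkap0 Gkk rvK.
Qed.
End Step.

Definition extends_to n K (i : {linear K -> 'rV[R]_n}) Y : Prop :=
  forall f : {linear K -> Y}, exists g : {linear 'rV[R]_n -> Y}, forall x, g (i x) = f x.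

(** Submodules of R^n represent all monomorphisms into finite free modules, which keeps the index
    type of cells small. The extension property says that the quotient of R^n by the submodule is
    left orthogonal to S. *)
Record cell := Cell {
  cell_rank : nat;
  cell_set : 'rV[R]_cell_rank -> Prop;
  cell_submod : submod cell_set;
  cell_ext : forall Y, S Y ->
    extends_to (val : {linear submod_type cell_submod -> 'rV[R]_cell_rank}) Y
}.

Definition cell_obj (c : cell) : lmodType R := submod_type (cell_submod c).
Definition cell_inj (c : cell) : {linear cell_obj c -> 'rV[R]_(cell_rank c)} := val.

(** Each stage attaches all cells along all maps into the kernel of p. The domain of a cell is
    finitely generated, so a map from it into the union lives at a finite stage and extends at the
    next one; this is why countably many stages suffice. Goodness reaches the union for the same
    reason. *)
Lemma small_object W0 Y (p0 : {linear W0 -> Y}) :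
  exists W (iota : {linear W0 -> W}) (p : {linear W -> Y}),
  [/\ injective iota, forall x, p (iota x) = p0 x,
      forall n K (i : {linear K -> 'rV[R]_n}), injective i ->
        (forall X, S X -> extends_to i X) ->
        forall f : {linear K -> W}, (forall x, p (f x) = 0) ->
        exists g : {linear 'rV[R]_n -> W}, (forall x, g (i x) = f x) /\ forall x, p (g x) = 0
    & good W0 -> good W].
Proof.
pose T := {W : lmodType R & {linear W -> Y}}.
pose step (s s' : T) := exists iota : {linear tag s -> tag s'},
  [/\ injective iota, forall x, tagged s' (iota x) = tagged s x,
      forall c (f : {linear cell_obj c -> tag s}), (forall x, tagged s (f x) = 0) ->
        exists g : {linear 'rV[R]_(cell_rank c) -> tag s'},
          (forall x, g (cell_inj c x) = iota (f x)) /\ forall x, tagged s' (g x) = 0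
    & good (tag s) -> good (tag s')].
have next s : exists s', step s s'.
  case: s => W p.
  pose I := {c : cell & {f : {linear cell_obj c -> W} | forall x, p (f x) = 0}}.
  have [||||W' [iota [p' [h1 h2 h3 h4]]]] := @attach_cells {classic I}
    (fun i => cell_obj (tag i)) (fun i => 'rV[R]_(cell_rank (tag i)) : lmodType R)
    (fun i => cell_inj (tag i)) _ _ _ W Y p (fun i => sval (tagged i)) _.
  - by move=> i; exact: val_inj.
  - by move=> i; exact: fin_gen_rV.
  - by move=> i; exact: projective_rV.
  - by move=> [c [f hf]]; exact: hf.
  exists (existT _ W' p'), iota; split=> //.
    move=> c f hf; have [g hg] := h3 (existT _ c (exist _ f hf) : I).
    by exists g.
  by apply: h4 => i X SX; exact (@cell_ext (tag i) X SX).
have [nx hnx] := choice next.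
pose s n := iter n nx (existT _ W0 p0 : T).
pose M n := tag (s n).
have [t ht] := dchoice (fun n => hnx (s n)).
have ti n : injective (t n) by case: (ht n).
have [C [i [ii it isur]]] := colimit_exists ti.
have [p hp] := colimit_map ii it isur (p := fun n => tagged (s n))
  (fun n x => let: And4 _ h _ _ := ht n in h x).
exists C, (i 0%N), p; split=> //.
- exact (ii 0%N).
- by move=> x; exact (hp 0%N x).
- move=> n K a ia hext f pf.
  have fK : fin_gen K by apply: fin_gen_sub ia (fin_gen_rV R n).
  have [m [f' hf']] := colimit_fin_gen ii it isur f fK.
  (* K is replaced by its image in R^n, the form in which cells are indexed. *)
  have hS : submod (fun x => exists y, a y = x) by exact: submod_im.
  have [u hu] : exists u : {linear submod_type hS -> K}, forall x, a (u x) = val x.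
    apply: (linear_lift_inj (f := val : {linear submod_type hS -> _})) => // x.
    exact/asboolP/(valP x).
  have [v hv] : exists v : {linear K -> submod_type hS}, forall x, val (v x) = a x.
    apply: (linear_lift_inj (i := val : {linear submod_type hS -> _})) => [|x]; first exact: val_inj.
    have hx : a x \in submod_pred hS by apply/asboolP; exists x.
    by exists (exist (fun x => x \in submod_pred hS) (a x) hx).
  have uv x : u (v x) = x by apply: ia; rewrite hu hv.
  have ce X : S X -> extends_to (val : {linear submod_type hS -> 'rV[R]_n}) X.
    move=> SX h; have [g hg] := hext X SX (h \o v); exists g => x.
    transitivity (g (a (u x))); first by rewrite hu.
    by rewrite hg /=; congr (h _); apply: val_inj; rewrite hv hu.
  have [_ _ ext _] := ht m.
  have [|g [hg pg]] := ext (Cell ce) (f' \o u).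
    by move=> x /=; rewrite -hp hf' pf.
  exists (i m.+1 \o g); split=> x; last by rewrite -(pg x); exact: (hp m.+1).
  by rewrite /= -hv (hg (v x)) it /= uv hf'.
move=> g0; have gM n : good (M n).
  by elim: n => // n IH; case: (ht n) => _ _ _; exact.
move=> N f fN; have [m [f' hf']] := colimit_fin_gen ii it isur f fN.
have [Z [a [b [hZ ba]]]] := gM m N f' fN.
by exists Z, a, (i m \o b); split=> // x; rewrite /= ba hf'.
Qed.

End SmallObject.

Section Injectives.
Variable R : pzRingType.
Implicit Types A B C D E F I K L M N P Q T W X Y Z : lmodType R.

(** Baer's criterion. Partial extensions of f along g are the submodules of B x M that are graphs,
    so Zorn's lemma for submodules applies to them. *)
Lemma baer M :
  (forall K (i : {linear K -> R^o}) (f : {linear K -> M}), injective i ->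
     exists g : {linear R^o -> M}, forall x, g (i x) = f x) ->
  injective_mod M.
Proof.
move=> hM A B g f ig.
pose fun_graph (G : B * M -> Prop) := forall m, G (0, m) -> m = 0.
have [||| G [hG fG G0 Gmax]] := @zorn_submod R (B * M)%type fun_graph
  (fun z => exists x, pair_fun g f x = z).
- exact: submod_im.
- by move=> m [x [h <-]]; have -> : x = 0; [apply: ig; rewrite h linear0 | rewrite linear0].
- by move=> FF _ hFF _ _ m [G /hFF [_ h _]]; exact: h.
have tot b : exists m, G (b, m).
  pose J (r : R^o) := exists m, G ((r : R) *: b, m).
  have hJ : submod J.
    split; first by exists 0; rewrite scale0r; case: hG.
    move=> a r r' [m h] [m' h']; exists (a *: m + m').
    rewrite scalerDl -scalerA.
    have -> : (a *: ((r : R) *: b) + (r' : R) *: b, a *: m + m') =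
              a *: ((r : R) *: b, m) + ((r' : R) *: b, m') by [].
    by case: hG => _; apply.
  have [K [i [ii hi]]] := sub_exists hJ.
  have [u hu] : exists u : {linear K -> M}, forall x, G ((i x : R) *: b, u x).
    apply: (@linear_of_rel R K M (fun x m => G ((i x : R) *: b, m))).
    - move=> x; have /hi [m hm] : exists y, i y = i x by exists x.
      by exists m.
    - move=> a x m x' m' h h'; rewrite linearP scalerDl -scalerA.
      have -> : (a *: ((i x : R) *: b) + (i x' : R) *: b, a *: m + m') =
              a *: ((i x : R) *: b, m) + ((i x' : R) *: b, m') by [].
      by case: hG => _; apply.
    - by move=> m; rewrite linear0 scale0r; exact: fG.
  have [h hh] := hM K i u ii.
  exists (h 1).
  pose G' z := exists2 w, G w & exists r : R, z = w + r *: (b, h 1).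
  apply: (Gmax G').
  - exact: submod_adjoin.
  - move=> m [[x m'] Gw [r [/eqP]]]; rewrite eq_sym addrC addr_eq0 => /eqP rb ->.
    have Gn : G (r *: b, - m').
      by rewrite rb; exact: (submodN hG Gw).
    have /hi [y hy] : J r by exists (- m').
    have e : - m' = u y.
      apply/eqP; rewrite -subr_eq0; apply/eqP/fG.
      have := submodB hG Gn (hu y); rewrite hy.
      have -> : (r *: b, - m') - (r *: b, u y) = (r *: b - r *: b, - m' - u y) by [].
      by rewrite subrr.
    have -> : r *: h 1 = u y.
      by rewrite -hh hy -linearZ; congr (h _); exact: mulr1.
    by rewrite -e subrr.
  - by move=> w Gw; exists w => //; exists 0; rewrite scale0r addr0.
  - by exists 0; [case: hG | exists 1; rewrite scale1r add0r].
have [h hh] : exists h : {linear B -> M}, forall b, G (b, h b).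
  apply: (@linear_of_rel R B M (fun b m => G (b, m))) => //.
  move=> a x m x' m' h h'.
  have -> : (a *: x + x', a *: m + m') = a *: (x, m) + (x', m') by [].
  by case: hG => _; apply.
exists h => x; apply/eqP; rewrite -subr_eq0; apply/eqP/fG.
have Gx : G (g x, f x) by apply: G0; exists x.
have := submodB hG (hh (g x)) Gx.
have -> : (g x, h (g x)) - (g x, f x) = (g x - g x, h (g x) - f x) by [].
by rewrite subrr.
Qed.

Lemma injective_retract I M : retract M I -> injective_mod I -> injective_mod M.
Proof.
move=> [u [v vu]] hI A B g f ig; have [h hh] := hI _ _ g (u \o f) ig.
by exists (v \o h) => x; rewrite /= hh /= vu.
Qed.

Lemma injective_prod I M : injective_mod I -> injective_mod M -> injective_mod (I * M)%type.
Proof.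
move=> hI hM A B g f ig; have [h hh] := hI _ _ g (fst \o f) ig.
have [k hk] := hM _ _ g (snd \o f) ig; exists (pair_fun h k) => x.
by rewrite -[LHS]/(h (g x), k (g x)) hh hk /=; case: (f x).
Qed.

Hypothesis noeth : forall M, fin_gen M -> noetherian M.

(** For the empty class every submodule of R^n is a cell, and over the zero module the extension
    property of W contains Baer's criterion. *)
Lemma enough_injectives M : exists I (i : {linear M -> I}), injective_mod I /\ injective i.
Proof.
have [W [iota [p [h1 _ h3 _]]]] :=
  small_object noeth (fun=> False) (\0 : {linear M -> ('rV[R]_0 : lmodType R)}).
exists W, iota; split=> //; apply: baer => K i f ii.
have [r hr] := rV_tuple (fun _ : 'I_1 => idfun : {linear R^o -> R^o}).
have [|||g [hg _]] := h3 1%N K (r \o i) _ _ f.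
- apply: inj_comp ii => x y; rewrite !hr => /rowP /(_ ord0).
  by rewrite !mxE.
- by [].
- by move=> x; apply/rowP => - [].
by exists (g \o r) => x; rewrite -hg.
Qed.

Lemma injective_ses M : exists I C (i : {linear M -> I}) (p : {linear I -> C}),
  injective_mod I /\ ses i p.
Proof.
have [I [i [hI ii]]] := enough_injectives M; have [C [p e]] := coker_ses ii.
by exists I, C, i, p.
Qed.

End Injectives.

(** * Virtually Gorenstein algebras *)

Section WakamatsuLeft.
Variable R : pzRingType.
Implicit Types A B C D E F I K L M N P Q T U W X Y Z : lmodType R.

(** Dual to [wakamatsu_right]: the pullback of the extension along U -> L lies in S, so the lift of
    f to it that vanishes in E extends to U, and minimality corrects this extension to a section. *)
Lemma wakamatsu_left (S : lmodType R -> Prop) A U L (f : {linear A -> U})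
    (q : {linear U -> L}) :
  (forall A1 A A2 (i : {linear A1 -> A}) (p : {linear A -> A2}),
    ses i p -> S A1 -> S A2 -> S A) ->
  ses f q -> left_approx S f ->
  (forall g : {linear U -> U}, (forall x, g (f x) = f x) -> injective g /\ surj g) ->
  forall Z, S Z -> ext1 L Z.
Proof.
move=> Sext e [SU hf] fmin Z SZ; apply: ext1_of_section => E i p e'.
have [jf sq ex] := e.
have [Q [j [u [l [e2 pl univ]]]]] := pullback q e'.
have [a [la ua]] : exists a : {linear A -> Q},
    (forall x, l (a x) = (\0 : {linear A -> E}) x) /\ forall x, u (a x) = f x.
  by apply: univ => x; rewrite (ses0 _ e) linear0.
have [h hh] := hf Q a (Sext _ _ _ _ _ e2 SZ SU).
have [|ig sg] := fmin (u \o h); first by move=> x; rewrite /= hh ua.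
have [g [g1 g2]] := linear_inverse ig sg.
have gf x : g (f x) = f x by rewrite -[RHS]g1 /= hh ua.
have [t ht] : exists t : {linear L -> E}, forall x, t (q x) = (l \o (h \o g)) x.
  by apply: factor_surj => // x /ex [y <-]; rewrite /= gf hh la.
exists t => x; have [y <-] := sq x; rewrite ht /= pl.
by congr (q _); exact: (g2 y).
Qed.
End WakamatsuLeft.

Section VirtuallyGorenstein.
Variables (k : comPzRingType) (R : pzRingType) (iota : {rmorphism k -> R}).
Hypothesis hk : artinian k^o.
Hypothesis central : forall a r, iota a * r = r * iota a.
Hypothesis finite : exists (n : nat) (e : 'I_n -> R),
  forall r, exists c : 'I_n -> k, r = \sum_i iota (c i) * e i.
Implicit Types A B C D E F G I K L M N P Q T U W X Y Z : lmodType R.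

Let noeth M : fin_gen M -> noetherian M := @fin_gen_noetherian k R iota hk finite M.
Let artin M : fin_gen M -> dcc M := @fin_gen_dcc k R iota hk finite M.

(* E is a maximal essential extension of N inside I; it is a direct summand,
   complemented by any submodule maximal among those that meet E trivially. *)
Lemma fin_gen_injective_hull N I (i : {linear N -> I}) :
  injective_mod I -> injective i -> fin_gen N ->
  exists E (a : {linear N -> E}) (m : {linear E -> I}),
    [/\ fin_gen E, injective_mod E, injective m & forall x, m (a x) = i x].
Proof.
move=> hI ii fN.
pose ess (S : I -> Prop) := forall U : I -> Prop, submod U -> (forall x, U x -> S x) ->
  (exists2 x, U x & x <> 0) -> exists2 n, U (i n) & i n <> 0.
have [||S [hS eS NS Smax]] := @zorn_submod R I ess _ (submod_im i).
- move=> U hU Ui [x Ux nx]; have [n nE] := Ui x Ux.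
  by exists n; rewrite nE.
- move=> F _ FS tot _ U hU UF [x Ux nx]; have [S FS_ Sx] := UF x Ux.
  have [hS eS _] := FS S FS_.
  have [||n [Un _] nn] := eS (fun x => U x /\ S x) (submodI hU hS).
  + by move=> y [].
  + by exists x.
  by exists n.
have [E [m [mi hm]]] := sub_exists hS.
have [a ha] : exists a : {linear N -> E}, forall x, m (a x) = i x.
  by apply: linear_lift_inj => // x; apply/hm/NS; exists x.
have ia : injective a by move=> x y /(congr1 m); rewrite !ha => /ii.
have fE : fin_gen E.
  apply: (essential_fin_gen hk central finite ia) => // U hU [x Ux nx].
  have hV : submod (fun y => exists2 z, U z & m z = y).
    split; first by exists 0; [case: hU | rewrite linear0].
    move=> c _ _ [z Uz <-] [w Uw <-]; exists (c *: z + w); last by rewrite linearP.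
    by case: hU => _; apply.
  have [||n [z Uz zn] nn] := eS _ hV.
  - by move=> _ [z _ <-]; apply/hm; exists z.
  - by exists (m x); [exists x | rewrite -(linear0 m) => /mi].
  exists n; last by move=> h; apply: nn; rewrite -ha h linear0.
  by have <- : z = a n by apply: mi; rewrite zn ha.
have [||| V [hV VS _ Vmax]] := @zorn_submod R I
    (fun V => forall x, V x -> S x -> x = 0) (fun x => x = 0).
- exact: submod0.
- by [].
- by move=> F _ FS _ _ x [U /FS [_ h _]]; exact: h.
have [Q [q [sq hq]]] := quot_exists hV.
have iqm : injective (q \o m).
  apply: linear_inj => x /= /hq Vx; apply: mi; rewrite linear0; apply: VS => //.
  by apply/hm; exists x.
have [h hh] := hI _ _ (q \o m : {linear E -> Q}) m iqm.
have hqS x : S x -> h (q x) = x by move=> /hm [y <-]; exact: hh.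
have pre (U : I -> Prop) : submod U -> submod (fun x => U (h (q x))).
  move=> hU; split; first by rewrite !linear0; case: hU.
  by move=> c x y Ux Uy; rewrite !linearP; case: hU => _; apply.
have hqi x : h (q x) = 0 -> V x.
  apply: (Vmax (fun x => h (q x) = 0)).
  - exact: (pre _ (submod0 I)).
  - by move=> y hy /hqS <-.
  - by move=> y Vy; rewrite (hq y).2 ?linear0.
(* The image of h q contains S and is still essential over N: a submodule of it meeting S trivially
   has a preimage that contains V and meets S trivially, hence equals V, and so the submodule is
   zero. Maximality of S then gives the claim. *)
have hS' x : S (h (q x)).
  apply: (Smax (fun y => exists x, (h \o q) x = y)); last by exists x.
  - exact: submod_im.
  - move=> U hU US [_ /[dup] /US [y /= <-] Uy ny].
    have [[s Ss [Us ns]]|no] := pselect (exists2 s, S s & U (h (q s)) /\ s <> 0).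
      rewrite hqS // in Us.
      have [||n [Un _] nn] := eS (fun x => U x /\ S x) (submodI hU hS).
      - by move=> z [].
      - by exists s.
      by exists n.
    case: ny; rewrite (hq y).2 ?linear0 //.
    apply: (Vmax (fun x => U (h (q x)))) => //; first exact: pre.
      by move=> z Uz Sz; apply: contrapT => nz; apply: no; exists z.
    by move=> z Vz; rewrite (hq z).2 ?linear0 //; case: hU.
  - by move=> y Sy; exists y; exact: hqS.
have [r hr] : exists r : {linear I -> E}, forall x, m (r x) = (h \o q) x.
  by apply: linear_lift_inj => // x; apply/hm/hS'.
exists E, a, m; split=> //; apply: injective_retract hI.
by exists m, r => x; apply: mi; rewrite hr; exact: hh.
Qed.

Lemma fin_gen_embedding N : fin_gen N -> exists E (a : {linear N -> E}),
  [/\ fin_gen E, injective_mod E & injective a].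
Proof.
move=> fN; have [I [i [hI ii]]] := enough_injectives noeth N.
have [E [a [m [fE hE im ma]]]] := fin_gen_injective_hull hI ii fN.
by exists E, a; split=> // x y /(congr1 m); rewrite !ma => /ii.
Qed.

Definition right_perp (S : lmodType R -> Prop) Y : Prop := forall Z, S Z -> ext1 Z Y.

Local Notation T := (fin_perp (@GInj R)).

Lemma GInj_ext1 I Y : injective_mod I -> GInj Y -> ext1 I Y.
Proof. by move=> hI /gi_class_GInj [h _ _]; exact: h. Qed.

(* Partial sections of E -> I correspond to submodules of E that do not meet Y;
   among those which are injective modules a maximal one is a section. *)
Lemma ext1_injective I Y : injective_mod I -> right_perp T Y -> ext1 I Y.
Proof.
move=> hI hY; apply: ext1_of_section => E j p e; have [ij sp ex] := e.
(* Injectivity of the submodule S in Baer's form. As a property of subsets of E it passes to unions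
   of chains, because left ideals are finitely generated. *)
pose inj_sub (S : E -> Prop) := forall K (i : {linear K -> R^o}) (f : {linear K -> E}),
  injective i -> (forall x, S (f x)) ->
  exists g : {linear R^o -> E}, (forall x, g (i x) = f x) /\ forall x, S (g x).
have inj_im G (m : {linear G -> E}) : injective m -> injective_mod G ->
    inj_sub (fun x => exists y, m y = x).
  move=> im hG K i f ii hf; have [f' hf'] := linear_lift_inj im hf.
  have [g hg] := hG _ _ i f' ii; exists (m \o g).
  by split=> x /=; [rewrite hg hf' | exists (g x)].
have [||| S [hS [dS iS] _ Smax]] := @zorn_submod R E
    (fun S => (forall x, S x -> p x = 0 -> x = 0) /\ inj_sub S) (fun x => x = 0).
- exact: submod0.
- by split=> // K i f _ f0; exists \0; split=> // x; rewrite f0.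
- move=> F F0 FS tot _; split; first by move=> x [S /FS [_ [h _] _]]; exact: h.
  move=> K i f ii hf.
  have [m [e' he]] := fin_gen_sub hk finite ii (fin_gen_regular R).
  have [S FSS Se] := chain_fin F0 tot (fun a => hf (e' a)).
  have [hS [_ iS] _] := FS S FSS.
  have [x|g [hg Sg]] := iS K i f ii; last by exists g; split=> // x; exists S.
  have [c ->] := he x; rewrite linear_sum; apply: submod_sum => // a _.
  by rewrite linearZ; apply: submodZ.
have [G [m [im hm]]] := sub_exists hS.
have hG : injective_mod G.
  apply: baer => K i f ii; have [x|g [hg Sg]] := iS K i (m \o f) ii.
    by apply/hm; exists (f x).
  have [g' hg'] := linear_lift_inj im (fun x => (hm (g x)).1 (Sg x)).
  by exists g' => x; apply: im; rewrite hg' hg.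
have ipm : injective (p \o m).
  apply: linear_inj => x h; apply: im; rewrite linear0; apply: dS => //.
  by apply/hm; exists x.
have [rho hrho] := hG _ _ (p \o m : {linear G -> I}) idfun ipm.
have [spm|/existsNP [x nx]] := pselect (surj (p \o m)).
  have [t [_ t2]] := linear_inverse ipm spm.
  by exists (m \o t) => x; exact: t2.
(* If p m is not onto, its image has the complement I2 = ker rho, which contains x' <> 0. A finitely
   generated injective submodule of I2 containing x' lies in T, so it lifts to E, and adding the
   lift enlarges S. *)
pose x' := x - p (m (rho x)).
have rx' : rho x' = 0 by rewrite /x' linearB [X in _ - X]hrho subrr.
have nx' : x' <> 0.
  by move=> /eqP; rewrite subr_eq0 => /eqP xE; apply: nx; exists (rho x).
have [I2 [v [iv hv]]] := sub_exists (submod_ker rho).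
have [w hw] : exists w : {linear I -> I2}, forall y,
    v (w y) = (idfun \- ((p \o m) \o rho)) y.
  apply: linear_lift_inj => // y; apply/hv; rewrite linearB [X in _ - X]hrho.
  exact: subrr.
have rv y : rho (v y) = 0 by apply/hv; exists y.
have hI2 : injective_mod I2.
  apply: injective_retract hI; exists v, w => y; apply: iv.
  by rewrite hw /= rv !linear0 addr0.
have [y0 hy0] : exists y, v y = x' by apply/hv.
have [f hf] := rV_map (fun _ : 'I_1 => y0).
have [N [n [inn hn]]] := sub_exists (submod_im f).
have fN : fin_gen N.
  have [g hg] := linear_lift_inj inn (fun x => (hn (f x)).1 (ex_intro _ x erefl)).
  apply: (fin_gen_surj (p := g)) (fin_gen_rV R 1) => y.
  have /hn [z hz] : exists z, n z = n y by exists y.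
  by exists z; apply: inn; rewrite hg.
have [E2 [a [m2 [fE2 hE2 im2 m2a]]]] := fin_gen_injective_hull hI2 inn fN.
have TE2 : T E2 by split=> // D hD; exact: GInj_ext1.
have [s hs] := ext1_lift (v \o m2) (hY E2 TE2) e.
have hs' y : p (s y) = v (m2 y) := hs y.
have dG g y : p (m g) + v (m2 y) = 0 -> g = 0 /\ y = 0.
  move=> h; have g0 : g = 0.
    by have := congr1 rho h; rewrite linearD rv addr0 linear0 => <-; exact/esym/hrho.
  split=> //; apply: im2; apply: iv; move: h; rewrite g0 !linear0 add0r => ->.
  by [].
pose c : {linear (G * E2)%type -> E} := copair_fun m s.
have cE g y : c (g, y) = m g + s y by [].
have ic : injective c.
  apply: linear_inj => - [g y] h.
  have [|-> ->] := dG g y; last by [].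
  by rewrite -hs' -linearD -cE h linear0.
have [y1 hy1] : exists y, m2 y = y0.
  have /hn [z hz] : exists z, f z = y0.
    by exists (delta_mx 0 0); rewrite hf big_ord1 mxE !eqxx scale1r.
  by exists (a z); rewrite m2a.
have Ssy : S (s y1).
  apply: (Smax (fun x => exists y, c y = x)).
  - exact: submod_im.
  - split; last by apply: inj_im ic _; exact: injective_prod.
    move=> _ [[g y] <-]; rewrite cE linearD hs' => /dG [-> ->].
    by rewrite !linear0 addr0.
  - by move=> _ /hm [g <-]; exists (g, 0); rewrite cE linear0 addr0.
  - by exists (0, y1); rewrite cE linear0 add0r.
have /hm [g hg] := Ssy.
have [|_ y10] := dG (- g) y1.
  by rewrite !linearN hg hs' addNr.
by case: nx'; rewrite -hy0 -hy1 y10 !linear0.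
Qed.

Lemma fin_perp_syzygy Z K P (i : {linear K -> P}) (p : {linear P -> Z}) :
  ses i p -> projective P -> fin_gen P -> T Z -> T K.
Proof.
move=> e hP fP [fZ hZ]; split; first by have [ii _ _] := e; exact: (fin_gen_sub hk finite) ii fP.
move=> Y /gi_class_GInj [_ _ [I [C [a [q [hC hI e']]]]]].
exact: ext1_shift_down e hP e' hI (hZ C hC).
Qed.

Lemma fin_perp_coker Z E C (i : {linear Z -> E}) (p : {linear E -> C}) :
  ses i p -> T Z -> T E -> T C.
Proof.
move=> e [fZ hZ] [fE hE]; split; first by have [_ sp _] := e; exact: fin_gen_surj sp fE.
move=> Y hY; have [_ [K [I [a [q [hK hI e']]]]] _] := gi_class_GInj hY.
exact: ext1_coker_l e e' hI (hZ K hK) (hE Y hY).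
Qed.

Lemma fin_perp_retract X Y : retract X Y -> T Y -> T X.
Proof.
move=> r [fY hY]; split; first exact: fin_gen_retract r fY.
by move=> D hD; apply: ext1_stable_retract (retract_stable_retract r) (hY D hD).
Qed.

Lemma fin_perp_ext A1 A A2 (i : {linear A1 -> A}) (p : {linear A -> A2}) :
  ses i p -> T A1 -> T A2 -> T A.
Proof.
move=> e [f1 h1] [f2 h2]; split; first exact: fin_gen_ext e f1 f2.
by move=> Y hY; apply: ext1_ext_l e (h1 Y hY) (h2 Y hY).
Qed.

Lemma fin_perp_projective P : fin_gen P -> projective P -> T P.
Proof. by move=> fP hP; split=> // Y _; exact: projective_ext1. Qed.

Lemma fin_perp_injective I : fin_gen I -> injective_mod I -> T I.
Proof. by move=> fI hI; split=> // Y hY; exact: GInj_ext1. Qed.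

(** A map from a left ideal to W factors through some Z in T. Embed Z into a finitely generated
    injective J: since J / Z is in T, the map Z -> W extends to J, and the map from the ideal to J
    extends to R. *)
Lemma good_injective W : good (@GInj R) W -> right_perp T W -> injective_mod W.
Proof.
move=> gW hW; apply: baer => K i f ii.
have fK := fin_gen_sub hk finite ii (fin_gen_regular R).
have [Z [a [b [TZ ba]]]] := gW K f fK.
have [J [j [fJ hJ ij]]] := fin_gen_embedding TZ.1.
have [C [q e]] := coker_ses ij.
have [g hg] := ext1_extend b (hW C (fin_perp_coker e TZ (fin_perp_injective fJ hJ))) e.
have [h hh] := hJ _ _ i (j \o a) ii.
by exists (g \o h) => x; rewrite /= hh /= hg ba.
Qed.

(** The small object argument is started at a free cover, which is good since maps from finitely
    generated modules pass through finite free modules; the extension property it yields is the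
    orthogonality of the kernel to T. *)
Lemma right_perp_cover Y : exists K W (i : {linear K -> W}) (p : {linear W -> Y}),
  [/\ ses i p, good (@GInj R) W & right_perp T K].
Proof.
have [D [p0 [sp0 hD fD]]] := free_cover Y.
have gD : good (@GInj R) D.
  move=> N f fN; have [n [a [b [c [_ ba]]]]] := fD N f fN.
  exists ('rV[R]_n), a, b; split=> //.
  by apply: fin_perp_projective; [exact: fin_gen_rV | exact: projective_rV].
have [W [io [p [iio pio ext gW]]]] := small_object noeth (@GInj R) p0.
have sp : surj p by move=> y; have [x <-] := sp0 y; exists (io x).
have [K [i e]] := ker_ses sp; have [ii _ exK] := e.
exists K, W, i, p; split=> //; first exact: gW.
move=> Z [fZ hZ]; have [n [L [j [q [e' _]]]]] := fin_presentation hk finite fZ.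
apply: (ext1_of_extend e') => [|f]; first exact/projective_ext1/projective_rV.
have [ij _ _] := e'.
have [||g [hg pg]] := ext n L j ij _ (i \o f).
- by move=> X hX h; exact: ext1_extend (hZ X hX) e'.
- by move=> x /=; rewrite (ses0 _ e).
have [g' hg'] : exists g' : {linear 'rV[R]_n -> K}, forall x, i (g' x) = g x.
  by apply: linear_lift_inj => // x; apply/exK.
by exists g' => x; apply: ii; rewrite hg' hg.
Qed.

(** Coinduction on the right perpendicular class itself. The cover W of Y is injective: it is good
    and, as an extension of Y by K, right orthogonal to T. *)
Lemma right_perp_GInj Y : right_perp T Y -> GInj Y.
Proof.
move=> hY; apply: (GInj_of_class (S := right_perp T)) hY => {}Y hY; split.
- by move=> I hI; exact: ext1_injective.
- have [K [W [i [p [e gW hK]]]]] := right_perp_cover Y.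
  exists K, W, i, p; split=> //; apply: good_injective => // Z hZ.
  have [L [P [l [x [hP e']]]]] := cover_ses Z.
  exact: ext1_ext_r e e' hP (hK Z hZ) (hY Z hZ).
- have [I [C [i [p [hI e]]]]] := injective_ses noeth Y.
  exists I, C, i, p; split=> // Z hZ.
  have [n [L [j [q [e' _]]]]] := fin_presentation hk finite hZ.1.
  have hP := projective_rV (R := R) (n := n).
  apply: (ext1_coker_r e e' hP); last exact: injective_ext1.
  exact/hY/(fin_perp_syzygy e' hP (fin_gen_rV R n)).
Qed.

Lemma good_of_left_perp Y : (forall D, GInj D -> ext1 Y D) -> good (@GInj R) Y.
Proof.
move=> hY; have [K [W [i [p [e gW /right_perp_GInj hK]]]]] := right_perp_cover Y.
exact: good_retract (ext1_split e (hY K hK)) gW.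
Qed.

Hypothesis vG : virtually_Gorenstein R.

(** [GProj] has syzygies and [GInj] has cosyzygies inside the class, so on both sides the condition
    in degree one implies it in all degrees. *)
Lemma virtually_Gorenstein_ext1 A :
  (forall X, GProj X -> ext1 X A) <-> (forall D, GInj D -> ext1 A D).
Proof.
split=> h.
  have /(vG A).1 h' : forall n X, (1 <= n)%N -> GProj X -> Ext_zero n X A.
    move=> n X n1 hX; suff hp : perp X A by exact: ((perpP X A).2 hp).
    move: X hX => {n n1}; apply: perp_class => X hX; split; first exact: h.
    have [_ [K [P [i [p [hK hP e]]]]] _] := gp_class_GProj hX.
    by exists K, P, i, p.
  by move=> D hD; exact: ((Ext_zero_vanish 0 A D).1 (h' 1%N D isT hD)).
have /(vG A).2 h' : forall n Y, (1 <= n)%N -> GInj Y -> Ext_zero n A Y.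
  move=> n Y n1 hY; suff hp : perp A Y by exact: ((perpP A Y).2 hp).
  move: hY; move: Y => {n n1} Y hY.
  apply: (perp_class (S := fun A => forall D, GInj D -> ext1 A D)) h => {}A h.
  split; first exact: h.
  have [K [P [i [p [hP e]]]]] := cover_ses A.
  exists K, P, i, p; split=> // D /gi_class_GInj [_ _ [I [C [j [q [hC hI e']]]]]].
  exact: ext1_shift_down e hP e' hI (h C hC).
by move=> X hX; exact: ((Ext_zero_vanish 0 X A).1 (h' 1%N X isT hX)).
Qed.

(** Quotients of R^n represent all finitely generated modules up to isomorphism, so the maps from A
    to members of T get a small type over which a product can be formed. *)
Record quotient_map A := QuotientMap {
  qm_rank : nat;
  qm_set : 'rV[R]_qm_rank -> Prop;
  qm_submod : submod qm_set;
  qm_perp : T (quotmod_type qm_submod);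
  qm_map : {linear A -> quotmod_type qm_submod}
}.

(* The product of all maps from A to members of T is right orthogonal to the
   Gorenstein-projectives, so the map from A to it factors through T. *)
Lemma left_approx_exists A : fin_gen A -> exists Z (f : {linear A -> Z}), left_approx T f.
Proof.
move=> fA.
have [P [pr [prI prS]]] :=
  prod_exists (fun q : quotient_map A => quotmod_type (qm_submod q) : lmodType R).
have [F hF] := prod_pair prI prS (fun q => qm_map q).
have /good_of_left_perp gP : forall D, GInj D -> ext1 P D.
  apply/virtually_Gorenstein_ext1 => X hX.
  have [K [Q [i [p [hQ e]]]]] := cover_ses X.
  apply: (ext1_of_extend e) => [|f]; first exact: projective_ext1.
  have ext q : exists g : {linear Q -> (quotmod_type (qm_submod q) : lmodType R)},
      forall x, g (i x) = (pr q \o f) x.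
    apply: ext1_extend e; move: X hX {i p}; apply/virtually_Gorenstein_ext1.
    by case: (qm_perp q).
  have [g0 hg0] := dchoice ext.
  have [g hg] := prod_pair prI prS g0.
  by exists g => x; apply: prI => q; rewrite hg hg0.
have [Z [a [b [TZ ba]]]] := gP A F fA.
exists Z, a; split=> // Y g TY.
have [n [q sq]] := (fin_genP Y).1 TY.1.
have hS := submod_ker q.
have [c hc] : exists c : {linear 'rV[R]_n -> quotmod_type hS}, forall x, c x = quot_proj hS x.
  by apply: linear_of_fun => r x y; exact: quot_proj_linear.
have sc : surj c by move=> x; exists (val x); rewrite hc quot_projK.
have kc x : c x = 0 <-> q x = 0 by rewrite hc quot_proj0.
have [u hu] : exists u : {linear Y -> quotmod_type hS}, forall x, u (q x) = c x.
  by apply: factor_surj => // x /kc.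
have [v hv] : exists v : {linear quotmod_type hS -> Y}, forall x, v (c x) = q x.
  by apply: factor_surj => // x /kc.
have vu x : v (u x) = x by have [y <-] := sq x; rewrite hu hv.
have uv x : u (v x) = x by have [y <-] := sc x; rewrite hv hu.
have TQ : T (quotmod_type hS) by apply: fin_perp_retract TY; exists v, u.
exists (v \o (pr (QuotientMap TQ (u \o g)) \o b)) => x /=.
by rewrite ba (hF x (QuotientMap TQ (u \o g))) /= vu.
Qed.

(** A minimal T-approximation is injective because A embeds into a finitely generated injective, a
    member of T; Wakamatsu's lemma controls its cokernel. *)
Lemma special_left_approx A : fin_gen A -> exists Z L (f : {linear A -> Z}) (q : {linear Z -> L}),
  [/\ ses f q, T Z & forall Y, T Y -> ext1 L Y].
Proof.
move=> fA; have [Z0 [f0 hf0]] := left_approx_exists fA.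
have [fZ0 _] := hf0.1.
have [Z [f [hf fmin]]] := minimal_left_approx fin_perp_retract (noeth fZ0) (artin fZ0) hf0.
have if_ : injective f.
  have [I [j [fI hI ij]]] := fin_gen_embedding fA.
  have [h hh] := hf.2 I j (fin_perp_injective fI hI).
  by move=> x y /(congr1 h); rewrite !hh => /ij.
have [L [q e]] := coker_ses if_.
exists Z, L, f, q; split=> //; first by case: hf.
exact: wakamatsu_left fin_perp_ext e hf fmin.
Qed.

Let left_T X := fin_gen X /\ forall Y, T Y -> ext1 X Y.

(** Coinduction on the left perpendicular class of T. For the cosyzygy, the middle term Z of a
    special approximation lies in T and, as an extension of L by X, is left orthogonal to T; its
    syzygy is in T, so its presentation splits and Z is projective. *)
Lemma left_T_GProj X : left_T X -> GProj X.
Proof.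
apply: (GProj_of_class (S := left_T)) => {}X [fX hX].
have TR : T R^o by apply: fin_perp_projective; [exact: fin_gen_regular | exact: projective_regular].
split.
- by move=> Q hQ; apply: (ext1_free hk finite) => //; exact: hX.
- have [n [K [i [p [e fK]]]]] := fin_presentation hk finite fX.
  have hP := projective_rV (R := R) (n := n).
  exists K, ('rV[R]_n), i, p; split=> //; split=> // Y TY.
  have [I [j [fI hI ij]]] := fin_gen_embedding TY.1.
  have [C [q e']] := coker_ses ij.
  apply: (ext1_shift_down e hP e' hI); apply: hX.
  exact: fin_perp_coker e' TY (fin_perp_injective fI hI).
have [Z [L [f [q [e TZ hL]]]]] := special_left_approx fX.
have fL : fin_gen L by have [_ sq _] := e; exact: fin_gen_surj sq TZ.1.
exists Z, L, f, q; split=> //.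
have hZ Y : T Y -> ext1 Z Y.
  by move=> TY; apply: ext1_ext_l e (hX Y TY) (hL Y TY).
have [n [K [i [p [e' fK]]]]] := fin_presentation hk finite TZ.1.
have hP := projective_rV (R := R) (n := n).
exact: projective_retract (ext1_split e' (hZ K (fin_perp_syzygy e' hP (fin_gen_rV R n) TZ))) hP.
Qed.

(* Salce's pushout of the syzygy sequence of A along a special left
   approximation of the syzygy. *)
Lemma virtually_Gorenstein_contravariantly_finite : contravariantly_finite (@Gproj R).
Proof.
move=> A fA; have [n [K [i [p [e fK]]]]] := fin_presentation hk finite fA.
have [Z [L [f [q [e' TZ hL]]]]] := special_left_approx fK.
have [G [j [l [u [e2 _ _ _ /(_ _ _ e') [t e1]]]]]] := pushout f e.
have hG : left_T G.
  split; first exact: fin_gen_ext e2 TZ.1 fA.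
  move=> Y TY; apply: (ext1_ext_l e1); last exact: hL.
  exact/projective_ext1/projective_rV.
exists G, u; split; first by split; [case: hG | exact: left_T_GProj].
(* Maps X -> A lift to G because Ext^1(X, Z) = 0: by hypothesis Z, being left orthogonal to [GInj],
   is right orthogonal to [GProj]. *)
move=> X h [_ gX]; apply: ext1_lift e2.
by move: X gX {h}; apply/virtually_Gorenstein_ext1; case: TZ.
Qed.

End VirtuallyGorenstein.

(** * Right modules over an algebra *)

Section Converse.
Variables (k : comPzRingType) (L : algType k).

(** The structure map of the algebra read in the converse ring. Its centrality and the finiteness of
    L over k are the form in which the preceding sections receive the algebra structure. *)
Definition converse_in_alg (a : k) : L^c := a%:A.

Fact converse_in_alg_additive : zmod_morphism converse_in_alg.
Proof. by move=> a b; exact: scalerBl. Qed.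

Fact converse_in_alg_multiplicative : monoid_morphism converse_in_alg.
Proof.
split; first exact: scale1r.
move=> a b; rewrite /converse_in_alg -[RHS]/((b%:A : L) * (a%:A : L)).
by rewrite mulr_algl scalerA mulrC.
Qed.

HB.instance Definition _ :=
  GRing.isZmodMorphism.Build k L^c converse_in_alg converse_in_alg_additive.
HB.instance Definition _ :=
  GRing.isMonoidMorphism.Build k L^c converse_in_alg converse_in_alg_multiplicative.

Lemma converse_in_algE a (x : L) : converse_in_alg a * (x : L^c) = a *: x.
Proof. by rewrite -[LHS]/(x * (a%:A : L)) mulr_algr. Qed.

Lemma converse_in_alg_central a (x : L^c) : converse_in_alg a * x = x * converse_in_alg a.
Proof. by rewrite converse_in_algE -[RHS]/((a%:A : L) * (x : L)) mulr_algl. Qed.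

Lemma converse_finite : fin_gen (L : lmodType k) -> exists (n : nat) (e : 'I_n -> L^c),
  forall r, exists c : 'I_n -> k, r = \sum_i converse_in_alg (c i) * e i.
Proof.
move=> [n [e he]]; exists n, e => r; have [c ->] := he r; exists c.
by apply: eq_bigr => i _; rewrite converse_in_algE.
Qed.

End Converse.

Theorem theorem5p2 (k : comPzRingType) (L : algType k)
    (hL : artin_algebra L) :
  (virtually_Gorenstein L^c -> contravariantly_finite (@Gproj L^c)) /\
  (finite_CM_type L^c -> contravariantly_finite (@Gproj L^c)) /\
  (contravariantly_finite (@Gproj L^c) ->
   [<-> (* (i) *)
        forall A : lmodType L^c, perp_ring A <-> Gproj A;
        (* (ii) *)
        forall A : lmodType L^c, (perp_ring A /\ Gproj_perp A) <-> proj A;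
        (* (iii) *)
        finite_rep_type (fun A : lmodType L^c => perp_ring A /\ Gproj_perp A)]).
Proof.
have [hk fL] := hL.
have central := @converse_in_alg_central k L.
have finite := converse_finite fL.
split; first exact: (virtually_Gorenstein_contravariantly_finite hk central finite).
split; first exact: (finite_CM_contravariantly_finite hk central finite).
move=> hcf; tfae.
- move=> h A; split; last exact: (proj_core hk finite).
  by move=> [pA qA]; exact: (core_proj hk finite (conj pA qA) ((h A).1 pA)).
- move=> h; have [n [M hM]] := proj_finite_rep_type hk finite.
  by exists n, M => A /h; exact: hM.
move=> h A; split; last exact: Gproj_perp_ring.
exact: (perp_ring_Gproj_of_finite hk central finite hcf h).
Qed.
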